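(* There is a universal constant $c$ such that the following holds. Let $z_0=(x_0,t_0)\in\mathbb{R}^3\times\mathbb{R}$ and let $(u,p)$ be a suitable weak solution to the Navier-Stokes equations in $Q(z_{0},1)$. Then for every $0<r<1$, $$A(z_{0},r/2;u)+ B(z_0,r/2;u)\leqslant c\left( C_{\infty}(z_{0},r;u)^{\frac{4}{3}}+C_{\infty}(z_{0},r;u)^{\frac{2}{3}}+D_{\infty}(z_{0},r;p)^{\frac{4}{3}}\right).$$
   Context: Notation. $B(x_0,R)=\{x\in\mathbb{R}^3:|x-x_0|<R\}$, $Q(z_0,R)=B(x_0,R)\times]t_0-R^2,t_0[$. Weak Lebesgue spaces: $\|g\|_{L^{p,\infty}(\Omega)}=\sup_{\alpha>0}\alpha\,|\{x\in\Omega:|g(x)|>\alpha\}|^{1/p}$. Scale-invariant quantities: $$A(z_{0},r;u)= \sup_{t_{0}-r^2\leqslant t\leqslant t_0}r^{-1}\int_{B(x_{0},r)}|u(x,t)|^2dx,\qquad B(z_{0},r;u)=r^{-1}\int_{Q(z_{0},r)}|\nabla u|^2dxdt,$$ $$C_{\infty}(z_{0},r;u)= r^{-2}\int_{t_{0}-r^2}^{t_0}\|u(\cdot,t)\|_{L^{3,\infty}(B(x_0,r))}^3 dt,\qquad D_{\infty}(z_0,r;p)=r^{-2}\int_{t_0-r^2}^{t_0}\|p(\cdot,t)\|_{L^{\frac{3}{2},\infty}(B(x_{0},r))}^{\frac{3}{2}}dt,$$ where the supremum in $A$ is understood as an essential supremum in $t$. Suitable weak solution in $Q(z_0,1)$: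 a pair $(u,p)$ with $u\in L_\infty(t_0-1,t_0;L_2(B(x_0,1)))\cap L_2(t_0-1,t_0;W^1_2(B(x_0,1)))$, $p\in L_{3/2}(Q(z_0,1))$, which satisfies the Navier-Stokes equations $\partial_t u+\operatorname{div}(u\otimes u)-\Delta u=-\nabla p$, $\operatorname{div}u=0$ in $Q(z_0,1)$ in the sense of distributions and such that, for a.a. $t\in]t_0-1,t_0[$ and all nonnegative $\phi\in C_0^\infty(\mathbb{R}^4)$ vanishing in a neighbourhood of the parabolic boundary $B(x_0,1)\times\{t_0-1\}\cup\partial B(x_0,1)\times[t_0-1,t_0]$, $$\int_{B(x_0,1)}\phi(x,t)|u(x,t)|^2dx+2\int_{B(x_0,1)\times]t_0-1,t[}\phi|\nabla u|^2dxdt'\leqslant\int_{B(x_0,1)\times]t_0-1,t[}\big[|u|^2(\partial_t\phi+\Delta\phi)+u\cdot\nabla\phi(|u|^2+2p)\big]dxdt'.$$ *)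

(* Defs.v *)
From HB Require Import structures.
From mathcomp Require Import all_boot all_order all_algebra.
From mathcomp Require Import all_classical all_reals all_analysis.
Set Implicit Arguments.
Unset Strict Implicit.
Unset Printing Implicit Defensive.
Import Order.TTheory GRing.Theory Num.Theory.
Import numFieldNormedType.Exports.
Local Open Scope classical_set_scope.
Local Open Scope ring_scope.

(* R^3 and space-time R^3 x R, as normed spaces (R3, R4) and with the Borel
   sigma-algebra [lebesgue_measure] is defined on (mR3, mR4). [measurableTypeR R]
   is convertible to R. *)
Notation R3 R := (R * R * R)%type.
Notation R4 R := (R * R * R * R)%type.
Notation mR3 R :=
  (measurableTypeR R * measurableTypeR R * measurableTypeR R)%type.
Notation mR4 R := (mR3 R * measurableTypeR R)%type.

Definition leb3 (R : realType) :
    {measure set (mR3 R) -> \bar R} :=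
  (@lebesgue_measure R \x @lebesgue_measure R \x @lebesgue_measure R)%E.

Definition leb4 (R : realType) :
    {measure set (mR4 R) -> \bar R} :=
  (leb3 R \x @lebesgue_measure R)%E.

Section Geometry.
Context {R : realType}.

Definition edist (x y : R3 R) : R :=
  Num.sqrt ((x.1.1 - y.1.1) ^+ 2 + (x.1.2 - y.1.2) ^+ 2 + (x.2 - y.2) ^+ 2).

(* Euclidean balls; the library's [ball] on a product is a cube. *)
Definition eball (x0 : R3 R) (r : R) : set (R3 R) := [set x | edist x x0 < r].

Definition esphere (x0 : R3 R) (r : R) : set (R3 R) :=
  [set x | edist x x0 = r].

Definition time_itv (t0 r : R) : set R := `]t0 - r ^+ 2, t0[%classic.

Definition pcyl (z0 : R4 R) (r : R) : set (R4 R) :=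
  eball z0.1 r `*` time_itv z0.2 r.

Definition pboundary (z0 : R4 R) (r : R) : set (R4 R) :=
  (eball z0.1 r `*` [set z0.2 - r ^+ 2]) `|`
  (esphere z0.1 r `*` `[z0.2 - r ^+ 2, z0.2]%classic).

Definition sqnorm (v : 'rV[R]_3) : R := \sum_(i < 3) v 0 i ^+ 2.

Definition enorm (v : 'rV[R]_3) : R := Num.sqrt (sqnorm v).

Definition mx_sqnorm (M : 'M[R]_3) : R := \sum_(i < 3) \sum_(j < 3) M i j ^+ 2.

End Geometry.

Section TestFunctions.
Context {R : realType}.

(* C^oo: every iterated directional derivative is (Frechet) differentiable. *)
Definition smooth (V : normedModType R) (f : V -> R) : Prop :=
  forall (s : seq V) (x : V),
    differentiable (foldr (fun v g => 'D_v g) f s) x.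

Definition tsupport (V : normedModType R) (f : V -> R) : set V :=
  closure [set x | f x != 0].

(* f is in C_0^oo(Omega) *)
Definition test_function (V : normedModType R) (Omega : set V) (f : V -> R) :
    Prop :=
  [/\ smooth f, compact (tsupport f) & tsupport f `<=` Omega].

Definition basis3 (j : 'I_3) : R3 R :=
  ((j == 0)%:R, (j == 1)%:R, (j == 2)%:R).

Definition dspace (j : 'I_3) (f : R4 R -> R) : R4 R -> R :=
  'D_((basis3 j, 0) : R4 R) f.

Definition dtime (f : R4 R -> R) : R4 R -> R := 'D_((0, 1) : R4 R) f.

Definition laplacian (f : R4 R -> R) (z : R4 R) : R :=
  \sum_(j < 3) dspace j (dspace j f) z.

End TestFunctions.

Section FunctionSpaces.
Context {R : realType}.
Local Open Scope ereal_scope.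

(* [ess_sup lebesgue_measure], restricted to the times in I *)
Definition ess_sup_on (I : set R) (f : R -> \bar R) : \bar R :=
  ereal_inf [set y | \forall t \ae @lebesgue_measure R, I t -> f t <= y].

Definition weak_Lnorm (p : R) (Omega : set (R3 R)) (g : R3 R -> R) : \bar R :=
  ereal_sup [set a%:E * leb3 R (Omega `&` [set x | a < `|g x|]%R) `^ p^-1
            | a in [set a : R | 0 < a]%R].

(* Measurability with respect to the sigma-algebra on which [leb4 R] is
   defined. *)
Definition measurable_on (Q : set (R4 R)) (f : R4 R -> R) : Prop :=
  measurable_fun (Q : set (mR4 R)) f.

(* G is the weak gradient of v in Omega: G x i j stands for d_j v_i at x. *)
Definition weak_gradient (Omega : set (R3 R)) (v : R3 R -> 'rV[R]_3)
    (G : R3 R -> 'M[R]_3) : Prop :=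
  forall (i j : 'I_3) (psi : R3 R -> R), test_function Omega psi ->
    \int[leb3 R]_(x in Omega) (v x 0 i * 'D_(basis3 j) psi x)%R%:E =
    - \int[leb3 R]_(x in Omega) (G x i j * psi x)%R%:E.

End FunctionSpaces.

Section NavierStokes.
Context {R : realType}.
Local Open Scope ereal_scope.

(* (u, p) is a suitable weak solution in Q(z0, 1), and Du is the spatial
   gradient of u. As the weak gradient is unique up to a null set, it is carried
   along as an argument rather than chosen. Membership of u in
   L_2(t0 - 1, t0; W^1_2(B(x0, 1))) is expressed by jointly measurable, square
   integrable u and Du such that Du(., t) is the weak gradient of u(., t) for
   a.a. t. Elements of Lebesgue spaces are given by Borel representatives. *)
Record suitable_weak_solution (z0 : R4 R) (u : R4 R -> 'rV[R]_3)
    (p : R4 R -> R) (Du : R4 R -> 'M[R]_3) : Prop := {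
  sws_measurable_u : forall i, measurable_on (pcyl z0 1) (fun z => u z 0%R i);
  sws_measurable_Du :
    forall i j, measurable_on (pcyl z0 1) (fun z => Du z i j);
  sws_measurable_p : measurable_on (pcyl z0 1) p;
  sws_u_Linfty_L2 :
    ess_sup_on (time_itv z0.2 1)
      (fun t => \int[leb3 R]_(x in eball z0.1 1) (sqnorm (u (x, t)))%:E) < +oo;
  sws_u_L2_W12 :
    \int[leb4 R]_(z in pcyl z0 1) (sqnorm (u z) + mx_sqnorm (Du z))%R%:E < +oo;
  sws_weak_gradient :
    \forall t \ae @lebesgue_measure R, time_itv z0.2 1 t ->
      weak_gradient (eball z0.1 1) (fun x => u (x, t)) (fun x => Du (x, t));
  sws_p_L32 :
    \int[leb4 R]_(z in pcyl z0 1) (`|p z| `^ (3 / 2))%R%:E < +oo;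
  (* d_t u + div (u (x) u) - Delta u = - grad p, component by component *)
  sws_momentum : forall (i : 'I_3) (phi : R4 R -> R),
    test_function (pcyl z0 1) phi ->
    \int[leb4 R]_(z in pcyl z0 1)
      (u z 0 i * dtime phi z
       + \sum_(j < 3) u z 0 i * u z 0 j * dspace j phi z
       + u z 0 i * laplacian phi z
       + p z * dspace i phi z)%R%:E = 0;
  sws_div_free : forall phi : R4 R -> R,
    test_function (pcyl z0 1) phi ->
    \int[leb4 R]_(z in pcyl z0 1)
      (\sum_(j < 3) u z 0 j * dspace j phi z)%R%:E = 0;
  sws_local_energy :
    \forall t \ae @lebesgue_measure R, time_itv z0.2 1 t ->
    forall phi : R4 R -> R,
      test_function setT phi -> (forall z, 0 <= phi z)%R ->
      set_nbhs (pboundary z0 1) [set z | phi z = 0%R] ->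
      \int[leb3 R]_(x in eball z0.1 1) (phi (x, t) * sqnorm (u (x, t)))%R%:E
      + 2%:E * \int[leb4 R]_(z in eball z0.1 1 `*` `](z0.2 - 1)%R, t[%classic)
                 (phi z * mx_sqnorm (Du z))%R%:E
      <= \int[leb4 R]_(z in eball z0.1 1 `*` `](z0.2 - 1)%R, t[%classic)
           (sqnorm (u z) * (dtime phi z + laplacian phi z)
            + (\sum_(j < 3) u z 0 j * dspace j phi z)
              * (sqnorm (u z) + 2 * p z))%R%:E
}.

Definition A_quantity (z0 : R4 R) (r : R) (u : R4 R -> 'rV[R]_3) : \bar R :=
  ess_sup_on `[(z0.2 - r ^+ 2)%R, z0.2]%classic
    (fun t => r^-1%:E *
       \int[leb3 R]_(x in eball z0.1 r) (sqnorm (u (x, t)))%:E).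

Definition B_quantity (z0 : R4 R) (r : R) (Du : R4 R -> 'M[R]_3) : \bar R :=
  r^-1%:E * \int[leb4 R]_(z in pcyl z0 r) (mx_sqnorm (Du z))%:E.

Definition C_infty (z0 : R4 R) (r : R) (u : R4 R -> 'rV[R]_3) : \bar R :=
  (r ^- 2)%:E * \int[lebesgue_measure]_(t in time_itv z0.2 r)
    weak_Lnorm 3 (eball z0.1 r) (fun x => enorm (u (x, t))) `^ 3.

Definition D_infty (z0 : R4 R) (r : R) (p : R4 R -> R) : \bar R :=
  (r ^- 2)%:E * \int[lebesgue_measure]_(t in time_itv z0.2 r)
    weak_Lnorm (3 / 2) (eball z0.1 r) (fun x => p (x, t)) `^ (3 / 2).

End NavierStokes.

(* Main.v *)
(** Let [zeta] be a product of four one-dimensional cut-offs, bounded below on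
[Q(z0, r/2)] and vanishing in [t < t0] outside [Q(z0, r)], and test the local
energy inequality with [zeta^2].  As [|grad (zeta^2)| <= (C/r) zeta], the cubic term and
the pressure term are, at almost every time, integrals of [h^2 |v|] with
[v = zeta u_i] and [h = |u|] or [h = |p|^(1/2)], where [h] is in weak [L^3].
Dyadic decomposition of [h] and [v] gives
[int h^2 |v| <= C |h|_(3,oo)^2 |v|_2^(1/2) |grad v|_2^(1/2)], provided that
[|v|_(6,oo) <= C |grad v|_2].  The latter follows by truncating [v] on lines:
[{|v| > 2b}] is contained in the cylinders over three sets [P_j] with
[b |P_j| <= int_{|v| > b} |d_j v|], and the Loomis-Whitney inequality bounds its
measure.  If [N] bounds both the cut-off kinetic energy and the cut-off
dissipation, Young's inequality then shows that
[N/2 + C r (e^2 + e^4 + d^4)] does too, where [C_infty = e^3] and [D_infty = d^3].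
Some finite [N] exists, so this can be iterated at fixed [r]; no comparison
between different radii is needed. *)
Require Import Defs.
From HB Require Import structures.
From mathcomp Require Import all_boot all_order all_algebra.
From mathcomp Require Import all_classical all_reals all_analysis.
From mathcomp Require Import measurable_realfun ring lra.
Set Implicit Arguments.
Unset Strict Implicit.
Unset Printing Implicit Defensive.
Import Order.TTheory GRing.Theory Num.Theory.
Import numFieldNormedType.Exports.
Local Open Scope classical_set_scope.
Local Open Scope ring_scope.

(** * Smooth functions *)

(** Since [h] is only in weak L^3, [h^2] is in weak L^(3/2), with dual exponent 3. The weak L^2 and
    weak L^6 bounds on [v] lie on either side of 3, and this makes the dyadic sums converge at both
    ends. The hypotheses control time integrals of cubes of weak norms. Young's inequality at a
    fixed time must therefore keep that cube linear: it leaves small multiples of [|v|_2^2] and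
    [|grad v|_2^2], plus the cube times a power of the supremum in time of [|v|_2]. Weak derivatives
    are known only through smooth test functions. Testing with a primitive of a bump in one variable
    and bumps in the other two, and letting the bumps tend to indicators of intervals, identifies
    [v] almost everywhere with minus the tail integral of its derivative on lines. Truncation is
    carried out on that representative. The weak norms in [C_infty] and [D_infty] are compared with
    suprema over rational levels, which are measurable in time. Norms and radii are written as
    integer powers of auxiliary roots ([r = rho ^ 4], [|v|_2^2 <= nu ^ 4]), so that the scaling
    becomes polynomial arithmetic. *)

Section smooth_functions.
Context {R : realType}.

(* The class [C] plays the role of a coinduction hypothesis. *)
Lemma smooth_class (V : normedModType R) (C : (V -> R) -> Prop) :
  (forall f, C f -> forall x, differentiable f x) ->
  (forall f v, C f -> C ('D_v f)) ->
  forall f, C f -> smooth f.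
Proof.
move=> Cdiff CD f Cf s; apply: Cdiff.
by elim: s => //= v s IH; exact: CD.
Qed.

Lemma smooth_differentiable (V : normedModType R) (f : V -> R) x :
  smooth f -> differentiable f x.
Proof. by move=> /(_ [::]); exact. Qed.

Lemma smooth_derivable (V : normedModType R) (f : V -> R) x v :
  smooth f -> derivable f x v.
Proof. by move=> sf; apply/diff_derivable/smooth_differentiable. Qed.

Lemma smooth_derive (V : normedModType R) (f : V -> R) v :
  smooth f -> smooth ('D_v f).
Proof.
move=> sf s x; have := sf (rcons s v) x.
by rewrite -cats1 foldr_cat.
Qed.

Lemma smooth_continuous (V : normedModType R) (f : V -> R) :
  smooth f -> continuous f.
Proof.
by move=> sf x; apply: differentiable_continuous; exact: smooth_differentiable.
Qed.

(** The derivative of a product is a sum of products, so a class that contains products and is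
    stable under differentiation must be closed under both operations. *)
Inductive ring_generated (V : normedModType R) (B : (V -> R) -> Prop) :
    (V -> R) -> Prop :=
| ring_generated_base f : B f -> ring_generated B f
| ring_generated_add f g : ring_generated B f -> ring_generated B g ->
    ring_generated B (f \+ g)
| ring_generated_mul f g : ring_generated B f -> ring_generated B g ->
    ring_generated B (f \* g).

Lemma smooth_ring_generated (V : normedModType R) (B : (V -> R) -> Prop) :
  (forall f, B f -> forall x, differentiable f x) ->
  (forall f v, B f -> ring_generated B ('D_v f)) ->
  forall f, ring_generated B f -> smooth f.
Proof.
move=> Bdiff BD.
have dif f : ring_generated B f -> forall x, differentiable f x.
  elim=> {f} [f /Bdiff //|f g _ fd _ gd x|f g _ fd _ gd x].
    exact: (@differentiableD _ _ _ f g).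
  exact: (@differentiableM _ _ f g).
apply: smooth_class => // f v; elim=> {f} [f Bf|f g Bf Df Bg Dg|f g Bf Df Bg Dg].
- exact: BD.
- rewrite (_ : 'D_v _ = 'D_v f \+ 'D_v g); first exact: ring_generated_add.
  by apply/funext => x; rewrite (@deriveD _ _ _ f g)//;
    apply: diff_derivable; exact: dif.
- rewrite (_ : 'D_v _ = f \* 'D_v g \+ g \* 'D_v f).
    by apply: ring_generated_add; apply: ring_generated_mul.
  by apply/funext => x; rewrite (@deriveM _ _ f g)//;
    apply: diff_derivable; exact: dif.
Qed.

Lemma smooth_mul (V : normedModType R) (f g : V -> R) :
  smooth f -> smooth g -> smooth (f \* g).
Proof.
move=> sf sg; apply: (@smooth_ring_generated _ (@smooth R V)).
- by move=> h sh x; exact: smooth_differentiable.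
- by move=> h v sh; apply: ring_generated_base; exact: smooth_derive.
- by apply: ring_generated_mul; exact: ring_generated_base.
Qed.

Lemma derive_affine_comp (V : normedModType R) (L dL : V -> R) (f : R -> R) x v :
  is_diff x L dL -> differentiable f (L x) ->
  'D_v (f \o L) x = dL v * 'D_1 f (L x).
Proof.
move=> Ld fd.
rewrite deriveE; last exact: differentiable_comp.
rewrite diff_comp//= [in LHS]diff_val.
by rewrite -[in LHS](mulr1 (dL v)) linearZ/= deriveE.
Qed.

(** The differential [dL] is the same at every point, so differentiating along [v] only produces the
    constant factor [dL v]. The functions [a * h (L x)] with [h] smooth thus form a stable class. *)
Lemma smooth_affine_comp (V : normedModType R) (L dL : V -> R) (f : R -> R) :
  (forall x, is_diff x L dL) -> smooth (f : R^o -> R) -> smooth (f \o L).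
Proof.
move=> Ld sf.
pose B (g : V -> R) :=
  exists2 h : R -> R, smooth (h : R^o -> R) &
    exists a : R, g = (fun x => a * h (L x)).
have Bdiff g : B g -> forall x, differentiable g x.
  move=> [h sh [a ->]] x.
  apply: (@differentiableM _ _ (cst a) (h \o L)) => //.
  apply: differentiable_comp => //.
  by apply: smooth_differentiable.
apply: (@smooth_class _ B) => //; last by exists f => //; exists 1;
  apply/funext => x; rewrite mul1r.
move=> g v [h sh [a ->]]; exists ('D_1 (h : R^o -> R)).
  exact: smooth_derive.
exists (a * dL v); apply/funext => x.
rewrite (@deriveM _ _ (cst a) (h \o L)).
- by rewrite derive_cst scaler0 addr0 (@derive_affine_comp _ _ dL)//;
    [rewrite [LHS]mulrA|exact: smooth_differentiable].
- exact: derivable_cst.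
- apply: diff_derivable; apply: differentiable_comp => //.
  exact: smooth_differentiable.
Qed.

Lemma smooth_cst (V : normedModType R) (a : R) : smooth (cst a : V -> R).
Proof.
apply: (@smooth_class _ (fun f => exists a, f = cst a)); last by exists a.
- by move=> f [b ->] x; exact: differentiable_cst.
- move=> f v [b ->]; exists 0; apply/funext => x; exact: derive_cst.
Qed.

End smooth_functions.

(** * Bumps on the line, built from flat functions *)

Section bump_functions.
Context {R : realType}.

(* [x^-1 |-> P(x^-1)] times the flat function [e^(-c/x)], extended by 0 *)
Definition flat (c : R) (P : {poly R}) (x : R) : R :=
  if 0 < x then P.[x^-1] * expR (- (c * x^-1)) else 0.

(** The action of d/dx on the polynomial factor: the derivative of [P(1/x) e^(-c/x)] is
    [x^-2 (c P - P')(1/x) e^(-c/x)]. *)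
Definition dflat (c : R) (P : {poly R}) : {poly R} :=
  'X^2 * (c *: P - P^`()).

(** A single term of the exponential series, [(c y)^n / n! <= e^(c y)], gives the bound. *)
Lemma pow_expR_bounded (c : R) (n : nat) : 0 < c ->
  exists M : R, forall y, 0 <= y -> y ^+ n * expR (- (c * y)) <= M.
Proof.
move=> c0; case: n => [|n].
  exists 1 => y y0; rewrite expr0 mul1r -[leRHS]expR0 ler_expR oppr_le0.
  by rewrite mulr_ge0// ltW.
exists ((n.+1)`!%:R / c ^+ n.+1) => y y0.
have cy : 0 <= c * y by rewrite mulr_ge0// ltW.
have := expR_ge1Dxn n cy; set k := n.+1.
have k0 : 0 < k`!%:R :> R by rewrite ltr0n fact_gt0.
have ck : 0 < c ^+ k by rewrite exprn_gt0.
move=> h; rewrite expRN ler_pdivrMr ?expR_gt0// mulrAC ler_pdivlMr//.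
rewrite -ler_pdivrMl// mulrC -exprMn (mulrC y) mulrC.
by apply: le_trans h; rewrite mulrC lerDr.
Qed.

Lemma flat_bounded (c : R) (P : {poly R}) : 0 < c ->
  exists M : R, forall x, `|flat c P x| <= M.
Proof.
move=> c0.
have [M HM] : exists M : R, forall y, 0 <= y ->
    `|P.[y] * expR (- (c * y))| <= M.
  have [M HM] : exists M : R, forall (n : nat) y, (n <= size P)%N -> 0 <= y ->
      y ^+ n * expR (- (c * y)) <= M.
    elim: (size P) => [|m [M IH]].
      have [M HM] := pow_expR_bounded 0 c0.
      by exists M => n y; rewrite leqn0 => /eqP ->; exact: HM.
    have [M0 H0] := pow_expR_bounded m.+1 c0.
    exists (Num.max M M0) => n y; rewrite leq_eqVlt => /orP[/eqP ->|nm] y0.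
      by rewrite le_max H0 ?orbT.
    by rewrite le_max IH.
  exists (\sum_(i < size P) `|P`_i| * M) => y y0.
  rewrite horner_coef mulr_suml.
  apply: le_trans (ler_norm_sum _ _ _) _; apply: ler_sum => i _.
  rewrite -mulrA normrM ler_wpM2l// ger0_norm ?mulr_ge0 ?exprn_ge0 ?expR_ge0//.
  by apply: HM => //; exact: ltnW.
exists (Num.max M 0) => x; rewrite /flat; case: ifPn => [x0|_].
  by rewrite le_max HM// invr_ge0 ltW.
by rewrite normr0 le_max lexx orbT.
Qed.

(** Used at the origin: one factor [x] cancels the denominator of the difference quotient, and the
    other makes it tend to 0 because the remaining flat function is bounded. *)
Lemma flat_dflat0 (c : R) (P : {poly R}) (x : R) :
  flat c P x = x ^+ 2 * flat c ('X^2 * P) x.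
Proof.
rewrite /flat; case: ifPn => x0; last by rewrite mulr0.
rewrite hornerM hornerXn mulrA mulrA -exprMn divff ?gt_eqF//.
by rewrite expr1n mul1r.
Qed.

Lemma is_derive_flat (c : R) (P : {poly R}) (x : R) : 0 < c ->
  is_derive x 1 (flat c P) (flat c (dflat c P) x).
Proof.
move=> c0.
have [x0|x0|->] := ltgtP x 0.
- rewrite /flat ltNge (ltW x0)/=.
  apply: (@near_eq_is_derive _ _ _ (cst 0)).
    near=> y; rewrite ifF//; apply/negbTE; rewrite -leNgt ltW//.
    by near: y; exact: lt_nbhsl.
- rewrite {2}/flat x0.
  apply: (@near_eq_is_derive _ _ _
    (fun y => (horner P \o GRing.inv) y * expR (- (c * y^-1)))).
    near=> y; rewrite /flat ifT//.
    by near: y; exact: lt_nbhsr.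
  have x1 : x != 0 by rewrite gt_eqF.
  have dI : is_derive x 1 (fun y : R => y^-1) (- x ^- 2).
    apply: (is_derive_eq (@is_deriveV _ id x 1 1 x1 _)).
    by rewrite scaler1.
  have dP : is_derive x 1 (horner P \o GRing.inv) (P^`().[x^-1] * (- x ^- 2)).
    exact: is_derive1_comp.
  have dM : is_derive x 1 (fun y : R => - (c * y^-1)) (- (c * (- x ^- 2))).
    exact: (is_deriveN (is_deriveZ c dI)).
  have dE : is_derive x 1 (expR \o (fun y : R => - (c * y^-1)))
      (expR (- (c * x^-1)) * (- (c * (- x ^- 2)))).
    exact: is_derive1_comp.
  apply: (is_derive_eq (is_deriveM dP dE)).
  rewrite /dflat hornerM hornerXn hornerD hornerN hornerZ /= exprVn.
  have sE (a b : R) : a *: (b : R^o) = a * b by [].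
  move: (expR _) (P.[_]) (P^`().[_]) (x ^- 2) => E A B X; rewrite !sE.
  by ring.
- rewrite {2}/flat ltxx.
  have [M HM] := flat_bounded ('X^2 * P) c0.
  suff : h^-1 *: (flat c P (h *: 1 + 0) - flat c P 0) @[h --> 0^'] --> (0:R).
    by move=> H; apply: DeriveDef; [apply/cvg_ex; exists 0|exact: cvg_lim].
  apply/cvgr0Pnorm_lt => e e0.
  have M1 : 0 < M + 1 by rewrite ltr_wpDl// (le_trans _ (HM 0)).
  near=> h.
  have h0 : h != 0 by near: h; exact: nbhs_dnbhs_neq.
  rewrite {2}/flat ltxx subr0 addr0 [h *: 1]mulr1 flat_dflat0 [_ *: _]mulrA.
  rewrite exprS expr1 mulKf// normrM.
  apply: (@le_lt_trans _ _ (`|h| * M)); first by rewrite ler_wpM2l.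
  apply: (@le_lt_trans _ _ (`|h| * (M + 1))).
    by rewrite ler_wpM2l// lerDl.
  rewrite -ltr_pdivlMr//.
  by near: h; apply: dnbhs0_lt; exact: divr_gt0.
Unshelve. all: by end_near. Qed.

Lemma smooth_flat (c : R) (P : {poly R}) : 0 < c ->
  smooth (flat c P : R^o -> R).
Proof.
move=> c0.
pose C (f : R -> R) := exists a Q, f = (fun x => a * flat c Q x).
apply: (@smooth_class _ _ C); last first.
- by exists 1, P; apply/funext => x; rewrite mul1r.
- move=> f v [a [Q ->]]; exists (v * a), (dflat c Q); apply/funext => x.
  have d := @is_derive_flat c Q x c0.
  have df : differentiable (flat c Q) (x : R^o) by apply/derivable1_diffP.
  have -> : (fun x => a * flat c Q x) = cst a \* flat c Q by [].
  rewrite deriveM//; [|exact: diff_derivable].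
  rewrite derive_cst scaler0 addr0.
  rewrite (derive_affine_comp (L := id) v (is_diff_id _) df) derive_val.
  by rewrite [LHS]mulrCA mulrA.
- move=> f [a [Q ->]] x.
  apply: (@differentiableM _ _ (cst a) (flat c Q)) => //.
  by apply/derivable1_diffP; have [] := @is_derive_flat c Q x c0.
Qed.


(** Equal to [exp (- c / (s - a) - c / (a' - s))] on []a, a'[] and to 0 elsewhere. The parameter [c]
    stays free because the bump increases to the indicator of the interval as [c] tends to 0. *)
Definition bump (c a a' : R) (s : R) : R := flat c 1 (s - a) * flat c 1 (a' - s).

Lemma smooth_bump (c a a' : R) : 0 < c -> smooth (bump c a a' : R^o -> R).
Proof.
move=> c0.
have d1 (x : R^o) : is_diff x (fun s : R^o => s - a) id.
  have := is_diffB (is_diff_id x) (is_diff_cst a x).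
  by rewrite subr0.
have d2 (x : R^o) : is_diff x (fun s : R^o => a' - s) (fun s : R^o => - s).
  have := is_diffB (is_diff_cst a' x) (is_diff_id x).
  by rewrite sub0r.
have s1 := smooth_affine_comp d1 (smooth_flat 1 c0).
have s2 := smooth_affine_comp d2 (smooth_flat 1 c0).
exact: smooth_mul s1 s2.
Qed.

Lemma flat1 (c x : R) : 0 < x -> flat c 1 x = expR (- (c / x)).
Proof. by move=> x0; rewrite /flat x0 hornerC mul1r. Qed.

Lemma flat1_ge0 (c x : R) : 0 <= flat c 1 x.
Proof. by rewrite /flat; case: ifP => //; rewrite hornerC mul1r expR_ge0. Qed.

Lemma flat1_le1 (c x : R) : 0 < c -> flat c 1 x <= 1.
Proof.
move=> c0; rewrite /flat; case: ifPn => // x0; rewrite hornerC mul1r.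
by rewrite -[leRHS]expR0 ler_expR oppr_le0 divr_ge0// ltW.
Qed.

Lemma bump_ge0 (c a a' s : R) : 0 <= bump c a a' s.
Proof. by rewrite mulr_ge0// flat1_ge0. Qed.

Lemma bump_le1 (c a a' s : R) : 0 < c -> bump c a a' s <= 1.
Proof. by move=> c0; rewrite mulr_ile1// ?flat1_ge0 ?flat1_le1. Qed.

Lemma bump_eq0 (c a a' s : R) : s \notin `]a, a'[ -> bump c a a' s = 0.
Proof.
rewrite in_itv/= negb_and -!leNgt => /orP[sa|as'].
  by rewrite /bump /flat ltNge subr_le0 sa mul0r.
by rewrite /bump [X in _ * X]/flat ltNge subr_le0 as' mulr0.
Qed.

Lemma bump_cvg1 (a a' s : R) : s \in `]a, a'[ ->
  bump n.+1%:R^-1 a a' s @[n --> \oo] --> (1 : R).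
Proof.
rewrite in_itv/= => /andP[sa sa'].
have F x : 0 < x -> flat n.+1%:R^-1 1 x @[n --> \oo] --> (1 : R).
  move=> x0; under eq_fun do rewrite flat1//.
  have : expR (- (n.+1%:R^-1 / x)) @[n --> \oo] --> expR (- (0 / x)).
    apply: continuous_cvg; first exact: continuous_expR.
    by apply: cvgN; apply: cvgMl; exact: cvg_harmonic.
  by rewrite mul0r oppr0 expR0.
have : bump n.+1%:R^-1 a a' s @[n --> \oo] --> (1 * 1 : R).
  by apply: cvgM; apply: F; rewrite subr_gt0.
by rewrite mulr1.
Qed.

End bump_functions.

Section test_functions.
Context {R : realType}.

Lemma tsupport_subset (V : normedModType R) (K : set V) (f : V -> R) :
  closed K -> (forall x, ~ K x -> f x = 0) -> tsupport f `<=` K.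
Proof.
move=> cK fK; rewrite /tsupport [X in _ `<=` X](closure_id _).1//.
apply: closure_subset => x /= fx; apply: contrapT => /fK fx0.
by rewrite fx0 eqxx in fx.
Qed.

Lemma test_function_compact (V : normedModType R) (K Omega : set V) (f : V -> R) :
  smooth f -> compact K -> K `<=` Omega -> (forall x, ~ K x -> f x = 0) ->
  test_function Omega f.
Proof.
move=> sf cK KO fK.
have fsub : tsupport f `<=` K.
  by apply: tsupport_subset => //; exact: (compact_closed (@norm_hausdorff _ V)).
split => //; last exact: subset_trans KO.
by apply: (subclosed_compact _ cK fsub); exact: closed_closure.
Qed.

Lemma notin_tsupport (V : normedModType R) (f : V -> R) x :
  ~ tsupport f x -> f x = 0.
Proof.
move=> nf; apply/eqP; apply: contrapT => /negP fx; apply: nf.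
exact: subset_closure.
Qed.

Lemma derive_notin_tsupport (V : normedModType R) (f : V -> R) v x :
  ~ tsupport f x -> 'D_v f x = 0.
Proof.
move=> nf; rewrite (@near_eq_derive _ _ _ f (cst 0)) ?derive_cst//.
have := @closed_closure _ [set x | f x != 0]; rewrite -openC openE => /(_ _ nf).
apply: filterS => y /=; exact: notin_tsupport.
Qed.

Lemma test_function_derive (V : normedModType R) (Omega : set V) (f : V -> R) v :
  test_function Omega f -> test_function Omega ('D_v f).
Proof.
move=> [sf cf fO]; apply: (@test_function_compact _ (tsupport f)) => //.
  exact: smooth_derive.
by move=> x; exact: derive_notin_tsupport.
Qed.

Lemma test_function_bounded (V : normedModType R) (Omega : set V) (f : V -> R) :
  test_function Omega f -> exists M : R, forall x, `|f x| <= M.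
Proof.
move=> [sf cf _].
have : compact (f @` tsupport f).
  apply: continuous_compact => //; apply: continuous_subspaceT.
  exact: smooth_continuous.
move=> /compact_bounded [M [Mreal HM]].
exists (Num.max (M + 1) 0) => x.
have [fx|fx] := pselect (tsupport f x).
  by rewrite le_max HM// ?ltrDl//; exists x.
by rewrite (notin_tsupport fx) normr0 le_max lexx orbT.
Qed.

End test_functions.

(** * Functions in weak Lebesgue spaces *)

Section weak_type_pairing.
Context d (T : measurableType d) (R : realType) (mu : {measure set T -> \bar R}).
Local Open Scope ereal_scope.

Lemma ler_sqr_nneg (x y : R) : (0 <= x -> x <= y -> x ^+ 2 <= y ^+ 2)%R.
Proof.
by move=> x0 xy; apply: lerXn2r => //; rewrite nnegrE (le_trans x0).
Qed.

(** Dyadic layers are always arranged below so that the n-th one contributes at most [c / 2 ^ n]. *)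
Lemma integral_series_le (D : set T) (f : nat -> T -> \bar R) (c : R) :
  measurable D -> (0 <= c)%R ->
  (forall n, measurable_fun D (f n)) -> (forall n x, D x -> 0 <= f n x) ->
  (forall n, \int[mu]_(x in D) f n x <= (c / 2 ^+ n)%:E) ->
  \int[mu]_(x in D) (\sum_(0 <= n <oo) f n x) <= (2 * c)%:E.
Proof.
move=> mD c0 mf f0 fc; rewrite integral_nneseries//.
apply: (@le_trans _ _ (\sum_(0 <= n <oo) (2 * c / (2 ^ n.+1)%:R)%:E)).
  apply: lee_nneseries => [n _ _|n _]; first by apply: integral_ge0 => x; exact: f0.
  rewrite (le_trans (fc n))// lee_fin natrX exprS invfM mulrACA divff// mul1r.
  by [].
by apply: epsilon_trick0; rewrite mulr_ge0.
Qed.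

Lemma le_nneseries_term (f : nat -> \bar R) k : (forall n, 0 <= f n) ->
  f k <= \sum_(0 <= n <oo) f n.
Proof.
by move=> f0; rewrite (@nneseriesD1 _ _ k)// leeDl// nneseries_ge0.
Qed.

Lemma measurable_superlevel (h : T -> R) a : measurable_fun setT h ->
  measurable [set x | (a < h x)%R].
Proof.
move=> mh; rewrite -[X in measurable X]setTI.
have -> : [set x | (a < h x)%R] = h @^-1` `]a, +oo[%classic.
  by apply/seteqP; split => x /=; rewrite in_itv/= andbT.
exact: mh.
Qed.

Lemma integral_scale_indic (D A : set T) (c : R) : measurable D -> measurable A ->
  (0 <= c)%R -> \int[mu]_(x in D) (c%:E * (\1_A x)%:E) = c%:E * mu (A `&` D).
Proof.
move=> mD mA c0; rewrite ge0_integralZl ?integral_indic//.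
exact/measurable_EFinP/measurable_indic.
Qed.

(** Where [h <= a] the integrand is at most [a^2]. The layer [2^n a < h <= 2^(n+1) a] contributes at
    most [4 (2^n a)^2 kappa / (2^n a)^3 = 4 kappa / (2^n a)], and these bounds sum to
    [8 kappa / a]. *)
Lemma weak3_integral_sqr (h : T -> R) (kappa : R) (E : set T) (a : R) :
  measurable_fun setT h -> (forall x, 0 <= h x)%R ->
  (forall b : R, (0 < b)%R -> (b ^+ 3)%:E * mu [set x | (b < h x)%R] <= kappa%:E) ->
  measurable E -> (0 < a)%R ->
  \int[mu]_(x in E) (h x ^+ 2)%:E <= (a ^+ 2)%:E * mu E + (8 * kappa / a)%:E.
Proof.
move=> mh h0 hk mE a0.
have mS b : measurable [set x | (b < h x)%R] by exact: measurable_superlevel.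
have k0 : (0 <= kappa)%R.
  rewrite -lee_fin; apply: le_trans (hk _ ltr01).
  by rewrite mule_ge0 ?lee_fin ?exprn_ge0.
pose f n (x : T) := ((2 ^+ n.+1 * a) ^+ 2)%:E *
  (\1_[set x | (2 ^+ n * a < h x)%R] x)%:E.
have mf n : measurable_fun E (f n).
  apply/measurable_funTS/measurable_funeM.
  by apply/measurable_EFinP/measurable_indic; exact: mS.
have f0 n x : 0 <= f n x.
  by rewrite mule_ge0 ?lee_fin ?sqr_ge0// indicE; case: (_ \in _).
apply: (@le_trans _ _
    (\int[mu]_(x in E) ((a ^+ 2)%:E + \sum_(0 <= n <oo) f n x))).
  apply: ge0_le_integral => //.
  - by move=> x _; rewrite lee_fin sqr_ge0.
  - by apply/measurable_EFinP/measurable_funTS; exact: measurable_funX.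
  - apply: emeasurable_funD; first exact: measurable_cst.
    exact: ge0_emeasurable_sum.
  move=> x _; have [ha|ha] := leP (h x) a.
    rewrite -[leLHS]adde0 leeD ?nneseries_ge0// lee_fin.
    exact: ler_sqr_nneg.
  (* The least such [n] is positive because [h x > a]; its predecessor indexes the layer that
     contains [x]. *)
  have [n hn] : exists n, (h x <= 2 ^+ n * a)%R.
    exists (Num.Def.archi_bound (h x / a)); rewrite -ler_pdivrMr//.
    by apply/ltW/upper_nthrootP.
  case: (ex_minnP (P := fun n => (h x <= 2 ^+ n * a)%R)); first by exists n.
  case=> [|m hm mmin]; first by rewrite expr0 mul1r leNgt ha.
  have hm' : (2 ^+ m * a < h x)%R.
    by rewrite ltNge; apply/negP => /mmin; rewrite ltnn.
  apply: le_trans (_ : f m x <= _); last first.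
    rewrite -[leLHS]add0e leeD ?lee_fin ?sqr_ge0//.
    by apply: le_nneseries_term => k; exact: f0.
  by rewrite /f indicE mem_set//= mule1 lee_fin; exact: ler_sqr_nneg.
rewrite ge0_integralD//; last 3 first.
- by move=> x _; rewrite lee_fin sqr_ge0.
- by move=> x _; exact: nneseries_ge0.
- exact: ge0_emeasurable_sum.
rewrite integral_cst// leeD2l//.
have -> : (8 * kappa / a = 2 * (4 * kappa / a))%R by field; rewrite gt_eqF.
apply: integral_series_le => //; first by rewrite divr_ge0 ?mulr_ge0// ltW.
move=> n; rewrite integral_scale_indic ?sqr_ge0//.
have t0 : (0 < 2 ^+ n * a)%R by rewrite mulr_gt0// exprn_gt0.
have := hk _ t0; set m := mu _ => mk.
apply: (@le_trans _ _ ((4 / (2 ^+ n * a))%:E * (((2 ^+ n * a) ^+ 3)%:E * m))).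
  rewrite muleA -EFinM; apply: lee_pmul.
  - by rewrite lee_fin sqr_ge0.
  - exact: measure_ge0.
  - rewrite lee_fin le_eqVlt; apply/orP; left; apply/eqP.
    rewrite [(2 ^+ n.+1)%R]exprS.
    by field; rewrite !gt_eqF// exprn_gt0.
  - apply: le_measure; rewrite ?inE//; exact: measurableI.
apply: (@le_trans _ _ ((4 / (2 ^+ n * a))%:E * kappa%:E)).
  by rewrite lee_wpmul2l// lee_fin divr_ge0// ltW.
rewrite -EFinM lee_fin le_eqVlt; apply/orP; left; apply/eqP.
by field; rewrite !gt_eqF// exprn_gt0.
Qed.


Lemma integral_scale_restrict (h : T -> R) (E : set T) (c : R) :
  measurable_fun setT h -> measurable E -> (0 <= c)%R ->
  \int[mu]_x (c%:E * ((h x ^+ 2)%:E * (\1_E x)%:E)) =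
  c%:E * \int[mu]_(x in E) (h x ^+ 2)%:E.
Proof.
move=> mh mE c0; rewrite ge0_integralZl//.
- by rewrite [in RHS]integral_mkcond epatch_indic.
- apply: emeasurable_funM; apply/measurable_EFinP; first exact: measurable_funX.
  exact: measurable_indic.
- by move=> x _; rewrite mule_ge0 ?lee_fin ?sqr_ge0// indicE; case: (_ \in _).
Qed.

(** The level [b] separates small values of [v], where the weak L^2 bound is used, from large ones,
    where the weak L^6 bound is. On each layer of [v], [weak3_integral_sqr] is applied to [h] with
    its own threshold: [a / 4^n] on [b / 8^(n+1) < v <= b / 8^n], and [a 4^n] on
    [2^n b < v <= 2^(n+1) b]. With the bases 8, 4 and 2 every contribution decays exactly like
    [2^-n]: the ratios are [64 / (8 * 16)] and [4 / 8] below [b], [2 * 16 / 64] and [2 / 4]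
    above. *)
Lemma weak_pairing (h v : T -> R) (kappa V W a b : R) :
  measurable_fun setT h -> (forall x, 0 <= h x)%R ->
  measurable_fun setT v -> (forall x, 0 <= v x)%R ->
  (0 <= kappa)%R -> (0 <= V)%R -> (0 <= W)%R ->
  (forall t : R, (0 < t)%R -> (t ^+ 3)%:E * mu [set x | (t < h x)%R] <= kappa%:E) ->
  (forall t : R, (0 < t)%R -> (t ^+ 2)%:E * mu [set x | (t < v x)%R] <= V%:E) ->
  (forall t : R, (0 < t)%R -> (t ^+ 6)%:E * mu [set x | (t < v x)%R] <= W%:E) ->
  (0 < a)%R -> (0 < b)%R ->
  \int[mu]_x (h x ^+ 2 * v x)%:E <=
    (128 * V * a ^+ 2 / b + 4 * W * a ^+ 2 / b ^+ 5 + 48 * kappa * b / a)%:E.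
Proof.
move=> mh h0 mv v0 k0 V0 W0 hk hV hW a0 b0.
have mS t : measurable [set x | (t < v x)%R] by exact: measurable_superlevel.
have p2 n : (0 < 2 ^+ n :> R)%R by rewrite exprn_gt0.
have p4 n : (0 < 4 ^+ n :> R)%R by rewrite exprn_gt0.
have p8 n : (0 < 8 ^+ n :> R)%R by rewrite exprn_gt0.
pose f n (x : T) := (b / 8 ^+ n)%:E *
  ((h x ^+ 2)%:E * (\1_[set x | (b / 8 ^+ n.+1 < v x)%R] x)%:E).
pose g n (x : T) := (2 ^+ n.+1 * b)%:E *
  ((h x ^+ 2)%:E * (\1_[set x | (2 ^+ n * b < v x)%R] x)%:E).
have mf n : measurable_fun setT (f n).
  apply: measurable_funeM; apply: emeasurable_funM; apply/measurable_EFinP.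
    exact: measurable_funX.
  exact: measurable_indic.
have mg n : measurable_fun setT (g n).
  apply: measurable_funeM; apply: emeasurable_funM; apply/measurable_EFinP.
    exact: measurable_funX.
  exact: measurable_indic.
have f0 n x : 0 <= f n x.
  by rewrite !mule_ge0 ?lee_fin ?sqr_ge0//; apply: divr_ge0; apply: ltW.
have g0 n x : 0 <= g n x.
  by rewrite !mule_ge0 ?lee_fin ?sqr_ge0//; apply: mulr_ge0; apply: ltW.
apply: (@le_trans _ _ (\int[mu]_x
    (\sum_(0 <= n <oo) f n x + \sum_(0 <= n <oo) g n x))).
  apply: ge0_le_integral => //.
  - by move=> x _; rewrite lee_fin mulr_ge0 ?sqr_ge0.
  - apply/measurable_EFinP; apply: measurable_funM => //; exact: measurable_funX.
  - by apply: emeasurable_funD; exact: ge0_emeasurable_sum.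
  move=> x _; have [vx|vx] := leP (v x) b; last first.
    have [n hn] : exists n, (v x <= 2 ^+ n * b)%R.
      exists (Num.Def.archi_bound (v x / b)); rewrite -ler_pdivrMr//.
      by apply/ltW/upper_nthrootP.
    case: (ex_minnP (P := fun n => (v x <= 2 ^+ n * b)%R)); first by exists n.
    case=> [|m hm mmin]; first by rewrite expr0 mul1r leNgt vx.
    have hm' : (2 ^+ m * b < v x)%R.
      by rewrite ltNge; apply/negP => /mmin; rewrite ltnn.
    apply: le_trans (_ : g m x <= _); last first.
      rewrite -[leLHS]add0e leeD ?nneseries_ge0//.
      by apply: le_nneseries_term => k; exact: g0.
    rewrite /g indicE mem_set//= mule1 -EFinM lee_fin mulrC.
    by rewrite ler_wpM2r ?sqr_ge0.
  have [vx0|vx0] := leP (v x) 0%R.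
    have -> : v x = 0%R by apply/le_anti; rewrite vx0 v0.
    by rewrite mulr0 adde_ge0// nneseries_ge0.
  have [n hn] : exists n, (b / 8 ^+ n < v x)%R.
    exists (Num.Def.archi_bound (b / v x)).
    rewrite ltr_pdivrMr// mulrC -ltr_pdivrMr//.
    apply: lt_le_trans (upper_nthrootP (leqnn _)) _.
    by rewrite lerXn2r// ?nnegrE// ler_nat.
  case: (ex_minnP (P := fun n => (b / 8 ^+ n < v x)%R)); first by exists n.
  case=> [|m hm mmin]; first by rewrite expr0 divr1 ltNge vx.
  have hm' : (v x <= b / 8 ^+ m)%R.
    by rewrite leNgt; apply/negP => /mmin; rewrite ltnn.
  apply: le_trans (_ : f m x <= _); last first.
    rewrite -[leLHS]adde0 leeD ?nneseries_ge0//.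
    by apply: le_nneseries_term => k; exact: f0.
  rewrite /f indicE mem_set//= mule1 -EFinM lee_fin mulrC.
  by rewrite ler_wpM2r ?sqr_ge0.
rewrite ge0_integralD//; last 4 first.
- by move=> x _; exact: nneseries_ge0.
- exact: ge0_emeasurable_sum.
- by move=> x _; exact: nneseries_ge0.
- exact: ge0_emeasurable_sum.
have mE (t : R) (U : R) (k : nat) : (0 < t)%R ->
    (t ^+ k)%:E * mu [set x | (t < v x)%R] <= U%:E ->
    mu [set x | (t < v x)%R] <= (U / t ^+ k)%:E.
  move=> t0 H; have tk : (0 < t ^+ k)%R by rewrite exprn_gt0.
  by rewrite EFinM muleC lee_pdivlMl.
have K1 : \int[mu]_x (\sum_(0 <= n <oo) f n x) <=
    (2 * (64 * V * a ^+ 2 / b + 8 * kappa * b / a))%:E.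
  apply: integral_series_le => //.
    by rewrite addr_ge0// divr_ge0 ?mulr_ge0 ?sqr_ge0// ltW.
  move=> n; rewrite integral_scale_restrict//; last by apply: divr_ge0; apply: ltW.
  have t0 : (0 < b / 8 ^+ n.+1)%R by rewrite divr_gt0.
  have a1 : (0 < a / 4 ^+ n)%R by rewrite divr_gt0.
  have := weak3_integral_sqr mh h0 hk (mS (b / 8 ^+ n.+1)%R) a1.
  move=> /le_trans H.
  apply: (@le_trans _ _ ((b / 8 ^+ n)%:E * (((a / 4 ^+ n) ^+ 2)%:E *
     (V / (b / 8 ^+ n.+1) ^+ 2)%:E + (8 * kappa / (a / 4 ^+ n))%:E))).
    apply: lee_wpmul2l; first by rewrite lee_fin divr_ge0 ?ltW.
    apply: H.
    apply: leeD2r; apply: lee_wpmul2l; first by rewrite lee_fin sqr_ge0.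
    by apply: mE => //; exact: hV.
  rewrite -!EFinM lee_fin le_eqVlt; apply/orP; left; apply/eqP.
  rewrite [(8 ^+ n.+1)%R]exprS.
  have -> : (8 ^+ n = 2 ^+ n * 2 ^+ n * 2 ^+ n :> R)%R.
    by rewrite -!exprMn; congr (_ ^+ n)%R; ring.
  have -> : (4 ^+ n = 2 ^+ n * 2 ^+ n :> R)%R.
    by rewrite -!exprMn; congr (_ ^+ n)%R; ring.
  by field; rewrite !gt_eqF.
have K2 : \int[mu]_x (\sum_(0 <= n <oo) g n x) <=
    (2 * (2 * W * a ^+ 2 / b ^+ 5 + 16 * kappa * b / a))%:E.
  apply: integral_series_le => //.
    by rewrite addr_ge0// divr_ge0 ?mulr_ge0 ?sqr_ge0 ?exprn_ge0// ltW.
  move=> n; rewrite integral_scale_restrict//; last by apply: mulr_ge0; apply: ltW.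
  have t0 : (0 < 2 ^+ n * b)%R by rewrite mulr_gt0.
  have a1 : (0 < a * 4 ^+ n)%R by rewrite mulr_gt0.
  have := weak3_integral_sqr mh h0 hk (mS (2 ^+ n * b)%R) a1.
  move=> /le_trans H.
  apply: (@le_trans _ _ ((2 ^+ n.+1 * b)%:E * (((a * 4 ^+ n) ^+ 2)%:E *
     (W / (2 ^+ n * b) ^+ 6)%:E + (8 * kappa / (a * 4 ^+ n))%:E))).
    apply: lee_wpmul2l; first by rewrite lee_fin mulr_ge0 ?ltW.
    apply: H.
    apply: leeD2r; apply: lee_wpmul2l; first by rewrite lee_fin sqr_ge0.
    by apply: mE => //; exact: hW.
  rewrite -!EFinM lee_fin le_eqVlt; apply/orP; left; apply/eqP.
  rewrite [(2 ^+ n.+1)%R]exprS.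
  have -> : (4 ^+ n = 2 ^+ n * 2 ^+ n :> R)%R.
    by rewrite -!exprMn; congr (_ ^+ n)%R; ring.
  by field; rewrite !gt_eqF.
apply: (le_trans (leeD K1 K2)).
rewrite -EFinD lee_fin le_eqVlt; apply/orP; left; apply/eqP.
by field; rewrite !gt_eqF.
Qed.

End weak_type_pairing.

(** * Truncation of a primitive on the line *)

Section line_truncation.
Context {R : realType}.
Local Notation leb := (@lebesgue_measure R).

Lemma Rintegral_tail_le (g : R -> R) (s t : R) :
  leb.-integrable setT (EFin \o g) -> s <= t ->
  `|\int[leb]_(x in `[s, +oo[) g x| <=
  `|\int[leb]_(x in `[t, +oo[) g x| + \int[leb]_(x in `[s, t]) `|g x|.
Proof.
move=> ig st.
have igS (A : set R) : measurable A -> leb.-integrable A (EFin \o g).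
  by move=> mA; apply: integrableS ig.
have := @Rintegral_itvB _ g (BLeft s) +oo%O t (igS _ (measurable_itv _)).
rewrite bnd_simp => /(_ st isT).
rewrite Rintegral_itv_obnd_cbnd; last exact: igS.
move=> /eqP; rewrite subr_eq => /eqP ->.
apply: (le_trans (ler_normD _ _)); rewrite lerD2l.
by apply: le_normr_Rintegral => //; exact: igS.
Qed.

(* Let [t0] be the first time after [s] at which [`|w| <= b]: the variation of
   [w] over [s, t0[, where [b < `|w|], is at least [b]. *)
Lemma tail_truncation (g : R -> R) (m b s : R) :
  let w t := \int[leb]_(x in `[t, +oo[) g x in
  leb.-integrable setT (EFin \o g) -> (forall x, m < x -> g x = 0) ->
  measurable_fun setT w -> 0 < b -> 2 * b < `|w s| ->
  (b%:E <= \int[leb]_(x in [set x | (b < `|w x|)%R]) (`|g x|%R)%:E)%E.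
Proof.
have aux (p q y z k e : R) :
    p <= q + (y + z) -> q <= k -> 2 * k < p -> z < e -> k <= y + e by lra.
move=> w ig gm mw b0 bws.
have igS (A : set R) : measurable A -> leb.-integrable A (EFin \o g).
  by move=> mA; apply: integrableS ig.
have inS (A : set R) : measurable A -> leb.-integrable A (EFin \o (fun x => `|g x|)).
  by move=> mA; apply: integrable_norm; exact: igS.
have w0 t : m < t -> w t = 0.
  move=> mt; rewrite /w (@eq_Rintegral _ _ _ _ _ (cst 0)).
    by rewrite Rintegral_cst// mul0r.
  by move=> x; rewrite inE/= in_itv/= andbT => tx; rewrite gm// (lt_le_trans mt).
have sm : s <= m.
  rewrite leNgt; apply/negP => /w0 ws0; move: bws; rewrite ws0 normr0.
  by rewrite ltNge mulr_ge0 ?ltW.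
(* Nonempty because [w] vanishes to the right of [m], so the infimum is a genuine stopping time. *)
pose T := [set t | s <= t /\ `|w t| <= b].
have T1 : T (m + 1).
  by split; [rewrite (le_trans sm)// lerDl|rewrite w0 ?ltrDl// normr0 ltW].
have infT : has_inf T.
  by split; [exists (m + 1)|exists s => t []].
pose t0 := inf T.
have st0 : s <= t0 by apply: lb_le_inf; [exists (m + 1)|move=> t []].
have wb t : s <= t -> t < t0 -> b < `|w t|.
  move=> st tt0; rewrite ltNge; apply/negP => wt.
  by move: tt0; rewrite ltNge; apply/negP; rewrite negbK; apply: ge_inf; [exists s => ? []|].
have mS : measurable [set x | (b < `|w x|)%R].
  by apply: measurable_superlevel; exact: measurableT_comp.
apply: (@le_trans _ _ (\int[leb]_(x in `[s, t0[) (`|g x|%R)%:E)%E); last first.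
  apply: ge0_subset_integral => //.
  - apply/measurable_EFinP; apply: measurableT_comp => //.
    by apply/measurable_EFinP; exact: (measurable_int leb (igS _ mS)).
  - by move=> x /=; rewrite in_itv/= => /andP[sx xt0]; exact: wb.
(* Instead of evaluating [w] at the infimum [t0], a point [t] of [T] is taken so close to [t0] that
   absolute continuity of the integral makes the variation over [[t0, t]] smaller than [e]. *)
apply/lee_addgt0Pr => e e0.
have := @integral_normr_continuous _ _ _ leb g ig e e0.
move=> [d [d0 Hd]].
have [t [st wt] tt0] : exists2 t, T t & t < t0 + d by exact: inf_adherent.
have t0t : t0 <= t by apply: ge_inf => //; exists s => ? [].
have H := Rintegral_tail_le ig st.
have E : (\int[leb]_(x in `[s, t]) `|g x| =
    \int[leb]_(x in `[s, t0[) `|g x| + \int[leb]_(x in `[t0, t]) `|g x|).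
  rewrite (@itv_bndbnd_setU _ _ _ (BLeft t0)) ?bnd_simp//.
  rewrite Rintegral_setU//; first by apply: inS; exact: measurableU.
  apply/disj_set2P; rewrite -subset0 => x []/=; rewrite !in_itv/=.
  by move=> /andP[_ xt0] /andP[]; rewrite leNgt xt0.
have Ht : \int[leb]_(x in `[t0, t]) `|g x| < e.
  have L : (leb `[t0, t]%classic < d%:E)%E.
    rewrite lebesgue_measure_itv/=.
    by case: ifPn => _; rewrite lte_fin// ltrBlDl.
  exact: Hd L.
have -> : (\int[leb]_(x in `[s, t0[) (`|g x|%R)%:E)%E =
    (\int[leb]_(x in `[s, t0[) `|g x|)%:E.
  by rewrite /Rintegral fineK//; apply: integrable_fin_num => //; exact: inS.
rewrite -EFinD lee_fin; rewrite E in H.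
exact: (aux _ _ _ _ _ _ H wt bws Ht).
Qed.

End line_truncation.

(** * Functions with a weak derivative along a line *)

Section density_measure.
Context d (T : measurableType d) (R : realType) (mu : {measure set T -> \bar R}).
Variables (f : T -> \bar R) (mf : measurable_fun setT f)
  (f0 : forall x, (0 <= f x)%E).
Local Open Scope ereal_scope.

(** The two proofs are arguments of the constant so that the measure structure, which depends on
    them, can be inferred from the term. *)
Definition density of measurable_fun setT f & (forall x, 0 <= f x) :=
  fun A : set T => \int[mu]_(x in A) f x.

Let density0 : density mf f0 set0 = 0.
Proof. by rewrite /density integral_set0. Qed.

Let density_ge0 A : 0 <= density mf f0 A.
Proof. by apply: integral_ge0 => x _; exact: f0. Qed.

Let density_sigma_additive : semi_sigma_additive (density mf f0).
Proof.
move=> /= F mF tF mUF; rewrite /density; apply: cvg_toP.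
  apply: ereal_nondecreasing_is_cvgn => m n mn.
  by apply: lee_sum_nneg_natr => // k _ _; exact: integral_ge0.
by rewrite ge0_integral_bigcup//=; exact: measurable_funTS.
Qed.

HB.instance Definition _ := isMeasure.Build _ _ _ (density mf f0)
  density0 density_ge0 density_sigma_additive.

End density_measure.

Section trace_measure.
Context d d' (X : measurableType d) (Z : measurableType d') (R : realType).
Variables (m : {measure set X -> \bar R}) (p : X -> Z) (D : set X).
Hypotheses (mp : measurable_fun setT p) (mD : measurable D).
Local Open Scope ereal_scope.

(** The image under [p] of the restriction of [m] to [D]. It allows uniqueness theorems for measures
    to be applied to one coordinate while the others are frozen in [D]. *)
Definition trace_image of measurable_fun setT p & measurable D :=
  fun A : set Z => m (p @^-1` A `&` D).

Let trace_image0 : trace_image mp mD set0 = 0.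
Proof. by rewrite /trace_image preimage_set0 set0I measure0. Qed.

Let trace_image_ge0 A : 0 <= trace_image mp mD A.
Proof. exact: measure_ge0. Qed.

Let trace_image_sigma_additive : semi_sigma_additive (trace_image mp mD).
Proof.
move=> F mF tF mUF; rewrite /trace_image preimage_bigcup setI_bigcupl.
have mpF n : measurable (p @^-1` F n).
  by rewrite -[X in measurable X]setTI; exact: mp.
apply: measure_semi_sigma_additive.
- by move=> n; exact: measurableI.
- apply/trivIsetP => /= i j _ _ ij; rewrite setIACA -preimage_setI.
  by move/trivIsetP : tF => /(_ _ _ _ _ ij) ->//; rewrite preimage_set0 set0I.
- by apply: bigcup_measurable => n _; exact: measurableI.
Qed.

HB.instance Definition _ := isMeasure.Build _ _ _ (trace_image mp mD)
  trace_image0 trace_image_ge0 trace_image_sigma_additive.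

End trace_measure.

(** * Measures and functions determined by open boxes *)

Section box_uniqueness.
Context {R : realType}.
Local Open Scope ereal_scope.

Lemma measure_ext_preimage d (X : measurableType d) d' (Z : measurableType d')
    (G : set (set Z)) (g : nat -> set Z) (m1 m2 : {measure set X -> \bar R})
    (p : X -> Z) (D : set X) :
  measurable = <<s G >> -> setI_closed G -> (forall i, G (g i)) ->
  \bigcup_i g i = setT -> measurable D -> measurable_fun setT p ->
  m1 setT < +oo ->
  (forall A, G A -> m1 (p @^-1` A `&` D) = m2 (p @^-1` A `&` D)) ->
  forall A, measurable A -> m1 (p @^-1` A `&` D) = m2 (p @^-1` A `&` D).
Proof.
move=> GE GI Gg gT mD mp m1T m12 A mA.
apply: (@measure_unique _ _ _ G g GE GI Gg gT
  (trace_image m1 mp mD) (trace_image m2 mp mD)) => // k.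
rewrite /= /trace_image; apply: le_lt_trans m1T; apply: le_measure; rewrite ?inE//.
apply: measurableI => //; rewrite -[X in measurable X]setTI; apply: mp => //.
by rewrite GE; exact: sub_sigma_algebra.
Qed.

Definition open_itvs : set (set (measurableTypeR R)) := @RGenOpens.G R.

Lemma setI_closed_open_itvs : setI_closed open_itvs.
Proof.
move=> _ _ [a [b ->]] [c [d ->]]; exists (Num.max a c), (Num.min b d).
apply/seteqP; split => x /=; rewrite !in_itv/= gt_max lt_min.
  by move=> [/andP[-> ->] /andP[-> ->]].
by move=> /andP[/andP[-> ->] /andP[-> ->]].
Qed.

Lemma bigcup_open_itvs : \bigcup_(n : nat) (`](- n%:R)%R, n%:R%R[%classic : set R) = setT.
Proof.
apply/seteqP; split => // x _; exists (Num.Def.archi_bound `|x|) => //=.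
by rewrite in_itv/= -ltr_norml archi_boundP.
Qed.

Lemma measure_ext_coord d (X : measurableType d) (m1 m2 : {measure set X -> \bar R})
    (p : X -> measurableTypeR R) (D : set X) :
  measurable D -> measurable_fun setT p -> m1 setT < +oo ->
  (forall a b : R, m1 (p @^-1` `]a, b[%classic `&` D) = m2 (p @^-1` `]a, b[%classic `&` D)) ->
  forall A, measurable A -> m1 (p @^-1` A `&` D) = m2 (p @^-1` A `&` D).
Proof.
move=> mD mp m1T m12; apply: (measure_ext_preimage (RGenOpens.measurableE R)
  setI_closed_open_itvs _ bigcup_open_itvs mD mp m1T).
- by move=> i; exists (- i%:R)%R, i%:R%R.
- by move=> _ [a [b ->]].
Qed.

Lemma measure_ext_prod d d' (X : measurableType d) (Y : measurableType d')
    (m1 m2 : {measure set (X * Y) -> \bar R}) :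
  m1 setT < +oo ->
  (forall A B, measurable A -> measurable B -> m1 (A `*` B) = m2 (A `*` B)) ->
  forall E, measurable E -> m1 E = m2 E.
Proof.
move=> m1T m12.
apply: (@measure_unique _ _ _ [set A `*` B | A in measurable & B in measurable]
  (fun=> setT)) => //.
- by rewrite measurable_prod_measurableType.
- move=> _ _ [A mA [B mB <-]] [A' mA' [B' mB' <-]]; rewrite -setXI.
  exists (A `&` A'); first exact: measurableI.
  by exists (B `&` B') => //; exact: measurableI.
- by move=> _; exists setT => //; exists setT => //; rewrite setXTT.
- exact: bigcup_const.
- by move=> _ [A mA [B mB <-]]; exact: m12.
Qed.

(** Open intervals are replaced by arbitrary Borel sets one factor at a time, each time by
    uniqueness on the pi-system of open intervals; products of Borel sets then determine the
    measure. *)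
Lemma measure_ext_boxes
    (m1 m2 : {measure set (measurableTypeR R * (measurableTypeR R * measurableTypeR R)) -> \bar R}) :
  m1 setT < +oo ->
  (forall a1 b1 a2 b2 a3 b3 : R,
    m1 (`]a1, b1[%classic `*` (`]a2, b2[%classic `*` `]a3, b3[%classic)) =
    m2 (`]a1, b1[%classic `*` (`]a2, b2[%classic `*` `]a3, b3[%classic))) ->
  forall E, measurable E -> m1 E = m2 E.
Proof.
move=> m1T box.
have mfst : measurable_fun [set: measurableTypeR R * (measurableTypeR R * measurableTypeR R)] fst.
  exact: measurable_fst.
have m2nd : measurable_fun [set: measurableTypeR R * (measurableTypeR R * measurableTypeR R)]
    (fst \o snd) by apply: measurableT_comp.
have m3rd : measurable_fun [set: measurableTypeR R * (measurableTypeR R * measurableTypeR R)]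
    (snd \o snd) by apply: measurableT_comp.
have s1 A a2 b2 a3 b3 : measurable A ->
    m1 (A `*` (`]a2, b2[%classic `*` `]a3, b3[%classic)) =
    m2 (A `*` (`]a2, b2[%classic `*` `]a3, b3[%classic)).
  have -> : A `*` (`]a2, b2[%classic `*` `]a3, b3[%classic) =
      fst @^-1` A `&` (setT `*` (`]a2, b2[%classic `*` `]a3, b3[%classic)).
    by apply/seteqP; split => -[x [y z]] /=; tauto.
  move: A; apply: measure_ext_coord => //.
    by apply: measurableX => //; exact: measurableX.
  move=> a1 b1; rewrite [X in m1 X](_ : _ = `]a1, b1[%classic `*` (`]a2, b2[%classic `*` `]a3, b3[%classic)).
    by rewrite box; congr (m2 _); apply/seteqP; split => -[x [y z]] /=; tauto.
  by apply/seteqP; split => -[x [y z]] /=; tauto.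
have s2 A B a3 b3 : measurable A -> measurable B ->
    m1 (A `*` (B `*` `]a3, b3[%classic)) = m2 (A `*` (B `*` `]a3, b3[%classic)).
  move=> mA; have -> : A `*` (B `*` `]a3, b3[%classic) =
      (fst \o snd) @^-1` B `&` (A `*` (setT `*` `]a3, b3[%classic)).
    by apply/seteqP; split => -[x [y z]] /=; tauto.
  move: B; apply: measure_ext_coord => //.
    by apply: measurableX => //; exact: measurableX.
  move=> a2 b2; rewrite [X in m1 X](_ : _ = A `*` (`]a2, b2[%classic `*` `]a3, b3[%classic)).
    by rewrite s1//; congr (m2 _); apply/seteqP; split => -[x [y z]] /=; tauto.
  by apply/seteqP; split => -[x [y z]] /=; tauto.
have s3 A B C : measurable A -> measurable B -> measurable C ->
    m1 (A `*` (B `*` C)) = m2 (A `*` (B `*` C)).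
  move=> mA mB; have -> : A `*` (B `*` C) =
      (snd \o snd) @^-1` C `&` (A `*` (B `*` setT)).
    by apply/seteqP; split => -[x [y z]] /=; tauto.
  move: C; apply: measure_ext_coord => //.
    by apply: measurableX => //; exact: measurableX.
  move=> a3 b3; rewrite [X in m1 X](_ : _ = A `*` (B `*` `]a3, b3[%classic)).
    by rewrite s2//; congr (m2 _); apply/seteqP; split => -[x [y z]] /=; tauto.
  by apply/seteqP; split => -[x [y z]] /=; tauto.
apply: measure_ext_prod => // A E mA.
have -> : A `*` E = snd @^-1` E `&` (A `*` setT).
  by apply/seteqP; split => -[x y] /=; tauto.
move: E; apply: (@measure_ext_preimage _ _ _ _
  [set B `*` C | B in measurable & C in measurable] (fun=> setT)) => //.
- by rewrite measurable_prod_measurableType.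
- move=> _ _ [B mB [C mC <-]] [B' mB' [C' mC' <-]]; rewrite -setXI.
  exists (B `&` B'); first exact: measurableI.
  by exists (C `&` C') => //; exact: measurableI.
- by move=> _; exists setT => //; exists setT => //; rewrite setXTT.
- exact: bigcup_const.
- exact: measurableX.
- move=> _ [B mB [C mC <-]].
  rewrite [X in m1 X](_ : _ = A `*` (B `*` C)).
    by rewrite s3//; congr (m2 _); apply/seteqP; split => -[x [y z]] /=; tauto.
  by apply/seteqP; split => -[x [y z]] /=; tauto.
Qed.

(** Both functions are densities of finite measures that agree on boxes, hence on all measurable
    sets. *)
Lemma ae_eq_boxes
    (mu : {measure set (measurableTypeR R * (measurableTypeR R * measurableTypeR R)) -> \bar R})
    (f1 f2 : measurableTypeR R * (measurableTypeR R * measurableTypeR R) -> \bar R) :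
  mu.-integrable setT f1 -> mu.-integrable setT f2 ->
  (forall x, 0 <= f1 x) -> (forall x, 0 <= f2 x) ->
  (forall a1 b1 a2 b2 a3 b3 : R,
    \int[mu]_(x in `]a1, b1[%classic `*` (`]a2, b2[%classic `*` `]a3, b3[%classic)) f1 x =
    \int[mu]_(x in `]a1, b1[%classic `*` (`]a2, b2[%classic `*` `]a3, b3[%classic)) f2 x) ->
  ae_eq mu setT f1 f2.
Proof.
move=> if1 if2 f10 f20 box.
have mf1 := measurable_int mu if1; have mf2 := measurable_int mu if2.
apply: integral_ae_eq => // E _ mE.
apply: (@measure_ext_boxes (density mu mf1 f10) (density mu mf2 f20)) => //.
rewrite /= /density; move/integrableP : if1 => [_].
by rewrite (eq_integral f1)// => x _; rewrite gee0_abs.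
Qed.

End box_uniqueness.

(* Canonically only products of (sub)probabilities are sigma-finite; iterating
   Tonelli needs it for products of Lebesgue measures. *)
Section sigma_finite_product.
Context d1 d2 (T1 : measurableType d1) (T2 : measurableType d2) (R : realType).
Variables (m1 : {sigma_finite_measure set T1 -> \bar R})
  (m2 : {sigma_finite_measure set T2 -> \bar R}).
Local Open Scope ereal_scope.

Definition sprod : set (T1 * T2) -> \bar R := m1 \x m2.

HB.instance Definition _ := Measure.copy sprod (m1 \x m2).

Let sprod_sigma_finite : sigma_finite setT sprod.
Proof.
have /sigma_finiteP[F [TF ndF Foo]] := sigma_finiteT m1.
have /sigma_finiteP[G [TG ndG Goo]] := sigma_finiteT m2.
exists (fun n => F n `*` G n) => [|n].
  apply/seteqP; split => // -[x y] _.
  have [i _ Fi] : (\bigcup_i F i) x by rewrite -TF.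
  have [j _ Gj] : (\bigcup_j G j) y by rewrite -TG.
  exists (maxn i j) => //; split => /=.
    by move: Fi; apply/subsetPset/ndF/leq_maxl.
  by move: Gj; apply/subsetPset/ndG/leq_maxr.
have [mF Fn] := Foo n; have [mG Gn] := Goo n.
split; first exact: measurableX.
by rewrite /sprod product_measure1E// lte_mul_pinfty// ge0_fin_numE.
Qed.

HB.instance Definition _ := Measure_isSigmaFinite.Build _ _ _ sprod
  sprod_sigma_finite.

End sigma_finite_product.

Lemma eq_indic (R : pzRingType) (S T : Type) (A : set S) (B : set T) x y :
  (A x <-> B y) -> \1_A x = \1_B y :> R.
Proof.
by move=> AB; rewrite !indicE; congr (nat_of_bool _)%:R; apply/idP/idP;
  rewrite !inE => /AB.
Qed.

(** * Tail integrals in the first variable *)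

Section tails.
Context d (Y : measurableType d) (R : realType).
Variable nu : {sigma_finite_measure set Y -> \bar R}.
Local Open Scope ereal_scope.
Local Notation leb := (@lebesgue_measure R).
Local Notation T1 := (measurableTypeR R).

Definition tail (g : T1 * Y -> \bar R) (z : T1 * Y) : \bar R :=
  \int[leb]_(t in `[z.1, +oo[) g (t, z.2).

(** The integrand of [tail], extended by zero to the whole line and regarded as a jointly measurable
    function of the point and the integration variable, so that Tonelli's theorem makes [tail g]
    measurable. *)
Definition shear (g : T1 * Y -> \bar R) (x : T1 * Y * T1) : \bar R :=
  g (x.2, x.1.2) * (\1_[set x : T1 * Y * T1 | (x.1.1 <= x.2)%R] x)%:E.

Lemma tailE g z : tail g z = \int[leb]_t shear g (z, t).
Proof.
rewrite /tail integral_mkcond epatch_indic; apply: eq_integral => t _ /=.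
by congr (_ * _%:E); apply: eq_indic; rewrite /= in_itv/= andbT.
Qed.

Lemma measurable_shear_set :
  measurable [set x : T1 * Y * T1 | (x.1.1 <= x.2)%R].
Proof.
rewrite -[X in measurable X]setTI.
have -> : [set x : T1 * Y * T1 | (x.1.1 <= x.2)%R] =
    (fun x : T1 * Y * T1 => (x.1.1 <= x.2)%R) @^-1` [set true].
  by apply/seteqP; split => x.
apply: (measurable_fun_ler (f := fun x : T1 * Y * T1 => x.1.1)) => //.
by apply: measurableT_comp => //; exact: measurable_fst.
Qed.

Lemma measurable_shear g : measurable_fun setT g -> measurable_fun setT (shear g).
Proof.
move=> mg; apply: emeasurable_funM.
  apply: (measurableT_comp mg); apply/measurable_fun_pairP; split.
    exact: measurable_snd.
  exact: (measurableT_comp measurable_snd measurable_fst).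
apply/measurable_EFinP; apply: measurable_indic; exact: measurable_shear_set.
Qed.

Lemma measurable_tail g : measurable_fun setT g -> (forall z, 0 <= g z) ->
  measurable_fun setT (tail g).
Proof.
move=> mg g0; rewrite (_ : tail g = fubini_F leb (shear g)).
  apply: measurable_fun_fubini_tonelli_F; first exact: measurable_shear.
  by move=> x; rewrite mule_ge0// lee_fin indicE; case: (_ \in _).
by apply/funext => z; rewrite tailE.
Qed.

Lemma tail_ge0 g z : (forall z, 0 <= g z) -> 0 <= tail g z.
Proof. by move=> g0; exact: integral_ge0. Qed.

Lemma measurable_lower_indic :
  measurable_fun setT (fun x => (\1_[set x : T1 * T1 | (x.2 <= x.1)%R] x)%:E : \bar R).
Proof.
apply/measurable_EFinP/measurable_indic; rewrite -[X in measurable X]setTI.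
have -> : [set x : T1 * T1 | (x.2 <= x.1)%R] =
    (fun x : T1 * T1 => (x.2 <= x.1)%R) @^-1` [set true].
  by apply/seteqP; split => x.
exact: measurable_fun_ler.
Qed.

Lemma lower_integralE (b : T1 -> \bar R) t :
  \int[leb]_(s in `]-oo, t]) b s =
  \int[leb]_s (b s * (\1_[set x : T1 * T1 | (x.2 <= x.1)%R] (t, s))%:E).
Proof.
rewrite integral_mkcond epatch_indic; apply: eq_integral => s _ /=.
by congr (_ * _%:E); apply: eq_indic; rewrite /= in_itv.
Qed.

Lemma measurable_lower_integral (b : T1 -> \bar R) :
  measurable_fun setT b -> (forall s, 0 <= b s) ->
  measurable_fun setT (fun t : T1 => \int[leb]_(s in `]-oo, t]) b s).
Proof.
move=> mb b0.
have -> : (fun t : T1 => \int[leb]_(s in `]-oo, t]) b s) =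
    fubini_F leb (fun x : T1 * T1 =>
      b x.2 * (\1_[set x : T1 * T1 | (x.2 <= x.1)%R] x)%:E).
  by apply/funext => t; rewrite lower_integralE.
apply: measurable_fun_fubini_tonelli_F.
  apply: emeasurable_funM; last exact: measurable_lower_indic.
  by apply: measurableT_comp.
by move=> x; rewrite mule_ge0// lee_fin indicE; case: (_ \in _).
Qed.

(** Integration over [[s, +oo[] and integration over []-oo, t]] are adjoint to each other: both
    sides integrate over the region [s <= t], in opposite orders. *)
Lemma tail_tonelli (g : T1 * Y -> \bar R) (b : T1 -> \bar R) (c : Y -> \bar R) :
  measurable_fun setT g -> (forall z, 0 <= g z) ->
  measurable_fun setT b -> (forall s, 0 <= b s) ->
  measurable_fun setT c -> (forall y, 0 <= c y) ->
  \int[leb \x nu]_z (tail g z * (b z.1 * c z.2)) =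
  \int[leb \x nu]_z (g z * ((\int[leb]_(s in `]-oo, z.1]) b s) * c z.2)).
Proof.
move=> mg g0 mb b0 mc c0.
have mI1 := measurable_lower_indic.
pose I x := (\1_[set x : T1 * T1 | (x.2 <= x.1)%R] x)%:E : \bar R.
have I0 x : 0 <= I x by rewrite lee_fin indicE; case: (_ \in _).
pose Fb (t : T1) : \bar R := \int[leb]_(s in `]-oo, t]) b s.
have FbE t : Fb t = \int[leb]_s (b s * I (t, s)) by exact: lower_integralE.
have mFb : measurable_fun setT Fb by exact: measurable_lower_integral.
have Fb0 t : 0 <= Fb t by exact: integral_ge0.
rewrite fubini_tonelli2; last 2 first.
- apply: emeasurable_funM; first exact: measurable_tail.
  apply: emeasurable_funM; first by apply: measurableT_comp => //; exact: measurable_fst.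
  by apply: measurableT_comp => //; exact: measurable_snd.
- by move=> z; rewrite !mule_ge0 ?tail_ge0.
rewrite [RHS]fubini_tonelli2; last 2 first.
- apply: emeasurable_funM => //.
  apply: emeasurable_funM; first by apply: (measurableT_comp mFb); exact: measurable_fst.
  by apply: measurableT_comp => //; exact: measurable_snd.
- by move=> z; rewrite !mule_ge0 ?Fb0.
apply: eq_integral => y _; rewrite /fubini_G /=.
have mgy : measurable_fun setT (fun t : T1 => g (t, y)).
  exact: (measurableT_comp mg (@pair2_measurable _ _ _ _ y)).
pose K (x : T1 * T1) := g (x.1, y) * (b x.2 * I x) * c y.
have mK : measurable_fun setT K.
  apply: emeasurable_funM => //; apply: emeasurable_funM.
    by apply: (measurableT_comp mgy); exact: measurable_fst.
  apply: emeasurable_funM => //; apply: measurableT_comp => //; exact: measurable_snd.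
have K0 x : 0 <= K x by rewrite !mule_ge0.
transitivity (\int[leb]_s \int[leb]_t K (t, s)).
  apply: eq_integral => s _; rewrite tailE/=.
  rewrite muleC -ge0_integralZl//; last 3 first.
  - apply: (measurableT_comp (measurable_shear mg)).
    exact: pair1_measurable.
  - by move=> t _; rewrite mule_ge0// lee_fin indicE; case: (_ \in _).
  - by rewrite mule_ge0.
  apply: eq_integral => t _; rewrite /K /shear /I /= muleCA -!muleA.
  congr (_ * _); rewrite muleA muleAC -!muleA; congr (_ * _).
rewrite -(fubini_tonelli K)//.
apply: eq_integral => t _; rewrite -/(Fb t) FbE.
under eq_integral do rewrite /K -muleA /=.
rewrite ge0_integralZl//; last 2 first.
- apply: emeasurable_funM => //; apply: emeasurable_funM => //.
  exact: (measurableT_comp mI1 (@pair1_measurable _ _ _ _ t)).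
- by move=> s _; rewrite !mule_ge0.
congr (_ * _); rewrite ge0_integralZr//.
- apply: emeasurable_funM => //.
  exact: (measurableT_comp mI1 (@pair1_measurable _ _ _ _ t)).
- by move=> s _; rewrite mule_ge0.
Qed.

End tails.

Section bump_primitive.
Context {R : realType}.
Local Notation leb := (@lebesgue_measure R).

Lemma continuous_bump (c a b : R) : 0 < c -> continuous (bump c a b).
Proof. by move=> c0; exact: smooth_continuous (smooth_bump a b c0). Qed.

Lemma measurable_bump (c a b : R) : 0 < c -> measurable_fun setT (bump c a b).
Proof. by move=> c0; apply: continuous_measurable_fun; exact: continuous_bump. Qed.

Lemma bump_le_indic (c a b s : R) : 0 < c -> bump c a b s <= \1_(`]a, b[%classic) s.
Proof.
move=> c0; rewrite indicE; case: (boolP (s \in _)) => sab.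
  exact: bump_le1.
by rewrite bump_eq0//; apply: contra sab => sab; rewrite inE.
Qed.

Lemma integrable_bump (c a b : R) : 0 < c ->
  leb.-integrable setT (EFin \o bump c a b).
Proof.
move=> c0.
have : leb.-integrable setT (EFin \o \1_(`]a, b[%classic)).
  exact: integrable_indic_itv.
apply: le_integrable => //.
- by apply/measurable_EFinP; exact: measurable_bump.
- move=> x _ /=; rewrite lee_fin !ger0_norm ?bump_ge0//.
  exact: bump_le_indic.
Qed.

(** Smooth and bounded, but constant to the right of [b]: it becomes a test function only after
    multiplication by a cut-off. *)
Definition bump_prim (c a b s : R) : R :=
  \int[leb]_(t in `]-oo, s]) bump c a b t.

Lemma bump_primE (c a b s : R) : 0 < c ->
  (bump_prim c a b s)%:E = (\int[leb]_(t in `]-oo, s]) (bump c a b t)%:E)%E.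
Proof.
move=> c0; rewrite /bump_prim /Rintegral fineK//.
apply: integrable_fin_num => //; apply: integrableS (integrable_bump a b c0) => //.
Qed.

Lemma bump_prim_ge0 (c a b s : R) : 0 <= bump_prim c a b s.
Proof. by apply: Rintegral_ge0 => x _; exact: bump_ge0. Qed.

Lemma bump_prim_le (c a b s : R) : 0 < c -> bump_prim c a b s <= `|b - a|.
Proof.
move=> c0; rewrite -lee_fin bump_primE//.
have mb D : measurable_fun D (EFin \o bump c a b).
  by apply/measurable_EFinP/measurable_funTS; exact: measurable_bump.
apply: (@le_trans _ _ (\int[leb]_(t in setT) (bump c a b t)%:E)%E).
  apply: ge0_subset_integral => //; first exact: mb.
  by move=> x _; rewrite lee_fin bump_ge0.
apply: (@le_trans _ _ (\int[leb]_(t in setT) (\1_(`]a, b[%classic) t)%:E)%E).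
  apply: ge0_le_integral => //.
  - by move=> x _; rewrite lee_fin bump_ge0.
  - exact: mb.
  - by apply/measurable_EFinP; exact: measurable_indic.
  - by move=> x _; rewrite lee_fin bump_le_indic.
have L : (leb `]a, b[%classic <= `|b - a|%:E)%E.
  rewrite lebesgue_measure_itv/=; case: ifPn => _; rewrite lee_fin//.
  exact: ler_norm.
by rewrite integral_indic// setIT; exact: L.
Qed.

Lemma is_derive_bump_prim (c a b s : R) : 0 < c ->
  is_derive s 1 (bump_prim c a b) (bump c a b s).
Proof.
move=> c0.
have s1 : s < s + 1 by rewrite ltrDl.
have i1 : leb.-integrable [set` Interval -oo%O (BRight (s + 1))]
    (EFin \o bump c a b).
  by apply: integrableS (integrable_bump a b c0).
have := continuous_FTC1 s1 i1 _ (@continuous_bump c a b c0 s).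
case; first by rewrite ltNyr.
move=> dF; rewrite derive1E => FE; exact: DeriveDef dF FE.
Qed.

Lemma smooth_bump_prim (c a b : R) : 0 < c -> smooth (bump_prim c a b : R^o -> R).
Proof.
move=> c0.
pose C (f : R -> R) := f = bump_prim c a b \/ smooth (f : R^o -> R).
apply: (@smooth_class _ _ C); last by left.
- move=> f [-> x|sf x]; last exact: smooth_differentiable.
  by apply/derivable1_diffP; have [] := @is_derive_bump_prim c a b x c0.
- move=> f v [->|sf]; right; last exact: smooth_derive.
  rewrite (_ : 'D_v _ = cst v \* bump c a b).
    by apply: smooth_mul; [exact: smooth_cst|exact: smooth_bump].
  apply/funext => x.
  have d := @is_derive_bump_prim c a b x c0.
  have df : differentiable (bump_prim c a b) (x : R^o) by apply/derivable1_diffP.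
  by rewrite (derive_affine_comp (L := id) v (is_diff_id _) df) derive_val.
Qed.

End bump_primitive.

(** * Recovery of a function from its weak derivative on lines *)

Section slices.
Context {R : realType}.
Local Open Scope ereal_scope.
Local Notation leb := (@lebesgue_measure R).
Local Notation T1 := (measurableTypeR R).
Local Notation T2 := (T1 * T1)%type.
Local Notation mu2 := (sprod leb leb).
Local Notation mu3 := (leb \x mu2).

Lemma integral_mul_posneg d (X : measurableType d) (m : {measure set X -> \bar R})
    (f B : X -> R) (K : R) :
  m.-integrable setT (EFin \o f) -> measurable_fun setT B ->
  (forall x, 0 <= B x <= K)%R ->
  [/\ \int[m]_x ((EFin \o f)^\+ x * (B x)%:E) < +oo,
      \int[m]_x ((EFin \o f)^\- x * (B x)%:E) < +oo &
      \int[m]_x (f x * B x)%:E =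
      \int[m]_x ((EFin \o f)^\+ x * (B x)%:E) -
      \int[m]_x ((EFin \o f)^\- x * (B x)%:E)].
Proof.
move=> intf mB BK.
have B0 x : (0 <= B x)%R by have /andP[] := BK x.
have bB : [bounded B x | x in setT].
  exists K; split; first exact: num_real.
  by move=> M KM x _ /=; rewrite ger0_norm// (le_trans _ (ltW KM))//;
    have /andP[] := BK x.
have ip : m.-integrable setT (fun x => (EFin \o f)^\+ x * (B x)%:E).
  by apply: integrableMl => //; exact: integrable_funepos.
have im : m.-integrable setT (fun x => (EFin \o f)^\- x * (B x)%:E).
  by apply: integrableMl => //; exact: integrable_funeneg.
have lt g : m.-integrable setT g -> (forall x, 0 <= g x) -> \int[m]_x g x < +oo.
  move=> /integrableP[_ + g0].
  by rewrite (eq_integral g)// => x _; rewrite gee0_abs.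
split.
- by apply: lt => // x; rewrite mule_ge0 ?funepos_ge0 ?lee_fin.
- by apply: lt => // x; rewrite mule_ge0 ?funeneg_ge0 ?lee_fin.
rewrite -integralB//; apply: eq_integral => x _.
rewrite funeposE funenegE /= -EFin_max -EFin_max -!EFinM -EFinB.
congr (_%:E); rewrite -mulrBl; congr (_ * _)%R.
by case: (leP (f x) 0%R) => f0; case: (leP (- f x)%R 0%R) => f1; lra.
Qed.


Definition bump3 (c a1 b1 a2 b2 a3 b3 : R) (z : T1 * T2) : R :=
  (bump c a1 b1 z.1 * (bump c a2 b2 z.2.1 * bump c a3 b3 z.2.2))%R.

Definition bump3_prim (c a1 b1 a2 b2 a3 b3 : R) (z : T1 * T2) : R :=
  (bump_prim c a1 b1 z.1 * (bump c a2 b2 z.2.1 * bump c a3 b3 z.2.2))%R.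

Lemma measurable_bump2 (c a2 b2 a3 b3 : R) : (0 < c)%R ->
  measurable_fun setT (fun y : T2 => bump c a2 b2 y.1 * bump c a3 b3 y.2)%R.
Proof.
move=> c0; apply: measurable_funM.
  by apply: (measurableT_comp (measurable_bump a2 b2 c0)); exact: measurable_fst.
by apply: (measurableT_comp (measurable_bump a3 b3 c0)); exact: measurable_snd.
Qed.

Lemma measurable_bump3 (c a1 b1 a2 b2 a3 b3 : R) : (0 < c)%R ->
  measurable_fun setT (bump3 c a1 b1 a2 b2 a3 b3).
Proof.
move=> c0; apply: measurable_funM.
  by apply: (measurableT_comp (measurable_bump a1 b1 c0)); exact: measurable_fst.
by apply: (measurableT_comp (measurable_bump2 a2 b2 a3 b3 c0)); exact: measurable_snd.
Qed.

Lemma measurable_bump3_prim (c a1 b1 a2 b2 a3 b3 : R) : (0 < c)%R ->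
  measurable_fun setT (bump3_prim c a1 b1 a2 b2 a3 b3).
Proof.
move=> c0; apply: measurable_funM.
  apply: (@measurableT_comp _ _ _ _ _ _ (bump_prim c a1 b1)); last exact: measurable_fst.
  apply: continuous_measurable_fun; exact: smooth_continuous (smooth_bump_prim a1 b1 c0).
by apply: (measurableT_comp (measurable_bump2 a2 b2 a3 b3 c0)); exact: measurable_snd.
Qed.

Lemma bump3_bounds (c a1 b1 a2 b2 a3 b3 : R) z : (0 < c)%R ->
  (0 <= bump3 c a1 b1 a2 b2 a3 b3 z <= 1)%R.
Proof.
move=> c0; apply/andP; split.
  by apply: mulr_ge0; [|apply: mulr_ge0]; exact: bump_ge0.
by apply: mulr_ile1; [| apply: mulr_ge0| |apply: mulr_ile1];
  rewrite ?bump_ge0 ?bump_le1.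
Qed.

Lemma bump3_prim_bounds (c a1 b1 a2 b2 a3 b3 : R) z : (0 < c)%R ->
  (0 <= bump3_prim c a1 b1 a2 b2 a3 b3 z <= `|b1 - a1|)%R.
Proof.
move=> c0; apply/andP; split.
  by apply: mulr_ge0; [exact: bump_prim_ge0|apply: mulr_ge0; exact: bump_ge0].
rewrite -[leRHS]mulr1; apply: ler_pM.
- exact: bump_prim_ge0.
- by apply: mulr_ge0; exact: bump_ge0.
- exact: bump_prim_le.
- by apply: mulr_ile1; rewrite ?bump_ge0 ?bump_le1.
Qed.

Lemma bump3_cvg (a1 b1 a2 b2 a3 b3 : R) z :
  bump3 n.+1%:R^-1 a1 b1 a2 b2 a3 b3 z @[n --> \oo] -->
  (\1_(`]a1, b1[%classic `*` (`]a2, b2[%classic `*` `]a3, b3[%classic)) z : R).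
Proof.
have H a b s : bump n.+1%:R^-1 a b s @[n --> \oo] --> (\1_(`]a, b[%classic) s : R).
  rewrite indicE; case: (boolP (s \in `]a, b[%classic)) => sab.
    by apply: bump_cvg1; rewrite inE in sab.
  rewrite (_ : (fun n => _) = cst 0%R); first exact: cvg_cst.
  apply/funext => n; rewrite bump_eq0//.
  by apply: contra sab => sab; rewrite inE.
have -> : (\1_(`]a1, b1[%classic `*` (`]a2, b2[%classic `*` `]a3, b3[%classic)) z : R) =
    (\1_(`]a1, b1[%classic) z.1 * (\1_(`]a2, b2[%classic) z.2.1 * \1_(`]a3, b3[%classic) z.2.2))%R.
  by rewrite !indicE !in_setX -!natrM !mulnb.
by apply: cvgM; [exact: H|apply: cvgM; exact: H].
Qed.

Lemma tail_bump3 (g : T1 * T2 -> \bar R) (c a1 b1 a2 b2 a3 b3 : R) : (0 < c)%R ->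
  measurable_fun setT g -> (forall z, 0 <= g z) ->
  \int[mu3]_z (tail g z * (bump3 c a1 b1 a2 b2 a3 b3 z)%:E) =
  \int[mu3]_z (g z * (bump3_prim c a1 b1 a2 b2 a3 b3 z)%:E).
Proof.
move=> c0 mg g0.
pose b (s : T1) := (bump c a1 b1 s)%:E.
pose k (y : T2) := (bump c a2 b2 y.1 * bump c a3 b3 y.2)%:E.
have mb : measurable_fun setT b.
  by apply/measurable_EFinP; exact: measurable_bump.
have b0 s : 0 <= b s by rewrite lee_fin bump_ge0.
have mk : measurable_fun setT k.
  by apply/measurable_EFinP; exact: measurable_bump2.
have k0 y : 0 <= k y by rewrite lee_fin mulr_ge0 ?bump_ge0.
have := tail_tonelli mu2 mg g0 mb b0 mk k0.
under eq_integral do rewrite -EFinM.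
move=> ->.
by apply: eq_integral => z _; rewrite /b -bump_primE.
Qed.

(** The tail of an integrable function need not be integrable in the first variable over the whole
    line. On the strip [|z.1| < M] its integral is at most [2 M] times that of [g]. *)
Lemma tail_strip_lty (g : T1 * T2 -> \bar R) (M : R) :
  measurable_fun setT g -> (forall z, 0 <= g z) -> \int[mu3]_z g z < +oo ->
  \int[mu3]_z (tail g z * (\1_(`]- M, M[%classic) z.1)%:E) < +oo.
Proof.
move=> mg g0 goo.
have mb : measurable_fun setT (fun s : T1 => (\1_(`](- M)%R, M[%classic) s)%:E : \bar R).
  by apply/measurable_EFinP; exact: measurable_indic.
have b0 (s : T1) : 0 <= (\1_(`](- M)%R, M[%classic) s)%:E :> \bar R.
  by rewrite lee_fin indicE; case: (_ \in _).
have := tail_tonelli mu2 mg g0 mb b0 (measurable_cst (1 : \bar R)) (fun=> lee01).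
under eq_integral do rewrite /= mule1.
move=> ->.
under eq_integral do rewrite /= mule1.
have L : leb `](- M)%R, M[%classic <= `|M - - M|%:E.
  rewrite lebesgue_measure_itv/=; case: ifPn => _; rewrite lee_fin//.
  exact: ler_norm.
have Fle (s : T1) : \int[leb]_(t in `]-oo, s]) (\1_(`](- M)%R, M[%classic) t)%:E <=
    `|M - - M|%:E.
  rewrite integral_indic//; apply: le_trans L; apply: le_measure; rewrite ?inE//.
  exact: measurableI.
apply: (@le_lt_trans _ _ (\int[mu3]_z (g z * `|M - - M|%:E))).
  apply: ge0_le_integral => //.
  - by move=> z _; rewrite mule_ge0// integral_ge0.
  - apply: emeasurable_funM => //.
    exact: (measurableT_comp (measurable_lower_integral mb b0) measurable_fst).
  - exact: emeasurable_funM.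
  - by move=> z _; rewrite lee_wpmul2l.
by rewrite ge0_integralZr// muleC lte_mul_pinfty.
Qed.


Section representation.
Variables v G : T1 * T2 -> R.
Hypotheses (iv : mu3.-integrable setT (EFin \o v))
  (iG : mu3.-integrable setT (EFin \o G)).
Hypothesis vG : forall c a1 b1 a2 b2 a3 b3 : R, (0 < c)%R ->
  \int[mu3]_z (v z * bump3 c a1 b1 a2 b2 a3 b3 z)%:E =
  - \int[mu3]_z (G z * bump3_prim c a1 b1 a2 b2 a3 b3 z)%:E.

Let vp := (EFin \o v)^\+.
Let vn := (EFin \o v)^\-.
Let gp := (EFin \o G)^\+.
Let gn := (EFin \o G)^\-.

Let mv : measurable_fun setT (EFin \o v) := measurable_int _ iv.
Let mG : measurable_fun setT (EFin \o G) := measurable_int _ iG.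
Let mvp : measurable_fun setT vp. Proof. exact: measurable_funepos. Qed.
Let mvn : measurable_fun setT vn. Proof. exact: measurable_funeneg. Qed.
Let mgp : measurable_fun setT gp. Proof. exact: measurable_funepos. Qed.
Let mgn : measurable_fun setT gn. Proof. exact: measurable_funeneg. Qed.
Let vp0 z : 0 <= vp z. Proof. exact: funepos_ge0. Qed.
Let vn0 z : 0 <= vn z. Proof. exact: funeneg_ge0. Qed.
Let gp0 z : 0 <= gp z. Proof. exact: funepos_ge0. Qed.
Let gn0 z : 0 <= gn z. Proof. exact: funeneg_ge0. Qed.

(** The identity sought is [v = - tail G]. Moving the negative parts across turns it into [f1 = f2]
    between nonnegative functions, to which Tonelli's theorem and uniqueness of measures apply. *)
Let f1 z := vp z + tail gp z.
Let f2 z := vn z + tail gn z.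
Let mf1 : measurable_fun setT f1.
Proof. by apply: emeasurable_funD => //; exact: measurable_tail. Qed.
Let mf2 : measurable_fun setT f2.
Proof. by apply: emeasurable_funD => //; exact: measurable_tail. Qed.
Let f10 z : 0 <= f1 z. Proof. by rewrite adde_ge0 ?tail_ge0. Qed.
Let f20 z : 0 <= f2 z. Proof. by rewrite adde_ge0 ?tail_ge0. Qed.

Lemma representation_bump3 c a1 b1 a2 b2 a3 b3 : (0 < c)%R ->
  \int[mu3]_z (f1 z * (bump3 c a1 b1 a2 b2 a3 b3 z)%:E) =
  \int[mu3]_z (f2 z * (bump3 c a1 b1 a2 b2 a3 b3 z)%:E).
Proof.
move=> c0; set B := bump3 _ _ _ _ _ _ _; set P := bump3_prim c a1 b1 a2 b2 a3 b3.
have mB : measurable_fun setT B by exact: measurable_bump3.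
have mP : measurable_fun setT P by exact: measurable_bump3_prim.
have B0 z : 0 <= (B z)%:E.
  by rewrite lee_fin; have /andP[] := bump3_bounds a1 b1 a2 b2 a3 b3 z c0.
have split_int w g : measurable_fun setT w -> (forall z, 0 <= w z) ->
    measurable_fun setT g -> (forall z, 0 <= g z) ->
    \int[mu3]_z ((w z + tail g z) * (B z)%:E) =
    \int[mu3]_z (w z * (B z)%:E) + \int[mu3]_z (g z * (P z)%:E).
  move=> mw w0 mg g0; rewrite -tail_bump3// -ge0_integralD//.
  - by apply: eq_integral => z _; rewrite ge0_muleDl ?tail_ge0.
  - by move=> z _; rewrite mule_ge0.
  - by apply: emeasurable_funM => //; exact/measurable_EFinP.
  - by move=> z _; rewrite mule_ge0 ?tail_ge0.
  - by apply: emeasurable_funM; [exact: measurable_tail|exact/measurable_EFinP].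
rewrite !split_int//.
have [p1 n1 e1] := integral_mul_posneg iv mB
  (fun z => bump3_bounds a1 b1 a2 b2 a3 b3 z c0).
have [p2 n2 e2] := integral_mul_posneg iG mP
  (fun z => bump3_prim_bounds a1 b1 a2 b2 a3 b3 z c0).
have P0 z : 0 <= (P z)%:E.
  by rewrite lee_fin; have /andP[] := bump3_prim_bounds a1 b1 a2 b2 a3 b3 z c0.
have := vG a1 b1 a2 b2 a3 b3 c0; rewrite e1 e2.
move: p1 n1 p2 n2; rewrite -/vp -/vn -/gp -/gn.
have ge0 w Q : (forall z, 0 <= w z) -> (forall z, 0 <= (Q z)%:E) ->
    0 <= \int[mu3]_z (w z * (Q z)%:E).
  by move=> w0 Q0; apply: integral_ge0 => z _; rewrite mule_ge0.
have := ge0 _ _ vp0 B0; have := ge0 _ _ vn0 B0.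
have := ge0 _ _ gp0 P0; have := ge0 _ _ gn0 P0.
move: (\int[_]_z (vp z * _)) (\int[_]_z (vn z * _))
  (\int[_]_z (gp z * _)) (\int[_]_z (gn z * _)).
move=> [x1| |] [x2| |] [x3| |] [x4| |]//= _ _ _ _ _ _ _ _.
by move=> -[] H; rewrite -!EFinD; congr (_%:E); lra.
Qed.

Lemma representation_strip (M : R) : ae_eq mu3 setT
  (fun z => f1 z * (\1_(`]- M, M[%classic) z.1)%:E)
  (fun z => f2 z * (\1_(`]- M, M[%classic) z.1)%:E).
Proof.
have mI : measurable_fun setT (fun z : T1 * T2 => (\1_(`](- M)%R, M[%classic) z.1)%:E : \bar R).
  apply/measurable_EFinP.
  have mi : measurable_fun setT (\1_(`](- M)%R, M[%classic) : T1 -> R).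
    exact: measurable_indic.
  exact: (measurableT_comp mi measurable_fst).
have I0 (z : T1 * T2) : 0 <= (\1_(`](- M)%R, M[%classic) z.1)%:E :> \bar R.
  by rewrite lee_fin indicE; case: (_ \in _).
have I1 (z : T1 * T2) : (\1_(`](- M)%R, M[%classic) z.1)%:E <= 1 :> \bar R.
  by rewrite lee_fin indicE; case: (_ \in _).
have int w g : mu3.-integrable setT w -> (forall z, 0 <= w z) ->
    mu3.-integrable setT g -> (forall z, 0 <= g z) ->
    mu3.-integrable setT
      (fun z => (w z + tail g z) * (\1_(`](- M)%R, M[%classic) z.1)%:E).
  move=> iw w0 ig g0.
  have mw := measurable_int _ iw; have mg := measurable_int _ ig.
  apply/integrableP; split.
    by apply: emeasurable_funM => //; apply: emeasurable_funD => //; exact: measurable_tail.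
  rewrite (eq_integral (fun z => w z * (\1_(`](- M)%R, M[%classic) z.1)%:E +
      tail g z * (\1_(`](- M)%R, M[%classic) z.1)%:E)); last first.
    move=> z _; rewrite gee0_abs; first by rewrite ge0_muleDl ?tail_ge0.
    by rewrite mule_ge0// adde_ge0 ?tail_ge0.
  have lt k : mu3.-integrable setT k -> (forall z, 0 <= k z) -> \int[mu3]_z k z < +oo.
    move=> /integrableP[_ + k0].
    by rewrite (eq_integral k)// => x _; rewrite gee0_abs.
  rewrite ge0_integralD//; last 4 first.
  - by move=> z _; rewrite mule_ge0.
  - exact: emeasurable_funM.
  - by move=> z _; rewrite mule_ge0 ?tail_ge0.
  - by apply: emeasurable_funM => //; exact: measurable_tail.
  apply: lte_add_pinfty; last by apply: tail_strip_lty => //; exact: lt.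
  apply: le_lt_trans (lt _ iw w0); apply: ge0_le_integral => //.
  - by move=> z _; rewrite mule_ge0.
  - exact: emeasurable_funM.
  - by move=> z _; rewrite -[leRHS]mule1 lee_wpmul2l.
have if1 := int _ _ (integrable_funepos measurableT iv) vp0
  (integrable_funepos measurableT iG) gp0.
have if2 := int _ _ (integrable_funeneg measurableT iv) vn0
  (integrable_funeneg measurableT iG) gn0.
apply: ae_eq_boxes => //.
- by move=> z; rewrite mule_ge0 ?f10.
- by move=> z; rewrite mule_ge0 ?f20.
move=> a1 b1 a2 b2 a3 b3.
set E := (X in \int[mu3]_(x in X) _ = _).
have mE : measurable E by apply: measurableX => //; exact: measurableX.
(* Bumps supported in the intersection of the box with the strip. They tend to its indicator as the
   parameter [1 / (n + 1)] vanishes, and they are dominated by the indicator of the strip, on which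
   [f1] and [f2] are integrable. *)
pose B n := bump3 n.+1%:R^-1 (Num.max a1 (- M)%R) (Num.min b1 M) a2 b2 a3 b3.
have n0 n : (0 < n.+1%:R^-1 :> R)%R by rewrite invr_gt0 ltr0n.
have BI n z : (B n z)%:E = (\1_(`](- M)%R, M[%classic) z.1)%:E * (B n z)%:E.
  rewrite /B /bump3 indicE; case: (boolP (z.1 \in _)) => zM; first by rewrite mul1e.
  rewrite bump_eq0 ?mul0r ?mule0//; apply: contra zM => zM.
  rewrite inE/=; move: zM; rewrite !in_itv/=.
  by rewrite gt_max lt_min => /andP[/andP[_ ->] /andP[_ ->]].
pose E' : set (T1 * T2) := `](Num.max a1 (- M))%R, (Num.min b1 M)[%classic `*`
  (`]a2, b2[%classic `*` `]a3, b3[%classic).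
have EE' (z : T1 * T2) : (\1_(`](- M)%R, M[%classic) z.1)%:E * (\1_E z)%:E =
    (\1_(`](- M)%R, M[%classic) z.1)%:E * (\1_E' z)%:E :> \bar R.
  rewrite !indicE; case: (boolP (z.1 \in _)) => zM; last by rewrite !mul0e.
  congr (_ * (nat_of_bool _)%:R%:E); rewrite /E /E' !in_setX; congr (_ && _).
  move: zM; rewrite inE/= in_itv/= => /andP[Mz zM].
  apply/idP/idP; rewrite !inE/= !in_itv/= gt_max lt_min Mz zM !andbT//.
have lim f : measurable_fun setT f ->
    mu3.-integrable setT (fun z => f z * (\1_(`](- M)%R, M[%classic) z.1)%:E) ->
    \int[mu3]_z (f z * (B n z)%:E) @[n --> \oo] -->
    \int[mu3]_(z in E) (f z * (\1_(`](- M)%R, M[%classic) z.1)%:E).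
  move=> mf intf.
  have := @dominated_convergence _ _ _ mu3 setT measurableT
    (fun n z => f z * (B n z)%:E)
    (fun z => f z * (\1_(`](- M)%R, M[%classic) z.1)%:E * (\1_E' z)%:E)
    (fun z => `|f z * (\1_(`](- M)%R, M[%classic) z.1)%:E|).
  case.
  - move=> n; apply: emeasurable_funM => //; apply/measurable_EFinP.
    exact: measurable_bump3.
  - apply: emeasurable_funM; first exact: emeasurable_funM.
    apply/measurable_EFinP; apply: measurable_indic.
    by apply: measurableX => //; exact: measurableX.
  - have := integrable_ae measurableT intf; apply: filterS => z /(_ I) ffin _.
    under eq_fun do rewrite BI muleA.
    apply: cvgeZl => //; apply: cvg_EFin; first exact: nearW.
    exact: bump3_cvg.
  - exact: integrable_abse.
  - apply: aeW => z n _.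
    rewrite BI muleA abseM -[leRHS]mule1 lee_wpmul2l//.
    rewrite gee0_abs lee_fin; first by have /andP[] := bump3_bounds (Num.max a1 (- M)%R) (Num.min b1 M) a2 b2 a3 b3 z (n0 n).
    by have /andP[] := bump3_bounds (Num.max a1 (- M)%R) (Num.min b1 M) a2 b2 a3 b3 z (n0 n).
  move=> _ _; rewrite [X in _ --> X -> _](_ : _ =
    \int[mu3]_(z in E) (f z * (\1_(`](- M)%R, M[%classic) z.1)%:E))//.
  rewrite [in RHS]integral_mkcond epatch_indic; apply: eq_integral => z _ /=.
  by rewrite -!muleA EE'.
have e n := representation_bump3 (Num.max a1 (- M)%R) (Num.min b1 M) a2 b2 a3 b3 (n0 n).
have c1 := lim _ mf1 if1; have c2 := lim _ mf2 if2.
have ee : (fun n => \int[mu3]_z (f1 z * (B n z)%:E)) =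
    (fun n => \int[mu3]_z (f2 z * (B n z)%:E)) by apply/funext.
rewrite ee in c1.
exact: (cvg_unique (@ereal_hausdorff R) c1 c2).
Qed.

(** The strips []-n, n[] exhaust the line. At almost every point both tails are finite, and there
    [f1 = f2] can be rearranged into the signed identity. *)
Lemma slice_representation : \forall z \ae mu3,
  v z = (- \int[leb]_(t in `[z.1, +oo[) G (t, z.2))%R.
Proof.
have lt k : mu3.-integrable setT k -> (forall z, 0 <= k z) -> \int[mu3]_z k z < +oo.
  move=> /integrableP[_ + k0].
  by rewrite (eq_integral k)// => x _; rewrite gee0_abs.
have tfin k : mu3.-integrable setT k -> (forall z, 0 <= k z) ->
    forall n : nat, \forall z \ae mu3,
      tail k z * (\1_(`](- n%:R)%R, n%:R%R[%classic) z.1)%:E \is a fin_num.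
  move=> ik k0 n.
  have mk := measurable_int _ ik.
  have mi : measurable_fun setT (\1_(`](- n%:R)%R, n%:R%R[%classic) : T1 -> R).
    exact: measurable_indic.
  have H : mu3.-integrable setT
      (fun z => tail k z * (\1_(`](- n%:R)%R, n%:R%R[%classic) z.1)%:E).
    apply/integrableP; split.
      apply: emeasurable_funM; first exact: measurable_tail.
      by apply/measurable_EFinP; exact: (measurableT_comp mi measurable_fst).
    rewrite (eq_integral (fun z => tail k z * (\1_(`](- n%:R)%R, n%:R%R[%classic) z.1)%:E)).
      by apply: tail_strip_lty => //; exact: lt.
    by move=> z _; rewrite gee0_abs// mule_ge0 ?tail_ge0.
  by have := integrable_ae measurableT H; apply: filterS => z; apply.
have /ae_foralln P1 := tfin _ (integrable_funepos measurableT iG) gp0.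
have /ae_foralln P2 := tfin _ (integrable_funeneg measurableT iG) gn0.
have /ae_foralln P3 := fun n : nat => representation_strip n%:R.
move: P1 P2 P3; apply: filterS3 => z F1 F2 F3.
have [n _ zn] : (\bigcup_(n : nat) (`](- n%:R)%R, n%:R%R[%classic : set R)) z.1.
  by rewrite bigcup_open_itvs.
have I1 : (\1_(`](- n%:R)%R, n%:R%R[%classic) z.1)%:E = 1 :> \bar R.
  by rewrite indicE mem_set.
have := F1 n; have := F2 n; have := F3 n I.
rewrite I1 !mule1 /f1 /f2 /vp /vn funeposE funenegE /=.
have -> : (\int[leb]_(t in `[z.1, +oo[) G (t, z.2) = fine (tail gp z - tail gn z))%R.
  rewrite /Rintegral integralE; congr (fine (_ - _)).
    by apply: eq_integral => x _; rewrite /gp !funeposE.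
  by apply: eq_integral => x _; rewrite /gn !funenegE.
case: (tail gp z) => [x1| |]//; case: (tail gn z) => [x2| |]//=.
rewrite -EFin_max -EFin_max -!EFinD => -[] H _ _; move: H.
by case: (leP (v z) 0%R) => ?; case: (leP (- v z)%R 0%R) => ?; lra.
Qed.

End representation.

End slices.

Section slice_cylinders.
Context {R : realType}.
Local Open Scope ereal_scope.
Local Notation leb := (@lebesgue_measure R).
Local Notation T1 := (measurableTypeR R).
Local Notation T2 := (T1 * T1)%type.
Local Notation mu2 := (sprod leb leb).
Local Notation mu3 := (leb \x mu2).

Lemma Rintegral_tailE (G : T1 * T2 -> R) (z : T1 * T2) :
  (\int[leb]_(t in `[z.1, +oo[) G (t, z.2))%R =
  fine (tail (EFin \o G)^\+ z - tail (EFin \o G)^\- z).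
Proof.
rewrite /Rintegral integralE; congr (fine (_ - _)).
  by apply: eq_integral => x _; rewrite !funeposE.
by apply: eq_integral => x _; rewrite !funenegE.
Qed.

Lemma measurable_Rintegral_tail (G : T1 * T2 -> R) : measurable_fun setT G ->
  measurable_fun setT (fun z : T1 * T2 => (\int[leb]_(t in `[z.1, +oo[) G (t, z.2))%R).
Proof.
move=> /measurable_EFinP mG.
under eq_fun do rewrite Rintegral_tailE.
apply: (measurableT_comp (fine_measurable measurableT)).
apply: emeasurable_funB; apply: measurable_tail.
- exact: measurable_funepos.
- exact: funepos_ge0.
- exact: measurable_funeneg.
- exact: funeneg_ge0.
Qed.

Lemma ae_snd (Q : T2 -> Prop) : (\forall y \ae mu2, Q y) ->
  \forall z \ae mu3, Q z.2.
Proof.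
move=> [N [mN N0 NQ]]; exists (setT `*` N); split.
- exact: measurableX.
- by rewrite product_measure1E// [X in _ * X]N0 mule0.
- by move=> z /= Qz; split => //; exact: NQ.
Qed.

(* [P] consists of the [y] for which the variation of [v (., y)] over
   [{b < `|v|}] is at least [b]. *)
Lemma slice_cylinder (v G : T1 * T2 -> R) (m b : R) :
  mu3.-integrable setT (EFin \o v) -> mu3.-integrable setT (EFin \o G) ->
  (forall c a1 b1 a2 b2 a3 b3 : R, (0 < c)%R ->
    \int[mu3]_z (v z * bump3 c a1 b1 a2 b2 a3 b3 z)%:E =
    - \int[mu3]_z (G z * bump3_prim c a1 b1 a2 b2 a3 b3 z)%:E) ->
  (forall z, (m < z.1)%R -> G z = 0%R) -> (0 < b)%R ->
  exists P : set T2, [/\ measurable P,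
    b%:E * mu2 P <= \int[mu3]_(z in [set z | (b < `|v z|)%R]) `|G z|%:E &
    \forall z \ae mu3, (2 * b < `|v z|)%R -> P z.2].
Proof.
move=> iv iG vG Gm b0.
have vw := slice_representation iv iG vG.
have mG : measurable_fun setT G by apply/measurable_EFinP; exact: measurable_int iG.
have mv : measurable_fun setT v by apply/measurable_EFinP; exact: measurable_int iv.
(* Truncation needs an honest primitive on every line, so it is applied to [w]; [v = - w] holds
   almost everywhere, which is enough for the integrals and for the conclusion. *)
set w := fun z : T1 * T2 => (\int[leb]_(t in `[z.1, +oo[) G (t, z.2))%R.
have mw : measurable_fun setT w by exact: measurable_Rintegral_tail.
have mS : measurable [set z | (b < `|w z|)%R].
  by apply: measurable_superlevel; exact: measurableT_comp.
have mSv : measurable [set z | (b < `|v z|)%R].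
  by apply: measurable_superlevel; exact: measurableT_comp.
pose F (z : T1 * T2) := `|G z|%:E * (\1_[set z | (b < `|w z|)%R] z)%:E.
have mF : measurable_fun setT F.
  apply: emeasurable_funM; apply/measurable_EFinP; last exact: measurable_indic.
  exact: measurableT_comp.
have F0 z : 0 <= F z.
  by rewrite mule_ge0 ?lee_fin// indicE; case: (_ \in _).
pose H := fubini_G leb F.
have mH : measurable_fun setT H by exact: measurable_fun_fubini_tonelli_G.
have H0 y : 0 <= H y by apply: integral_ge0 => t _; exact: F0.
have HE y : H y = \int[leb]_(t in [set t | (b < `|w (t, y)|)%R]) `|G (t, y)|%:E.
  rewrite /H /fubini_G [in RHS]integral_mkcond epatch_indic.
  by apply: eq_integral => t _; congr (_ * _%:E); apply: eq_indic.
exists [set y | b%:E <= H y]; split.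
- rewrite -[X in measurable X]setTI.
  by apply: emeasurable_fun_c_infty.
- have mP : measurable [set y | b%:E <= H y].
    by rewrite -[X in measurable X]setTI; apply: emeasurable_fun_c_infty.
  have -> : \int[mu3]_(z in [set z | (b < `|v z|)%R]) `|G z|%:E = \int[mu2]_y H y.
    rewrite -(fubini_tonelli2 F)//.
    rewrite [in LHS]integral_mkcond epatch_indic; apply: ae_eq_integral => //.
      apply: emeasurable_funM; apply/measurable_EFinP; last exact: measurable_indic.
      exact: measurableT_comp.
    move: vw; apply: filterS => z vz _ /=; congr (_ * _%:E); apply: eq_indic => /=.
    by rewrite vz normrN.
  rewrite -integral_cst//; apply: (@le_trans _ _ (\int[mu2]_(y in [set y | b%:E <= H y]) H y)).
    apply: ge0_le_integral => //.
    - by move=> y _; rewrite lee_fin ltW.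
    - exact: measurable_funTS.
  exact: ge0_subset_integral.
- have /ae_snd iGy := ae_integrable2 iG.
  move: vw iGy; apply: filterS2 => -[s y] vz iGy /= bv.
  have mwy : measurable_fun setT (fun t : T1 => w (t, y)).
    exact: (measurableT_comp mw (@pair2_measurable _ _ _ _ y)).
  rewrite HE.
  apply: (@tail_truncation R (fun t => G (t, y)) m b s) => //.
    by move=> t mt; rewrite Gm.
  by move: bv; rewrite vz normrN.
Qed.

End slice_cylinders.

(** * The Loomis-Whitney inequality and weak Sobolev embedding *)

Section loomis_whitney.
Context {R : realType}.
Local Open Scope ereal_scope.
Local Notation leb := (@lebesgue_measure R).
Local Notation T1 := (measurableTypeR R).
Local Notation T2 := (T1 * T1)%type.
Local Notation mu2 := (sprod leb leb).
Local Notation mu3 := (leb \x mu2).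

(** [sprod] is the product measure with a sigma-finite structure attached, so this is a conversion;
    it puts integrals over [leb3] into a form to which Tonelli's theorem applies. *)
Lemma integral_leb3E (F : mR3 R -> \bar R) :
  \int[leb3 R]_x F x = \int[mu2 \x leb]_x F x.
Proof. by []. Qed.

(** The geometric mean of the two bounds on [m], followed by [sqrt (p q) <= (p + q) / 2]. The result
    is linear in [p] and [q], hence ready for integration. *)
Lemma le_sqrt_amgm (K : R) (m p q : \bar R) : (0 <= K)%R -> 0 <= p -> 0 <= q ->
  m <= K%:E -> m <= p * q -> m <= (Num.sqrt K / 2)%:E * (p + q).
Proof.
move=> K0 p0 q0 mK mpq.
have [K1|K1] := eqVneq K 0%R.
  by rewrite K1 sqrtr0 mul0r mul0e; rewrite K1 in mK.
have Kgt : (0 < Num.sqrt K / 2)%R by rewrite divr_gt0// sqrtr_gt0 lt_neqAle eq_sym K1.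
case: p p0 mpq => [p| |]// p0 mpq; last by rewrite addye ?gt0_muley ?leey// -ltNye (lt_le_trans _ q0).
case: q q0 mpq => [q| |]// q0 mpq; last by rewrite addey ?gt0_muley ?leey.
case: m mK mpq => [m| |]// mK mpq; last by rewrite leNye.
rewrite -EFinD -EFinM lee_fin.
rewrite !lee_fin in p0 q0 mK mpq.
have sK : (Num.sqrt K ^+ 2 = K)%R by rewrite sqr_sqrtr.
have k0 := sqrtr_ge0 K; set k := Num.sqrt K in sK k0 *; rewrite -sK in mK.
have [m0|m0] := leP m 0%R.
  by apply: (le_trans m0); rewrite mulr_ge0 ?addr_ge0 ?divr_ge0.
have h : (m ^+ 2 <= (k / 2 * (p + q)) ^+ 2)%R.
  apply: (@le_trans _ _ (k ^+ 2 * (p * q))%R).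
    by rewrite expr2; apply: ler_pM => //; exact: ltW.
  have : (0 <= k ^+ 2 * (p - q) ^+ 2)%R by rewrite mulr_ge0 ?sqr_ge0.
  by lra.
rewrite -(ler_pXn2r (n := 2))// nnegrE; first exact: ltW.
by rewrite mulr_ge0 ?addr_ge0 ?divr_ge0.
Qed.

Lemma measurable_cylinders (P1 P2 P3 : set T2) :
  measurable P1 -> measurable P2 -> measurable P3 ->
  measurable ([set x | [/\ P1 (x.1.2, x.2), P2 (x.1.1, x.2) & P3 x.1]] : set (mR3 R)).
Proof.
move=> mP1 mP2 mP3.
have -> : [set x | [/\ P1 (x.1.2, x.2), P2 (x.1.1, x.2) & P3 x.1]] =
  (fun x : mR3 R => (x.1.2, x.2)) @^-1` P1 `&`
    ((fun x : mR3 R => (x.1.1, x.2)) @^-1` P2 `&` fst @^-1` P3).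
  by apply/seteqP; split => [x []|x [? []]].
have m1 : measurable_fun setT (fun x : mR3 R => (x.1.2, x.2)).
  apply: measurable_fun_pair; last exact: measurable_snd.
  exact: (measurableT_comp measurable_snd measurable_fst).
have m2 : measurable_fun setT (fun x : mR3 R => (x.1.1, x.2)).
  apply: measurable_fun_pair; last exact: measurable_snd.
  exact: (measurableT_comp measurable_fst measurable_fst).
have m3 : measurable_fun setT (fst : mR3 R -> T2) by exact: measurable_fst.
apply: measurableI; last apply: measurableI; rewrite -[X in measurable X]setTI.
- exact: m1.
- exact: m2.
- exact: m3.
Qed.

(** At height [z] the section of the set lies in [P3], of measure at most [K], and in the product of
    the sections of [P2] and [P1] at height [z]. [le_sqrt_amgm] combines the two bounds, and
    integration in [z] gives [sqrt K / 2 * (K + K)]. *)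
Lemma loomis_whitney (P1 P2 P3 : set T2) (K : R) :
  measurable P1 -> measurable P2 -> measurable P3 -> (0 <= K)%R ->
  mu2 P1 <= K%:E -> mu2 P2 <= K%:E -> mu2 P3 <= K%:E ->
  leb3 R [set x | [/\ P1 (x.1.2, x.2), P2 (x.1.1, x.2) & P3 x.1]] <=
  (Num.sqrt K * K)%:E.
Proof.
move=> mP1 mP2 mP3 K0 K1 K2 K3.
set A := [set x | _].
have mA : measurable (A : set (mR3 R)) by exact: measurable_cylinders.
pose p (P : set T2) (z : T1) := \int[leb]_y (\1_P (y, z))%:E.
have pm P : measurable P -> measurable_fun setT (p P).
  move=> mP; apply: (measurable_fun_fubini_tonelli_G (EFin \o \1_P)) => //.
    by apply/measurable_EFinP; exact: measurable_indic.
  by move=> y /=; rewrite lee_fin indicE; case: (_ \in _).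
have p0 P z : 0 <= p P z by exact: integral_ge0.
have pE P : measurable P -> \int[leb]_z p P z = mu2 P.
  move=> mP; rewrite -[P in RHS]setIT -integral_indic//.
  rewrite [in RHS](fubini_tonelli2 (m1 := leb) (m2 := leb) (EFin \o \1_P))//.
    by apply/measurable_EFinP; exact: measurable_indic.
  by move=> y /=; rewrite lee_fin indicE; case: (_ \in _).
rewrite -[A]setIT -integral_indic// integral_leb3E.
rewrite (fubini_tonelli2 (EFin \o \1_A)); last 2 first.
- by apply/measurable_EFinP; exact: measurable_indic.
- by move=> y /=; rewrite lee_fin indicE; case: (_ \in _).
apply: (@le_trans _ _ (\int[leb]_z ((Num.sqrt K / 2)%:E * (p P2 z + p P1 z)))).
  apply: ge0_le_integral => //.
  - by move=> z _; apply: integral_ge0 => y _; rewrite /= lee_fin indicE; case: (_ \in _).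
  - apply: (measurable_fun_fubini_tonelli_G (EFin \o \1_A)) => //.
      by apply/measurable_EFinP; exact: measurable_indic.
    by move=> y /=; rewrite lee_fin indicE; case: (_ \in _).
  - by apply: measurable_funeM; apply: emeasurable_funD; exact: pm.
  move=> z _; apply: le_sqrt_amgm => //.
    apply: le_trans K3; rewrite -[P3]setIT -integral_indic//.
    apply: ge0_le_integral => //.
    - by move=> y _ /=; rewrite lee_fin indicE; case: (_ \in _).
    - apply: (measurableT_comp (f := EFin \o \1_A)).
        by apply/measurable_EFinP; exact: measurable_indic.
      exact: pair2_measurable.
    - by apply/measurable_EFinP; exact: measurable_indic.
    - move=> y _ /=; rewrite lee_fin !indicE.
      case: (boolP ((y, z) \in A)) => //; rewrite inE => -[_ _ yP].
      by rewrite mem_set.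
  rewrite /fubini_G.
  have mp (P : set T2) (x : T1) : measurable P -> measurable_fun setT (fun y : T1 => (\1_P (y, x))%:E : \bar R).
    move=> mP; apply: (measurableT_comp (f := EFin \o \1_P)).
      by apply/measurable_EFinP; exact: measurable_indic.
    exact: pair2_measurable.
  apply: (@le_trans _ _ (\int[mu2]_y ((\1_P2 (y.1, z))%:E * (\1_P1 (y.2, z))%:E))).
    apply: ge0_le_integral => //.
    - by move=> y _ /=; rewrite lee_fin indicE; case: (_ \in _).
    - apply: (measurableT_comp (f := EFin \o \1_A)).
        by apply/measurable_EFinP; exact: measurable_indic.
      exact: pair2_measurable.
    - apply: emeasurable_funM.
        exact: (measurableT_comp (mp _ z mP2) measurable_fst).
      exact: (measurableT_comp (mp _ z mP1) measurable_snd).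
    - move=> y _ /=; rewrite -EFinM lee_fin !indicE.
      case: (boolP ((y, z) \in A)) => [|_]; last by rewrite mulr_ge0.
      by rewrite inE => -[/= y1 y2 _]; rewrite !mem_set// mulr1.
  rewrite (fubini_tonelli1 (m1 := leb) (m2 := leb)
    (fun y : T2 => (\1_P2 (y.1, z))%:E * (\1_P1 (y.2, z))%:E)); last 2 first.
  - apply: emeasurable_funM.
      exact: (measurableT_comp (mp _ z mP2) measurable_fst).
    exact: (measurableT_comp (mp _ z mP1) measurable_snd).
  - by move=> y; rewrite mule_ge0 ?lee_fin// indicE; case: (_ \in _).
  rewrite /fubini_F /=.
  under eq_integral => x _.
    rewrite ge0_integralZl//; last exact: mp.
    over.
  by rewrite ge0_integralZr//; [exact: mp|exact: (p0 P1 z)].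
rewrite ge0_integralZl//; last 2 first.
- by apply: emeasurable_funD; exact: pm.
- by move=> z _; rewrite adde_ge0.
rewrite ge0_integralD//; [|exact: pm|exact: pm].
rewrite !pE//.
apply: (@le_trans _ _ ((Num.sqrt K / 2)%:E * (K%:E + K%:E))).
  by rewrite lee_wpmul2l ?leeD// lee_fin divr_ge0.
by rewrite -EFinD -EFinM lee_fin; lra.
Qed.

End loomis_whitney.

(** * Lebesgue measure along the three coordinate directions *)

Section coordinate_lines.
Context {R : realType}.
Local Notation leb := (@lebesgue_measure R).
Local Notation T1 := (measurableTypeR R).
Local Notation T2 := (T1 * T1)%type.
Local Notation mu2 := (sprod leb leb).
Local Notation mu3 := (leb \x mu2)%E.

(** Bringing coordinate [j] to the front lets the results on lines in the first variable serve every
    direction. The other two keep their order, as in the cylinders of [loomis_whitney]. *)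
Definition insert (j : 'I_3) (z : T1 * T2) : mR3 R :=
  if j == 0 then ((z.1, z.2.1), z.2.2)
  else if j == 1 then ((z.2.1, z.1), z.2.2) else (z.2, z.1).

Definition extract (j : 'I_3) (x : mR3 R) : T1 * T2 :=
  if j == 0 then (x.1.1, (x.1.2, x.2))
  else if j == 1 then (x.1.2, (x.1.1, x.2)) else (x.2, x.1).

Lemma insertK j : cancel (insert j) (extract j).
Proof. by case: j => [[|[|[|//]]] ?] [s [y1 y2]]. Qed.

Lemma extractK j : cancel (extract j) (insert j).
Proof. by case: j => [[|[|[|//]]] ?] [[x1 x2] x3]. Qed.

Lemma measurable_insert j : measurable_fun setT (insert j).
Proof.
have m1 : measurable_fun setT (fun z : T1 * T2 => z.1) by exact: measurable_fst.
have m2 : measurable_fun setT (fun z : T1 * T2 => z.2.1).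
  exact: (measurableT_comp measurable_fst measurable_snd).
have m3 : measurable_fun setT (fun z : T1 * T2 => z.2.2).
  exact: (measurableT_comp measurable_snd measurable_snd).
case: j => [[|[|[|//]]] ?]; rewrite /insert /=.
- by apply: measurable_fun_pair => //; exact: measurable_fun_pair.
- by apply: measurable_fun_pair => //; exact: measurable_fun_pair.
- by apply: measurable_fun_pair => //; exact: measurable_snd.
Qed.

Lemma measurable_extract j : measurable_fun setT (extract j).
Proof.
have m1 : measurable_fun setT (fun z : mR3 R => z.2) by exact: measurable_snd.
have m2 : measurable_fun setT (fun z : mR3 R => z.1.1).
  exact: (measurableT_comp measurable_fst measurable_fst).
have m3 : measurable_fun setT (fun z : mR3 R => z.1.2).
  exact: (measurableT_comp measurable_snd measurable_fst).
case: j => [[|[|[|//]]] ?]; rewrite /extract /=.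
- by apply: measurable_fun_pair => //; exact: measurable_fun_pair.
- by apply: measurable_fun_pair => //; exact: measurable_fun_pair.
- by apply: measurable_fun_pair => //; exact: measurable_fst.
Qed.

Local Open Scope ereal_scope.

(** For nonnegative functions Tonelli's theorem allows the iterated integrals to be reordered until
    coordinate [j] is the outermost. *)
Lemma ge0_integral_insert j (F : mR3 R -> \bar R) :
  measurable_fun setT F -> (forall x, 0 <= F x) ->
  \int[leb3 R]_x F x = \int[mu3]_z F (insert j z).
Proof.
move=> mF F0.
have mFj i : measurable_fun setT (F \o insert i).
  exact: (measurableT_comp mF (measurable_insert i)).
have mFz z : measurable_fun setT (fun y => F (y, z)).
  exact: (measurableT_comp mF (@pair2_measurable _ _ _ _ z)).
have mFy y : measurable_fun setT (fun z => F (y, z)).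
  exact: (measurableT_comp mF (@pair1_measurable _ _ _ _ y)).
rewrite integral_leb3E.
case: j => [[|[|[|//]]] jlt]; rewrite /insert /=.
- rewrite (fubini_tonelli2 F)//.
  transitivity (\int[leb]_z \int[leb]_x \int[leb]_y F ((x, y), z)).
    apply: eq_integral => z _.
    by rewrite -(fubini_tonelli1 (m1 := leb) (m2 := leb) (fun y => F (y, z))).
  have mFz' : measurable_fun setT (fun w : T1 * T1 => \int[leb]_y F ((w.2, y), w.1)).
    have m : measurable_fun setT (fun w : T1 * T1 * T1 => F ((w.1.2, w.2), w.1.1)).
      apply: (measurableT_comp mF); apply: measurable_fun_pair.
        apply: measurable_fun_pair; last exact: measurable_snd.
        exact: (measurableT_comp measurable_snd measurable_fst).
      exact: (measurableT_comp measurable_fst measurable_fst).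
    exact: (measurable_fun_fubini_tonelli_F (m2 := leb) _ m).
  rewrite (fubini_tonelli (m1 := leb) (m2 := leb)
    (fun w : T1 * T1 => \int[leb]_y F ((w.2, y), w.1)))//; last first.
    by move=> w; exact: integral_ge0.
  rewrite (fubini_tonelli1 (m1 := leb) (m2 := mu2)
    (fun z : T1 * T2 => F ((z.1, z.2.1), z.2.2)))//; last exact: (mFj (@Ordinal 3 0 isT)).
  apply: eq_integral => x _; rewrite /fubini_F /=.
  rewrite (fubini_tonelli2 (m1 := leb) (m2 := leb)
    (fun w : T1 * T1 => F ((x, w.1), w.2)))//.
  apply: (measurableT_comp mF); apply: measurable_fun_pair; last exact: measurable_snd.
  by apply: measurable_fun_pair; [exact: measurable_cst|exact: measurable_fst].
- rewrite (fubini_tonelli2 F)//.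
  transitivity (\int[leb]_z \int[leb]_y \int[leb]_x F ((x, y), z)).
    apply: eq_integral => z _.
    by rewrite -(fubini_tonelli2 (m1 := leb) (m2 := leb) (fun y => F (y, z))).
  have mFz' : measurable_fun setT (fun w : T1 * T1 => \int[leb]_x F ((x, w.2), w.1)).
    have m : measurable_fun setT (fun w : T1 * T1 * T1 => F ((w.2, w.1.2), w.1.1)).
      apply: (measurableT_comp mF); apply: measurable_fun_pair.
        apply: measurable_fun_pair; first exact: measurable_snd.
        exact: (measurableT_comp measurable_snd measurable_fst).
      exact: (measurableT_comp measurable_fst measurable_fst).
    exact: (measurable_fun_fubini_tonelli_F (m2 := leb) _ m).
  rewrite (fubini_tonelli (m1 := leb) (m2 := leb)
    (fun w : T1 * T1 => \int[leb]_x F ((x, w.2), w.1)))//; last first.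
    by move=> w; exact: integral_ge0.
  rewrite (fubini_tonelli1 (m1 := leb) (m2 := mu2)
    (fun z : T1 * T2 => F ((z.2.1, z.1), z.2.2)))//; last exact: (mFj (@Ordinal 3 1 isT)).
  apply: eq_integral => y _; rewrite /fubini_F /=.
  rewrite (fubini_tonelli2 (m1 := leb) (m2 := leb)
    (fun w : T1 * T1 => F ((w.1, y), w.2)))//.
  apply: (measurableT_comp mF); apply: measurable_fun_pair; last exact: measurable_snd.
  by apply: measurable_fun_pair; [exact: measurable_fst|exact: measurable_cst].
- rewrite (fubini_tonelli2 F)//.
  rewrite (fubini_tonelli1 (m1 := leb) (m2 := mu2)
    (fun z : T1 * T2 => F (z.2, z.1)))//; exact: (mFj (@Ordinal 3 2 isT)).
Qed.

Lemma integral_insert j (f : mR3 R -> \bar R) :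
  measurable_fun setT f ->
  \int[leb3 R]_x f x = \int[mu3]_z f (insert j z).
Proof.
move=> mf; rewrite integralE [in RHS]integralE.
rewrite (ge0_integral_insert j); [|exact: measurable_funepos|exact: funepos_ge0].
rewrite [X in _ - X](ge0_integral_insert j); [|exact: measurable_funeneg|exact: funeneg_ge0].
congr (_ - _); first by apply: eq_integral => z _; rewrite !funeposE.
by apply: eq_integral => z _; rewrite !funenegE.
Qed.

Lemma integrable_insert j (f : mR3 R -> \bar R) :
  (leb3 R).-integrable setT f -> mu3.-integrable setT (f \o insert j).
Proof.
move=> /integrableP[mf f_lty]; apply/integrableP; split.
  exact: (measurableT_comp mf (measurable_insert j)).
rewrite -(ge0_integral_insert j (F := fun x => `|f x|))//.
exact: measurableT_comp.
Qed.

Lemma integral_insert_set j (f : mR3 R -> \bar R) (E : set (mR3 R)) :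
  measurable_fun setT f -> measurable E ->
  \int[leb3 R]_(x in E) f x = \int[mu3]_(z in insert j @^-1` E) f (insert j z).
Proof.
move=> mf mE; rewrite integral_mkcond (integral_insert j).
  rewrite [in RHS]integral_mkcond; apply: eq_integral => z _.
  rewrite !epatch_indic /=; congr (_ * _%:E); exact: eq_indic.
by rewrite epatch_indic; apply: emeasurable_funM => //; apply/measurable_EFinP;
  exact: measurable_indic.
Qed.

Lemma leb3_insert j (E : set (mR3 R)) : measurable E ->
  leb3 R E = mu3 (insert j @^-1` E).
Proof.
move=> mE; rewrite -[E in LHS]setIT -integral_indic// (ge0_integral_insert j)//.
  rewrite -[insert j @^-1` E]setIT -integral_indic//.
  by rewrite -[X in measurable X]setTI; exact: measurable_insert.
by apply/measurable_EFinP; exact: measurable_indic.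
Qed.

Lemma ae_insert j (Q : T1 * T2 -> Prop) :
  (\forall z \ae mu3, Q z) -> \forall x \ae leb3 R, Q (extract j x).
Proof.
move=> [N [mN N0 NQ]].
have mN' : measurable (extract j @^-1` N).
  by rewrite -[X in measurable X]setTI; exact: measurable_extract.
exists (extract j @^-1` N); split => //.
  rewrite (leb3_insert j mN') (_ : _ @^-1` _ = N)//.
  by apply/seteqP; split => z /=; rewrite insertK.
by move=> x /= Qx; exact: NQ.
Qed.

End coordinate_lines.

(** * The weak Sobolev inequality *)

Section weak_sobolev.
Context {R : realType}.
Local Open Scope ereal_scope.
Local Notation leb := (@lebesgue_measure R).
Local Notation T1 := (measurableTypeR R).
Local Notation T2 := (T1 * T1)%type.
Local Notation mu2 := (sprod leb leb).
Local Notation mu3 := (leb \x mu2).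

(** The number [64^4] is the fixed point of [x -> 64 x^(3/4)], so the bound propagates from [b] to
    [2 b]. It holds at [b / 2^n] for large [n] by the third hypothesis, and [n] doublings lead back
    to [b]. *)
Lemma doubling_bound (f : R -> R) (V : R) :
  (forall b, 0 < b -> 0 <= f b)%R ->
  (forall b, 0 < b -> f (2 * b) ^+ 4 <= 64 ^+ 4 * f b ^+ 3)%R ->
  (forall b, 0 < b -> f b <= V * b ^+ 4)%R ->
  (forall b, 0 < b -> f b <= 64 ^+ 4)%R.
Proof.
move=> f0 fd fV b b0.
have V0 : (0 <= V)%R by have := le_trans (f0 _ ltr01) (fV _ ltr01); rewrite expr1n mulr1.
have [n hn] : exists n, (V * b ^+ 4 <= 2 ^+ n)%R.
  exists (Num.Def.archi_bound (V * b ^+ 4)).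
  by apply/ltW/upper_nthrootP.
have p2 k : (0 < 2 ^+ k :> R)%R by rewrite exprn_gt0.
have base : (f (b / 2 ^+ n) <= 64 ^+ 4)%R.
  apply: (le_trans (fV _ (divr_gt0 b0 (p2 n)))).
  rewrite expr_div_n mulrA ler_pdivrMr ?exprn_gt0//.
  apply: (le_trans hn); apply: (@le_trans _ _ ((2 ^+ n) ^+ 4)%R).
    by rewrite -[leLHS]expr1; apply: ler_weXn2l => //; apply: exprn_ege1; rewrite ler1n.
  by apply: ler_peMl; [rewrite !exprn_ge0|apply: exprn_ege1; rewrite ler1n].
suff H k : (k <= n)%N -> (f (b / 2 ^+ (n - k)) <= 64 ^+ 4)%R.
  by have := H n (leqnn _); rewrite subnn expr0 divr1.
elim: k => [|k IH] kn; first by rewrite subn0.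
have bk0 : (0 < b / 2 ^+ (n - k))%R by rewrite divr_gt0.
have e : (b / 2 ^+ (n - k.+1) = 2 * (b / 2 ^+ (n - k)))%R.
  by rewrite -[in RHS](subnSK kn) exprS; field; rewrite gt_eqF.
rewrite e -(ler_pXn2r (n := 4))// ?nnegrE ?exprn_ge0//; last first.
  by rewrite f0// mulr_gt0.
apply: (le_trans (fd _ bk0)).
apply: (@le_trans _ _ (64 ^+ 4 * (64 ^+ 4) ^+ 3)%R); last by rewrite -!exprM -exprD.
rewrite ler_wpM2l ?exprn_ge0//; apply: lerXn2r; rewrite ?nnegrE ?f0 ?exprn_ge0//.
exact: IH (ltnW kn).
Qed.

(** The Cauchy-Schwarz inequality in parametric form, from [|g| <= t / 2 + g^2 / (2 t)]; the
    parameter is optimised by the caller. *)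
Lemma integral_norm_le_amgm d (X : measurableType d) (m : {measure set X -> \bar R})
    (g : X -> R) (E : set X) (S t : R) :
  measurable_fun setT g -> measurable E -> (0 < t)%R ->
  \int[m]_x (g x ^+ 2)%:E <= S%:E ->
  \int[m]_(x in E) `|g x|%:E <= (t / 2)%:E * m E + (S / (2 * t))%:E.
Proof.
move=> mg mE t0 gS.
have m2 : measurable_fun E (fun x => (g x ^+ 2)%:E).
  by apply/measurable_EFinP/measurable_funTS; exact: measurable_funX.
apply: (@le_trans _ _ (\int[m]_(x in E) ((t / 2)%:E + (2 * t)^-1%:E * (g x ^+ 2)%:E))).
  apply: ge0_le_integral => //.
  - by apply/measurable_EFinP/measurable_funTS; exact: measurableT_comp.
  - by apply: emeasurable_funD => //; exact: measurable_funeM.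
  move=> x _; rewrite -EFinM -EFinD lee_fin -(@real_normK _ (g x)) ?num_real//.
  rewrite -subr_ge0 [leRHS](_ : _ = (t - `|g x|) ^+ 2 / (2 * t))%R.
    by rewrite divr_ge0 ?sqr_ge0 ?mulr_ge0// ltW.
  by field; rewrite gt_eqF.
rewrite ge0_integralD//; last 3 first.
- by move=> x _; rewrite lee_fin divr_ge0// ltW.
- by move=> x _; rewrite mule_ge0 ?lee_fin ?sqr_ge0 ?invr_ge0 ?mulr_ge0// ltW.
- exact: measurable_funeM.
rewrite integral_cst// leeD2l// ge0_integralZl//; last 2 first.
- by move=> x _; rewrite lee_fin sqr_ge0.
- by rewrite lee_fin invr_ge0 mulr_ge0// ltW.
rewrite [(S / _)%R]mulrC EFinM lee_wpmul2l//.
  by rewrite lee_fin invr_ge0 mulr_ge0// ltW.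
apply: le_trans gS; apply: ge0_subset_integral => //.
  by apply/measurable_EFinP; exact: measurable_funX.
by move=> x _; rewrite lee_fin sqr_ge0.
Qed.

Lemma chebyshev_sqr d (X : measurableType d) (m : {measure set X -> \bar R})
    (v : X -> R) (V t : R) :
  measurable_fun setT v -> (0 < t)%R -> \int[m]_x (v x ^+ 2)%:E <= V%:E ->
  (t ^+ 2)%:E * m [set x | (t < `|v x|)%R] <= V%:E.
Proof.
move=> mv t0 vV; apply: le_trans vV.
have mE : measurable [set x | (t < `|v x|)%R].
  by apply: measurable_superlevel; exact: measurableT_comp.
have mv2 D : measurable_fun D (fun x => (v x ^+ 2)%:E).
  by apply/measurable_EFinP/measurable_funTS; exact: measurable_funX.
rewrite -integral_cst//.
apply: (@le_trans _ _ (\int[m]_(x in [set x | (t < `|v x|)%R]) (v x ^+ 2)%:E)).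
  apply: ge0_le_integral => //.
  - by move=> x _; rewrite lee_fin sqr_ge0.
  - move=> x /= tv; rewrite lee_fin -(@real_normK _ (v x)) ?num_real//.
    by apply: ler_sqr_nneg; exact: ltW.
apply: ge0_subset_integral => //.
by move=> x _; rewrite lee_fin sqr_ge0.
Qed.

(** With [K = sqrt (S p) / b] the hypothesis is [q <= K^(3/2)]; its fourth power [q^4 <= K^6]
    contains no root any more. *)
Lemma sqrt_power_bound (S p q b : R) : (0 < S -> 0 < p -> 0 < b -> 0 <= q ->
  q <= Num.sqrt (Num.sqrt (S * p) / b) * (Num.sqrt (S * p) / b) ->
  b ^+ 6 * q ^+ 4 <= S ^+ 3 * p ^+ 3)%R.
Proof.
move=> S0 p0 b0 q0.
have Sp : (0 <= S * p)%R by rewrite mulr_ge0 ?ltW.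
have K0 : (0 <= Num.sqrt (S * p) / b)%R by rewrite divr_ge0 ?sqrtr_ge0 ?ltW.
move: (sqr_sqrtr Sp) (sqr_sqrtr K0) (sqrtr_ge0 (Num.sqrt (S * p) / b)).
move: (Num.sqrt (S * p)) K0 => r K0; move: (Num.sqrt (r / b)) => k rE kE k0 qk.
have : (q ^+ 4 <= (k * (r / b)) ^+ 4)%R.
  by apply: lerXn2r => //; rewrite nnegrE//; exact: mulr_ge0.
have -> : ((k * (r / b)) ^+ 4 = S ^+ 3 * p ^+ 3 / b ^+ 6)%R.
  rewrite (_ : (k * (r / b)) ^+ 4 = (k ^+ 2) ^+ 2 * (r / b) ^+ 4)%R; last by ring.
  rewrite kE (_ : (r / b) ^+ 2 * (r / b) ^+ 4 = (r ^+ 2) ^+ 3 / b ^+ 6)%R; last first.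
    by field; rewrite gt_eqF.
  by rewrite rE exprMn.
by rewrite ler_pdivlMr ?exprn_gt0// mulrC.
Qed.

(* The weak form of the Sobolev inequality [||v||_6 <= C ||grad v||_2]. *)
Lemma weak_sobolev (v : mR3 R -> R) (G : 'I_3 -> mR3 R -> R) (V S : R) (m : 'I_3 -> R) :
  (leb3 R).-integrable setT (EFin \o v) ->
  (forall j, (leb3 R).-integrable setT (EFin \o G j)) ->
  (forall j c a1 b1 a2 b2 a3 b3, (0 < c)%R ->
    \int[leb3 R]_x (v x * bump3 c a1 b1 a2 b2 a3 b3 (extract j x))%:E =
    - \int[leb3 R]_x (G j x * bump3_prim c a1 b1 a2 b2 a3 b3 (extract j x))%:E) ->
  (forall j x, (m j < (extract j x).1)%R -> G j x = 0%R) ->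
  \int[leb3 R]_x (v x ^+ 2)%:E <= V%:E ->
  (0 < S)%R -> (forall j, \int[leb3 R]_x (G j x ^+ 2)%:E <= S%:E) ->
  forall b : R, (0 < b)%R ->
    (b ^+ 6)%:E * leb3 R [set x | (b < `|v x|)%R] <= (64 ^+ 4 * S ^+ 3)%:E.
Proof.
move=> iv iG vG Gm vV S0 GS.
have mv : measurable_fun setT v by apply/measurable_EFinP; exact: measurable_int iv.
have mG j : measurable_fun setT (G j).
  by apply/measurable_EFinP; exact: measurable_int (iG j).
have mE b : measurable [set x : mR3 R | (b < `|v x|)%R].
  by apply: measurable_superlevel; exact: measurableT_comp.
pose mu b := fine (leb3 R [set x | (b < `|v x|)%R]).
have muE b : (0 < b)%R -> leb3 R [set x | (b < `|v x|)%R] = (mu b)%:E.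
  move=> b0; rewrite /mu fineK// ge0_fin_numE//.
  have := chebyshev_sqr mv b0 vV; rewrite muleC -lee_pdivlMr ?exprn_gt0//.
  by move=> /le_lt_trans; apply; rewrite ltry.
have mu0 b : (0 <= mu b)%R by exact: fine_ge0.
have step b : (0 < b)%R -> (b ^+ 6 * mu (2 * b)%R ^+ 4 <= S ^+ 3 * mu b ^+ 3)%R.
  move=> b0.
  have cyl j : exists P : set T2, [/\ measurable P,
      b%:E * mu2 P <= \int[leb3 R]_(x in [set x | (b < `|v x|)%R]) `|G j x|%:E &
      \forall x \ae leb3 R, (2 * b < `|v x|)%R -> P (extract j x).2].
    have [|||P [mP Pb Pae]] := @slice_cylinder R (v \o insert j) (G j \o insert j)
      (m j) b (integrable_insert j iv) (integrable_insert j (iG j)).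
    - move=> c a1 b1 a2 b2 a3 b3 c0; have := vG j c a1 b1 a2 b2 a3 b3 c0.
      have mB : measurable_fun setT (bump3 c a1 b1 a2 b2 a3 b3) by exact: measurable_bump3.
      have mP : measurable_fun setT (bump3_prim c a1 b1 a2 b2 a3 b3) by exact: measurable_bump3_prim.
      rewrite (integral_insert j); last first.
        apply/measurable_EFinP; apply: measurable_funM => //.
        exact: (measurableT_comp mB (measurable_extract j)).
      rewrite [in X in _ = X -> _](integral_insert j); last first.
        apply/measurable_EFinP; apply: measurable_funM => //.
        exact: (measurableT_comp mP (measurable_extract j)).
      by under eq_integral do rewrite insertK; under [in X in _ = X -> _]eq_integral do rewrite insertK.
    - by move=> z mz; rewrite /= (Gm j)// insertK.
    - exact: b0.
    exists P; split => //.
      rewrite (integral_insert_set j)//.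
      by apply/measurable_EFinP; exact: measurableT_comp.
    have := ae_insert j Pae; apply: filterS => x /=.
    by rewrite extractK.
  (* The parameter [t] below divides by [mu b]. In the degenerate case monotonicity of the
     distribution function gives [mu (2 b) = 0]. *)
  have [mb0|mb0] := eqVneq (mu b) 0%R.
    rewrite mb0 expr0n/= mulr0 (_ : mu (2 * b)%R = 0%R) ?expr0n ?mulr0//.
    apply/le_anti; rewrite mu0 andbT -lee_fin -muE ?mulr_gt0// -mb0 -muE//.
    apply: le_measure; rewrite ?inE// => x /=; apply: lt_trans.
    by rewrite ltr_pMl// ltr1n.
  have mbgt : (0 < mu b)%R by rewrite lt_neqAle eq_sym mb0 mu0.
  pose K := (Num.sqrt (S * mu b) / b)%R.
  have K0 : (0 <= K)%R by rewrite divr_ge0// ltW.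
  (* The optimal parameter: it makes both terms of [integral_norm_le_amgm] equal to
     [sqrt (S * mu b) / 2], so [K] bounds each of the three projections. *)
  pose t := Num.sqrt (S / mu b).
  have t0 : (0 < t)%R by rewrite sqrtr_gt0 divr_gt0.
  have tE : (t * mu b = Num.sqrt (S * mu b))%R.
    rewrite -[in LHS](sqr_sqrtr (mu0 b)) /t sqrtrM ?(ltW S0)// sqrtrV//.
    rewrite sqrtrM ?(ltW S0)//.
    have : Num.sqrt (mu b) != 0%R by rewrite gt_eqF// sqrtr_gt0.
    by move: (Num.sqrt (mu b)) => q q0; field.
  have tS : (S / t = Num.sqrt (S * mu b))%R.
    apply: (@mulIf _ t); first by rewrite gt_eqF.
    rewrite divfK ?gt_eqF// -tE mulrAC -expr2 /t sqr_sqrtr.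
      by rewrite divfK// gt_eqF.
    by rewrite divr_ge0// ltW.
  have PK P j : b%:E * mu2 P <= \int[leb3 R]_(x in [set x | (b < `|v x|)%R]) `|G j x|%:E ->
      mu2 P <= K%:E.
    move=> /le_trans H.
    rewrite /K EFinM muleC lee_pdivlMl//; apply: H.
    apply: le_trans (integral_norm_le_amgm (mG j) (mE b) t0 (GS j)) _.
    rewrite muE// -EFinM -EFinD lee_fin.
    rewrite mulrAC tE invfM mulrA mulrAC tS.
    by lra.
  have [P0 [mP0 /PK P0K P0ae]] := cyl (@Ordinal 3 0 isT).
  have [P1 [mP1 /PK P1K P1ae]] := cyl (@Ordinal 3 1 isT).
  have [P2 [mP2 /PK P2K P2ae]] := cyl (@Ordinal 3 2 isT).
  have LW := loomis_whitney mP0 mP1 mP2 K0 P0K P1K P2K.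
  set A := [set x | _] in LW.
  have mA : measurable (A : set (mR3 R)) by exact: measurable_cylinders.
  have : leb3 R [set x | (2 * b < `|v x|)%R] <= leb3 R A.
    have [N [mN N0 NA]] : \forall x \ae leb3 R, (2 * b < `|v x|)%R -> A x.
      by move: P0ae P1ae P2ae; apply: filterS3 => x h0 h1 h2 vx; split;
        [exact: h0|exact: h1|exact: h2].
    rewrite -[leRHS]adde0 -N0.
    apply: (@le_trans _ _ (leb3 R (A `|` N))); last exact: measureU2.
    apply: le_measure; rewrite ?inE//; first exact: measurableU.
    move=> x vx; have [Ax|nAx] := pselect (A x); [by left|right].
    by apply: NA => /= /(_ vx).
  move=> /le_trans /(_ LW); rewrite muE ?mulr_gt0// lee_fin => muK.
  exact: (sqrt_power_bound S0 mbgt b0 (mu0 _) muK).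
move=> b b0; rewrite muE// -EFinM lee_fin.
have S3 : (0 < S ^+ 3)%R by rewrite exprn_gt0.
rewrite -ler_pdivrMr//.
(* The normalised weak L^6 quantity; the factor 64 comes from [(2 b)^6]. The L^2 bound [V] enters
   only through the behaviour as [b] tends to 0 and does not appear in the result. *)
apply: (@doubling_bound (fun b : R => b ^+ 6 * mu b / S ^+ 3)%R (V / S ^+ 3)%R _ _ _ b b0).
- move=> c c0; apply: divr_ge0; last exact: ltW.
  by apply: mulr_ge0 => //; exact/exprn_ge0/ltW.
- move=> c c0; have := step c c0.
  have Sn : S != 0%R by rewrite gt_eqF.
  rewrite [in X in _ -> X](_ : ((2 * c) ^+ 6 * mu (2 * c)%R / S ^+ 3) ^+ 4 =
    64 ^+ 4 * (c ^+ 18 / S ^+ 12) * (c ^+ 6 * mu (2 * c)%R ^+ 4))%R; last by field.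
  rewrite [in X in _ -> X](_ : 64 ^+ 4 * (c ^+ 6 * mu c / S ^+ 3) ^+ 3 =
    64 ^+ 4 * (c ^+ 18 / S ^+ 12) * (S ^+ 3 * mu c ^+ 3))%R; last by field.
  apply: ler_wpM2l; apply: mulr_ge0; first exact: exprn_ge0.
  by apply: divr_ge0; apply: exprn_ge0; exact: ltW.
- move=> c c0; rewrite [leRHS]mulrAC ler_pM2r ?invr_gt0//.
  have := chebyshev_sqr mv c0 vV; rewrite muE// -EFinM lee_fin => h.
  rewrite [(c ^+ 6)%R](_ : _ = c ^+ 4 * c ^+ 2)%R; last by rewrite -exprD.
  by rewrite -mulrA mulrC; apply: ler_wpM2r => //; apply: exprn_ge0; exact: ltW.
Qed.

End weak_sobolev.

(** * Cut-off functions *)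

Section tensor_products.
Context {R : realType}.
Local Notation d1 h := ('D_1 (h : R^o -> R)).

Lemma is_diff_linear (V W : normedModType R) (f : V -> W) (x : V) :
  linear f -> continuous f -> is_diff x f f.
Proof.
move=> l c.
pose g : {linear V -> W} := HB.pack f (GRing.isLinear.Build _ _ _ _ _ l).
have H : differentiable g x by apply: linear_differentiable.
have H2 : 'd g x = g :> (_ -> _) by rewrite diff_lin.
by apply: DiffDef.
Qed.

Lemma is_diff_fst (U V : normedModType R) (x : U * V) :
  is_diff x (@fst U V) (@fst U V).
Proof. by apply: is_diff_linear => // y; exact: cvg_fst. Qed.

Lemma is_diff_snd (U V : normedModType R) (x : U * V) :
  is_diff x (@snd U V) (@snd U V).
Proof. by apply: is_diff_linear => // y; exact: cvg_snd. Qed.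

Lemma derive_coord_comp (V : normedModType R) (L : V -> R) (h : R -> R) (v x : V) :
  (forall x, is_diff x L L) -> smooth (h : R^o -> R) ->
  'D_v (h \o L) x = L v * d1 h (L x).
Proof.
by move=> dL sh; rewrite (@derive_affine_comp _ _ L L)//; exact: smooth_differentiable.
Qed.

Lemma derive_mulE (V : normedModType R) (f g : V -> R) (v x : V) :
  smooth f -> smooth g ->
  'D_v (f \* g) x = 'D_v f x * g x + f x * 'D_v g x.
Proof.
move=> sf sg.
rewrite (deriveM (@smooth_derivable _ _ _ x v sf) (@smooth_derivable _ _ _ x v sg)).
rewrite addrC; congr (_ + _); exact: mulrC.
Qed.

Definition tens3 (h1 h2 h3 : R -> R) : R3 R -> R :=
  (h1 \o (fun x => x.1.1)) \* ((h2 \o (fun x => x.1.2)) \* (h3 \o (fun x => x.2))).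

Definition tens4 (h1 h2 h3 h4 : R -> R) : R4 R -> R :=
  (h1 \o (fun z => z.1.1.1)) \* ((h2 \o (fun z => z.1.1.2)) \*
  ((h3 \o (fun z => z.1.2)) \* (h4 \o (fun z => z.2)))).

Let d31 (x : R3 R) : is_diff x (fun x : R3 R => x.1.1) (fun x : R3 R => x.1.1).
Proof. by have := is_diff_comp (is_diff_fst x) (is_diff_fst x.1). Qed.
Let d32 (x : R3 R) : is_diff x (fun x : R3 R => x.1.2) (fun x : R3 R => x.1.2).
Proof. by have := is_diff_comp (is_diff_fst x) (is_diff_snd x.1). Qed.
Let d33 (x : R3 R) : is_diff x (fun x : R3 R => x.2) (fun x : R3 R => x.2).
Proof. exact: is_diff_snd. Qed.
Let d41 (x : R4 R) : is_diff x (fun x : R4 R => x.1.1.1) (fun x : R4 R => x.1.1.1).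
Proof. by have := is_diff_comp (is_diff_fst x) (d31 x.1). Qed.
Let d42 (x : R4 R) : is_diff x (fun x : R4 R => x.1.1.2) (fun x : R4 R => x.1.1.2).
Proof. by have := is_diff_comp (is_diff_fst x) (d32 x.1). Qed.
Let d43 (x : R4 R) : is_diff x (fun x : R4 R => x.1.2) (fun x : R4 R => x.1.2).
Proof. by have := is_diff_comp (is_diff_fst x) (d33 x.1). Qed.
Let d44 (x : R4 R) : is_diff x (fun x : R4 R => x.2) (fun x : R4 R => x.2).
Proof. exact: is_diff_snd. Qed.

Section smooth_factors.
Variables h1 h2 h3 h4 : R -> R.
Hypothesis s1 : smooth (h1 : R^o -> R).
Hypothesis s2 : smooth (h2 : R^o -> R).
Hypothesis s3 : smooth (h3 : R^o -> R).
Hypothesis s4 : smooth (h4 : R^o -> R).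

Lemma smooth_tens3 : smooth (tens3 h1 h2 h3).
Proof.
apply: smooth_mul; first exact: (smooth_affine_comp d31).
by apply: smooth_mul; [exact: (smooth_affine_comp d32)|exact: (smooth_affine_comp d33)].
Qed.

Lemma smooth_tens4 : smooth (tens4 h1 h2 h3 h4).
Proof.
apply: smooth_mul; first exact: (smooth_affine_comp d41).
apply: smooth_mul; first exact: (smooth_affine_comp d42).
by apply: smooth_mul; [exact: (smooth_affine_comp d43)|exact: (smooth_affine_comp d44)].
Qed.

Lemma derive_tens3 (v x : R3 R) :
  'D_v (tens3 h1 h2 h3) x =
  v.1.1 * tens3 (d1 h1) h2 h3 x + v.1.2 * tens3 h1 (d1 h2) h3 x
  + v.2 * tens3 h1 h2 (d1 h3) x.
Proof.
pose f1 : R3 R -> R := h1 \o (fun x => x.1.1).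
pose f2 : R3 R -> R := h2 \o (fun x => x.1.2).
pose f3 : R3 R -> R := h3 \o (fun x => x.2).
have S1 : smooth f1 := smooth_affine_comp d31 s1.
have S2 : smooth f2 := smooth_affine_comp d32 s2.
have S3 : smooth f3 := smooth_affine_comp d33 s3.
have S23 : smooth (f2 \* f3) := smooth_mul S2 S3.
rewrite -[tens3 h1 h2 h3]/(f1 \* (f2 \* f3)).
rewrite (derive_mulE v x S1 S23) (derive_mulE v x S2 S3).
rewrite /f1 (derive_coord_comp v x d31 s1) /f2 (derive_coord_comp v x d32 s2).
by rewrite /f3 (derive_coord_comp v x d33 s3) /f2 /tens3 /=; ring.
Qed.

Lemma derive_tens4 (v z : R4 R) :
  'D_v (tens4 h1 h2 h3 h4) z =
  v.1.1.1 * tens4 (d1 h1) h2 h3 h4 z + v.1.1.2 * tens4 h1 (d1 h2) h3 h4 z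
  + v.1.2 * tens4 h1 h2 (d1 h3) h4 z + v.2 * tens4 h1 h2 h3 (d1 h4) z.
Proof.
pose f1 : R4 R -> R := h1 \o (fun z => z.1.1.1).
pose f2 : R4 R -> R := h2 \o (fun z => z.1.1.2).
pose f3 : R4 R -> R := h3 \o (fun z => z.1.2).
pose f4 : R4 R -> R := h4 \o (fun z => z.2).
have S1 : smooth f1 := smooth_affine_comp d41 s1.
have S2 : smooth f2 := smooth_affine_comp d42 s2.
have S3 : smooth f3 := smooth_affine_comp d43 s3.
have S4 : smooth f4 := smooth_affine_comp d44 s4.
have S34 : smooth (f3 \* f4) := smooth_mul S3 S4.
have S234 : smooth (f2 \* (f3 \* f4)) := smooth_mul S2 S34.
rewrite -[tens4 h1 h2 h3 h4]/(f1 \* (f2 \* (f3 \* f4))).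
rewrite (derive_mulE v z S1 S234) (derive_mulE v z S2 S34) (derive_mulE v z S3 S4).
rewrite /f1 (derive_coord_comp v z d41 s1) /f2 (derive_coord_comp v z d42 s2).
rewrite /f3 (derive_coord_comp v z d43 s3) /f4 (derive_coord_comp v z d44 s4)
  /f2 /f3 /tens4 /=.
ring.
Qed.

Lemma dtime_tens4 : dtime (tens4 h1 h2 h3 h4) = tens4 h1 h2 h3 (d1 h4).
Proof. by apply/funext => z; rewrite /dtime derive_tens4/=; ring. Qed.

Lemma dspace_tens4 (j : 'I_3) : dspace j (tens4 h1 h2 h3 h4) =
  tens4 (if j == 0 then (d1 h1) else h1) (if j == 1 then (d1 h2) else h2)
        (if j == 2 then (d1 h3) else h3) h4.
Proof.
apply/funext => z; rewrite /dspace derive_tens4/=.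
by case: j => -[|[|[|//]]] jlt /=; rewrite ?(mul0r, mul1r, addr0, add0r).
Qed.

Lemma derive_tens3_basis (j : 'I_3) : 'D_(basis3 j) (tens3 h1 h2 h3) =
  tens3 (if j == 0 then (d1 h1) else h1) (if j == 1 then (d1 h2) else h2)
        (if j == 2 then (d1 h3) else h3).
Proof.
apply/funext => z; rewrite derive_tens3/=.
by case: j => -[|[|[|//]]] jlt /=; rewrite ?(mul0r, mul1r, addr0, add0r).
Qed.

End smooth_factors.

End tensor_products.

Section cutoff.
Context {R : realType}.
Local Notation d1 h := ('D_1 (h : R^o -> R)).

Definition scaled (h : R -> R) (a r s : R) : R := h ((s - a) / r).

Lemma is_diff_scaled (a r s : R) :
  is_diff (s : R^o) (fun s : R^o => (s - a) / r : R) (fun s : R^o => s / r : R).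
Proof.
have h := is_diffB (is_diff_id (s : R^o)) (is_diff_cst (a : R^o) (s : R^o)).
have := is_diffZ r^-1 h.
have -> : (r^-1 *: ((id : R^o -> R^o) - cst (a : R^o))) =
   (fun s : R^o => (s - a) / r : R).
  by apply/funext => x; exact: mulrC.
by have -> : (r^-1 *: ((id : R^o -> R^o) - 0)) = (fun s : R^o => s / r : R)
  by apply/funext => x; rewrite subr0; exact: mulrC.
Qed.

Lemma smooth_scaled (h : R -> R) (a r : R) :
  smooth (h : R^o -> R) -> smooth (scaled h a r : R^o -> R).
Proof. exact: (smooth_affine_comp (is_diff_scaled a r)). Qed.

Lemma derive_scaled (h : R -> R) (a r s : R) : smooth (h : R^o -> R) ->
  'D_1 (scaled h a r : R^o -> R) s = r^-1 * scaled ('D_1 (h : R^o -> R)) a r s.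
Proof.
move=> sh; rewrite (derive_affine_comp _ (is_diff_scaled a r s)); last first.
  exact: smooth_differentiable.
by rewrite mul1r.
Qed.

(** The half-width exceeds 1/2, so the cut-off is bounded below on [[-1/2, 1/2]]. Moreover
    [3 (11/20)^2 = 363/400 < 1], so a cube of half-side [11/20 r] still lies in the ball of radius
    [r]. *)
Definition cut : R -> R := bump 1 (- (11 / 20)) (11 / 20).

Lemma smooth_cut : smooth (cut : R^o -> R).
Proof. exact: smooth_bump. Qed.

Lemma smooth_cut2 : smooth (cut \* cut : R^o -> R).
Proof. exact: (smooth_mul smooth_cut smooth_cut). Qed.

Lemma cut_ge0 s : 0 <= cut s. Proof. exact: bump_ge0. Qed.

Lemma cut_le1 s : cut s <= 1. Proof. exact: bump_le1. Qed.

Lemma cut_eq0 s : 11 / 20 < `|s| -> cut s = 0.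
Proof.
move=> s1; apply: bump_eq0; rewrite in_itv/= -ltr_norml -leNgt; exact: ltW.
Qed.

Lemma test_function_cut (f : R -> R) : smooth (f : R^o -> R) ->
  (forall s, 11 / 20 < `|s| -> f s = 0) ->
  test_function [set s : R^o | `|s| <= 11 / 20] (f : R^o -> R).
Proof.
move=> sf f0; apply: (@test_function_compact _ _ [set s : R^o | `|s| <= 11 / 20]) => //.
  rewrite (_ : [set s : R^o | _] = `[- (11 / 20), 11 / 20]%classic).
    exact: segment_compact.
  by apply/seteqP; split => s /=; rewrite in_itv/= ler_norml.
by move=> s /negP; rewrite -ltNge => /f0.
Qed.

Lemma test_function_eq0 (V : normedModType R) (Omega : set V) (f : V -> R) x :
  test_function Omega f -> ~ Omega x -> f x = 0.
Proof. by move=> [_ _ H] nx; apply: notin_tsupport => /H. Qed.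

Lemma cut_test : test_function [set s : R^o | `|s| <= 11 / 20] (cut : R^o -> R).
Proof. apply: test_function_cut; [exact: smooth_cut|exact: cut_eq0]. Qed.

Lemma cut2_test : test_function [set s : R^o | `|s| <= 11 / 20] (cut \* cut : R^o -> R).
Proof.
apply: test_function_cut; first exact: smooth_cut2.
by move=> s /cut_eq0 /= ->; rewrite mul0r.
Qed.

Definition cut_derivatives_le (M : R) : Prop :=
  forall s, [/\ `|d1 cut s| <= M, `|d1 (cut \* cut) s| <= M &
    `|d1 (d1 (cut \* cut)) s| <= M].

Lemma cut_bounds : exists2 M : R, 1 <= M &
  cut_derivatives_le M.
Proof.
have [M1 H1] := test_function_bounded (test_function_derive (1 : R^o) cut_test).
have [M2 H2] := test_function_bounded (test_function_derive (1 : R^o) cut2_test).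
have [M3 H3] := test_function_bounded
  (test_function_derive (1 : R^o) (test_function_derive (1 : R^o) cut2_test)).
exists (1 + `|M1| + `|M2| + `|M3|).
  by rewrite -!addrA lerDl !addr_ge0.
move=> s; split; [apply: (le_trans (H1 s))|apply: (le_trans (H2 s))|
  apply: (le_trans (H3 s))]; have := ler_norm M1; have := ler_norm M2;
  have := ler_norm M3; have := normr_ge0 M1; have := normr_ge0 M2;
  have := normr_ge0 M3; lra.
Qed.

Lemma cut_lower_bound : exists2 c : R, 0 < c & forall s, `|s| <= 1 / 2 -> c <= cut s.
Proof.
(* For [|s| <= 1/2] both distances to the end points are at least [1/20], so each factor [e^(-1/x)]
   is at least [e^(-20)]. *)
exists (expR (- 20) * expR (- 20)); first by rewrite mulr_gt0 ?expR_gt0.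
have F x : 1 / 20 <= x -> expR (- 20) <= flat 1 1 x :> R.
  move=> x0; rewrite flat1; last lra.
  by rewrite ler_expR lerN2 ler_pdivrMr; lra.
move=> s; rewrite ler_norml => /andP[sa sb].
by apply: ler_pM; rewrite ?expR_ge0//; apply: F; lra.
Qed.

Lemma derive_cut2 s : d1 (cut \* cut) s = 2 * (cut s * d1 cut s).
Proof.
have /= -> := @derive_mulE _ R^o cut cut 1 s smooth_cut smooth_cut.
by rewrite mulrC -mulr2n mulr_natl.
Qed.

Definition cube (x0 : R3 R) (r : R) : set (R3 R) :=
  (`[x0.1.1 - 11 / 20 * r, x0.1.1 + 11 / 20 * r] `*`
   `[x0.1.2 - 11 / 20 * r, x0.1.2 + 11 / 20 * r]) `*`
  `[x0.2 - 11 / 20 * r, x0.2 + 11 / 20 * r].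

Lemma cube_abs x0 r x : cube x0 r x <->
  [/\ `|x.1.1 - x0.1.1| <= 11 / 20 * r, `|x.1.2 - x0.1.2| <= 11 / 20 * r &
     `|x.2 - x0.2| <= 11 / 20 * r].
Proof.
have E (a b d : R) : (a \in `[b - d, b + d]) = (`|a - b| <= d).
  by rewrite in_itv/= ler_distl.
rewrite /cube /=; split=> [[[]]|[]]; first by rewrite !E.
by rewrite -!E.
Qed.

Lemma scaled_cut_eq0 (a r s : R) : 0 < r -> 11 / 20 * r < `|s - a| ->
  scaled cut a r s = 0.
Proof.
move=> r0 h; apply: cut_eq0; rewrite normrM normfV (gtr0_norm r0).
by rewrite ltr_pdivlMr.
Qed.

Section space_time_cutoff.
Variables (x0 : R3 R) (t0 r : R).
Hypothesis r0 : 0 < r.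

Let r20 : 0 < r ^+ 2. Proof. by rewrite exprn_gt0. Qed.

Definition zeta : R4 R -> R :=
  tens4 (scaled cut x0.1.1 r) (scaled cut x0.1.2 r) (scaled cut x0.2 r)
    (scaled cut t0 (r ^+ 2)).

(** Written as a tensor product of squared profiles rather than as a square, so that the formulas
    for derivatives of tensor products apply to it. *)
Definition zeta2 : R4 R -> R :=
  tens4 (scaled (cut \* cut) x0.1.1 r) (scaled (cut \* cut) x0.1.2 r)
    (scaled (cut \* cut) x0.2 r) (scaled (cut \* cut) t0 (r ^+ 2)).

Definition cylinder : set (R4 R) :=
  cube x0 r `*` `[t0 - 11 / 20 * r ^+ 2, t0 + 11 / 20 * r ^+ 2].

Lemma zeta2E z : zeta2 z = zeta z ^+ 2.
Proof. by rewrite /zeta2 /zeta /tens4 /scaled /=; ring. Qed.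

Lemma zeta_ge0 z : 0 <= zeta z.
Proof.
rewrite /zeta /tens4 /scaled /=.
by do 3! (apply: mulr_ge0; first exact: cut_ge0); exact: cut_ge0.
Qed.

Lemma zeta_le1 z : zeta z <= 1.
Proof.
have H (a b : R) : 0 <= a <= 1 -> 0 <= b <= 1 -> 0 <= a * b <= 1.
  by move=> /andP[a0 a1] /andP[b1 b2]; rewrite mulr_ge0//= mulr_ile1.
have C s : 0 <= cut s <= 1 by rewrite cut_ge0 cut_le1.
by have /andP[_] := H _ _ (C ((z.1.1.1 - x0.1.1) / r))
  (H _ _ (C ((z.1.1.2 - x0.1.2) / r))
  (H _ _ (C ((z.1.2 - x0.2) / r)) (C ((z.2 - t0) / r ^+ 2)))).
Qed.

Lemma zeta_cube z : ~ cube x0 r z.1 -> zeta z = 0.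
Proof.
move=> H; rewrite /zeta /tens4 /=.
have [h1|h1] := leP `|z.1.1.1 - x0.1.1| (11 / 20 * r); last first.
  by rewrite (scaled_cut_eq0 r0 h1) mul0r.
have [h2|h2] := leP `|z.1.1.2 - x0.1.2| (11 / 20 * r); last first.
  by rewrite (scaled_cut_eq0 r0 h2) mul0r mulr0.
have [h3|h3] := leP `|z.1.2 - x0.2| (11 / 20 * r); last first.
  by rewrite (scaled_cut_eq0 r0 h3) mul0r !mulr0.
by exfalso; apply: H; apply/cube_abs.
Qed.

Lemma zeta_cylinder z : ~ cylinder z -> zeta z = 0.
Proof.
move=> H; have [h1|h1] := pselect (cube x0 r z.1); last exact: zeta_cube.
have [h2|h2] := leP `|z.2 - t0| (11 / 20 * r ^+ 2); last first.
  by rewrite /zeta /tens4 /= (scaled_cut_eq0 r20 h2) !mulr0.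
by exfalso; apply: H; split => //=; rewrite in_itv/= -ler_distl.
Qed.

Lemma compact_cylinder : compact cylinder.
Proof.
apply: compact_setX; last exact: segment_compact.
by apply: compact_setX; [apply: compact_setX|]; exact: segment_compact.
Qed.

Lemma smooth_zeta2 : smooth zeta2.
Proof. by apply: smooth_tens4; apply: smooth_scaled; exact: smooth_cut2. Qed.

Lemma test_function_zeta2 : test_function cylinder zeta2.
Proof.
apply: (@test_function_compact _ _ cylinder) => //.
- exact: smooth_zeta2.
- exact: compact_cylinder.
- by move=> z /zeta_cylinder; rewrite zeta2E => ->; rewrite expr0n.
Qed.

Lemma cube_edist x : cube x0 r x -> Defs.edist x x0 < r.
Proof.
move=> /cube_abs[h1 h2 h3]; rewrite /Defs.edist.
have sq (a b : R) : 0 <= b -> `|a| <= b -> a ^+ 2 <= b ^+ 2.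
  by move=> b0 ab; rewrite -[a ^+ 2]real_normK ?num_real// lerXn2r// nnegrE.
have b0 : 0 <= 11 / 20 * r by rewrite mulr_ge0// ltW.
have := sq _ _ b0 h1; have := sq _ _ b0 h2; have := sq _ _ b0 h3.
move=> k3 k2 k1; rewrite -[ltRHS](gtr0_norm r0) -sqrtr_sqr.
rewrite ltr_sqrt//; have := r20; nra.
Qed.

Lemma edist_abs x : [/\ `|x.1.1 - x0.1.1| <= Defs.edist x x0,
  `|x.1.2 - x0.1.2| <= Defs.edist x x0 & `|x.2 - x0.2| <= Defs.edist x x0].
Proof.
rewrite /Defs.edist; set a := x.1.1 - _; set b := x.1.2 - _; set c := x.2 - _.
have := sqr_ge0 a; have := sqr_ge0 b; have := sqr_ge0 c => c2 b2 a2.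
by split; rewrite -sqrtr_sqr ler_wsqrtr//; lra.
Qed.

(** The closed set [cylinder] outside which the cut-off vanishes misses the parabolic boundary: its
    times are at least [t0 - 11/20 r^2 > t0 - 1], and its cube is inside the ball of radius
    [r < 1]. *)
Lemma zeta2_pboundary : r < 1 ->
  set_nbhs (pboundary (x0, t0) 1) [set z | zeta2 z = 0].
Proof.
move=> r1; have r21 : r ^+ 2 < 1 by rewrite expr_lt1// ltW.
have oK : open (~` cylinder).
  rewrite openC; exact: (compact_closed (@norm_hausdorff _ (R4 R)) compact_cylinder).
move=> z zP; have nK : (~` cylinder) z.
  move=> [zc /=]; rewrite in_itv/= => /andP[t1 t2].
  case: zP => -[/= za zb].
    by move: t1; rewrite zb expr1n; lra.
  by have := cube_edist zc; rewrite za => /(lt_trans r1); rewrite ltxx.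
move: oK; rewrite openE => /(_ _ nK); apply: filterS => y /= yK.
by rewrite zeta2E (zeta_cylinder yK) expr0n.
Qed.

Lemma zeta_lower_bound c z : (forall s, `|s| <= 1 / 2 -> c <= cut s) -> 0 < c ->
  pcyl (x0, t0) (r / 2) z -> c ^+ 4 <= zeta z.
Proof.
move=> cc c0 [/= zx]; rewrite /time_itv /= in_itv/= => /andP[t1 t2].
have [h1 h2 h3] := edist_abs z.1.
have F a s d : 0 < d -> `|s - a| <= d / 2 -> c <= scaled cut a d s.
  move=> d0 h; apply: cc; rewrite normrM normfV (gtr0_norm d0).
  by rewrite ler_pdivrMr//; lra.
have e4 : c ^+ 4 = c * (c * (c * c)) by ring.
have zx' : Defs.edist z.1 x0 < r / 2 by [].
rewrite e4 /zeta /tens4 /=; have c0' := ltW c0.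
have k1 := F _ _ _ r0 (le_trans h1 (ltW zx')).
have k2 := F _ _ _ r0 (le_trans h2 (ltW zx')).
have k3 := F _ _ _ r0 (le_trans h3 (ltW zx')).
have k4 : c <= scaled cut t0 (r ^+ 2) z.2.
  by apply: F => //; rewrite ler_norml; move: t1; rewrite expr_div_n; lra.
have c20 := mulr_ge0 c0' c0'.
exact: (ler_pM c0' (mulr_ge0 c0' c20) k1 (ler_pM c0' c20 k2 (ler_pM c0' c0' k3 k4))).
Qed.

Section bounds.
Variable M : R.
Hypothesis HM : cut_derivatives_le M.

Let scaled_norm (h : R -> R) a d s A : (forall s, `|h s| <= A) ->
  `|scaled h a d s| <= A.
Proof. exact. Qed.

Let cut_norm s : `|cut s| <= 1.
Proof. by rewrite ger0_norm ?cut_ge0 ?cut_le1. Qed.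

Let cut2_norm s : `|(cut \* cut) s| <= 1.
Proof. by rewrite /= normrM mulr_ile1. Qed.

Let norm_mul4 (a b c d A B C D : R) : `|a| <= A -> `|b| <= B -> `|c| <= C ->
  `|d| <= D -> `|a * (b * (c * d))| <= A * (B * (C * D)).
Proof. by move=> ha hb hc hd; rewrite !normrM !ler_pM ?mulr_ge0. Qed.

Let deriv_norm (h : R -> R) (a d s : R) : smooth (h : R^o -> R) -> 0 < d ->
  (forall s, `|d1 h s| <= M) -> `|d1 (scaled h a d) s| <= d^-1 * M.
Proof.
move=> sh d0 hM; rewrite /= (derive_scaled _ _ _ sh) normrM gtr0_norm ?invr_gt0//.
by rewrite ler_pM2l ?invr_gt0//; exact: hM.
Qed.

Lemma dtime_zeta2_le z : `|dtime zeta2 z| <= M / r ^+ 2.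
Proof.
have S a d := smooth_scaled a d smooth_cut2.
rewrite /zeta2 (dtime_tens4 (S _ _) (S _ _) (S _ _) (S _ _)).
rewrite (_ : M / r ^+ 2 = 1 * (1 * (1 * ((r ^+ 2)^-1 * M)))); last by ring.
apply: norm_mul4; [exact: scaled_norm cut2_norm..|].
by apply: deriv_norm; [exact: smooth_cut2| |move=> s; case: (HM s)].
Qed.

Let deriv2_norm (h : R -> R) (a d s : R) : smooth (h : R^o -> R) -> 0 < d ->
  (forall s, `|d1 (d1 h) s| <= M) -> `|d1 (d1 (scaled h a d)) s| <= d^-1 * (d^-1 * M).
Proof.
move=> sh d0 hM; have sh' := smooth_derive (1 : R^o) sh.
have -> : d1 (scaled h a d) = cst d^-1 \* scaled (d1 h) a d.
  by apply/funext => y; rewrite /= (derive_scaled _ _ _ sh).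
have /= -> := @derive_mulE _ R^o (cst d^-1) (scaled (d1 h) a d) 1 s
  (smooth_cst _) (smooth_scaled a d sh').
rewrite derive_cst mul0r add0r normrM gtr0_norm ?invr_gt0//.
rewrite ler_pM2l ?invr_gt0//= (derive_scaled _ _ _ sh').
by rewrite normrM gtr0_norm ?invr_gt0// ler_pM2l ?invr_gt0//; exact: hM.
Qed.

Lemma laplacian_zeta2_le z : `|laplacian zeta2 z| <= 3 * (M / r ^+ 2).
Proof.
rewrite /laplacian; apply: (le_trans (ler_norm_sum _ _ _)).
rewrite (_ : 3 * (M / r ^+ 2) = \sum_(j < 3) (M / r ^+ 2)); last first.
  by rewrite sumr_const card_ord mulr_natl.
apply: ler_sum => j _.
have S a d := smooth_scaled a d smooth_cut2.
have S' a d := smooth_derive (1 : R^o) (S a d).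
have r2 : M / r ^+ 2 = r^-1 * (r^-1 * M) by field; rewrite gt_eqF.
have B a s : `|d1 (d1 (scaled (cut \* cut) a r)) s| <= r^-1 * (r^-1 * M).
  by apply: deriv2_norm; [exact: smooth_cut2| |move=> y; case: (HM y)].
rewrite /zeta2 (dspace_tens4 (S _ _) (S _ _) (S _ _) (S _ _)).
rewrite dspace_tens4; [|by case: ifP => _; [exact: S'|exact: S] ..|exact: S].
rewrite r2 /tens4; case: j => -[|[|[|//]]] jlt /=.
- rewrite -[leRHS]mulr1 -[X in _ <= _ * X]mulr1 -[X in _ <= _ * (_ * X)]mulr1.
  by apply: norm_mul4 => //; exact: scaled_norm cut2_norm.
- rewrite -[leRHS]mul1r -[X in _ <= _ * X]mulr1 -[X in _ <= _ * (_ * X)]mulr1.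
  by apply: norm_mul4 => //; exact: scaled_norm cut2_norm.
- rewrite -[leRHS]mul1r -[X in _ <= _ * X]mul1r -[X in _ <= _ * (_ * X)]mulr1.
  by apply: norm_mul4 => //; exact: scaled_norm cut2_norm.
Qed.

Let cut2_deriv_norm (a d s : R) : 0 < d ->
  `|d1 (scaled (cut \* cut) a d) s| <= 2 * (M / d) * scaled cut a d s.
Proof.
move=> d0; rewrite /= (derive_scaled _ _ _ smooth_cut2) /scaled derive_cut2.
have [+ _ _] := HM ((s - a) / d); have := cut_ge0 ((s - a) / d).
move: (cut ((s - a) / d)) (derive _ _ _) => p b p0 h.
rewrite (_ : d^-1 * (2 * (p * b)) = 2 * d^-1 * p * b); last by ring.
have q0 : 0 <= 2 * d^-1 * p by rewrite !mulr_ge0// invr_ge0 ltW.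
rewrite normrM (ger0_norm q0) (_ : 2 * (M / d) * p = 2 * d^-1 * p * M); last by ring.
exact: ler_wpM2l.
Qed.

Let cut2_le a d s : `|scaled (cut \* cut) a d s| <= scaled cut a d s.
Proof.
rewrite /scaled /=; have := cut_ge0 ((s - a) / d); have := cut_le1 ((s - a) / d).
move: (cut _) => p p1 p0; rewrite ger0_norm; last exact: mulr_ge0.
exact: ler_piMr.
Qed.

(** The differentiated factor is [2 cut cut' / r] and keeps one power of [cut]; the other three
    satisfy [cut^2 <= cut]. Together the four factors rebuild [zeta]. *)
Lemma dspace_zeta2_le j z : `|dspace j zeta2 z| <= 2 * (M / r) * zeta z.
Proof.
have S a d := smooth_scaled a d smooth_cut2.
rewrite /zeta2 (dspace_tens4 (S _ _) (S _ _) (S _ _) (S _ _)) /zeta /tens4.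
set A := 2 * (M / r).
case: j => -[|[|[|//]]] jlt /=.
- by rewrite [leRHS]mulrA; apply: norm_mul4 => //; exact: cut2_deriv_norm.
- rewrite [leRHS]mulrCA [X in _ <= _ * X]mulrA.
  by apply: norm_mul4 => //; exact: cut2_deriv_norm.
- rewrite [leRHS]mulrCA [X in _ <= _ * X]mulrCA [X in _ <= _ * (_ * X)]mulrA.
  by apply: norm_mul4 => //; exact: cut2_deriv_norm.
Qed.

(** The cut-off at a fixed time. Its time factor is a constant absorbed into the first spatial
    factor, which keeps the form of a tensor product. *)
Definition xi (t : R) : R3 R -> R :=
  tens3 (cst (scaled cut t0 (r ^+ 2) t) \* scaled cut x0.1.1 r)
    (scaled cut x0.1.2 r) (scaled cut x0.2 r).

Lemma xiE t x : xi t x = zeta (x, t).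
Proof. by rewrite /xi /zeta /tens3 /tens4 /=; ring. Qed.

Lemma smooth_xi t : smooth (xi t).
Proof.
have S a d := smooth_scaled a d smooth_cut.
by apply: smooth_tens3 => //; exact: smooth_mul (@smooth_cst _ R^o _) (S _ _).
Qed.

Lemma derive_xi_le t j x : `|'D_(basis3 j) (xi t) x| <= M / r.
Proof.
have S a d := smooth_scaled a d smooth_cut.
have S1 : smooth (cst (scaled cut t0 (r ^+ 2) t) \* scaled cut x0.1.1 r : R^o -> R).
  exact: smooth_mul (@smooth_cst _ R^o _) (S _ _).
have B a s : `|d1 (scaled cut a r) s| <= r^-1 * M.
  by apply: deriv_norm; [exact: smooth_cut| |move=> y; case: (HM y)].
have C a d s : `|scaled cut a d s| <= 1 by exact: scaled_norm cut_norm.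
have N3 (a b c A1 B1 C1 : R) : `|a| <= A1 -> `|b| <= B1 -> `|c| <= C1 ->
    `|a * (b * c)| <= A1 * (B1 * C1).
  by move=> ha hb hc; rewrite !normrM !ler_pM ?mulr_ge0.
have := derive_tens3_basis S1 (S x0.1.2 r) (S x0.2 r) j.
move=> /(congr1 (fun F => F x)) ->; rewrite mulrC.
rewrite /tens3; case: j => -[|[|[|//]]] jlt /=.
- have /= -> := @derive_mulE _ R^o (cst (scaled cut t0 (r ^+ 2) t)) (scaled cut x0.1.1 r)
    1 x.1.1 (@smooth_cst _ R^o _) (S _ _).
  rewrite derive_cst mul0r add0r -[leRHS]mulr1 -[X in _ <= _ * X]mulr1.
  by apply: N3 => //; rewrite -[leRHS]mul1r normrM ler_pM.
- rewrite -[leRHS]mul1r -[X in _ <= _ * X]mulr1.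
  by apply: N3 => //; rewrite normrM mulr_ile1.
- rewrite -[leRHS]mul1r -[X in _ <= _ * X]mul1r.
  by apply: N3 => //; rewrite normrM mulr_ile1.
Qed.

Lemma test_function_xi t : test_function (cube x0 r) (xi t).
Proof.
apply: (@test_function_compact _ _ (cube x0 r)) => //; first exact: smooth_xi.
  by apply: compact_setX; [apply: compact_setX|]; exact: segment_compact.
by move=> x nx; rewrite xiE; exact: zeta_cube.
Qed.

End bounds.

End space_time_cutoff.

End cutoff.

(** * Estimates at a fixed time *)

Section slice_estimate.
Context {R : realType}.
Local Open Scope ereal_scope.
Local Notation leb := (@lebesgue_measure R).
Local Notation T1 := (measurableTypeR R).

Lemma measurable_smooth1 (h : R -> R) : smooth (h : R^o -> R) ->
  measurable_fun (setT : set T1) h.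
Proof. by move=> /smooth_continuous; exact: continuous_measurable_fun. Qed.

Lemma measurable_tens3 (h1 h2 h3 : R -> R) : smooth (h1 : R^o -> R) ->
  smooth (h2 : R^o -> R) -> smooth (h3 : R^o -> R) ->
  measurable_fun (setT : set (mR3 R)) (tens3 h1 h2 h3).
Proof.
move=> /measurable_smooth1 m1 /measurable_smooth1 m2 /measurable_smooth1 m3.
apply: measurable_funM.
  exact: (measurableT_comp m1 (measurableT_comp measurable_fst measurable_fst)).
apply: measurable_funM; last exact: (measurableT_comp m3 measurable_snd).
exact: (measurableT_comp m2 (measurableT_comp measurable_snd measurable_fst)).
Qed.

Lemma measurable_cube x0 (r : R) : measurable (cube x0 r : set (mR3 R)).
Proof. by apply: measurableX => //; apply: measurableX. Qed.

Lemma leb3_cube_le x0 (r : R) : (0 < r)%R -> leb3 R (cube x0 r) <= (2 * r ^+ 3)%:E.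
Proof.
move=> r0; have L (a : R) : leb `[(a - 11 / 20 * r)%R, (a + 11 / 20 * r)%R]%classic
    = (11 / 10 * r)%:E.
  rewrite lebesgue_measure_itv/= lte_fin ifT; last by nra.
  by rewrite -EFinD; congr (_%:E); lra.
have P (A B C : set T1) : measurable A -> measurable B -> measurable C ->
    leb3 R ((A `*` B) `*` C) = leb A * leb B * leb C.
  move=> mA mB mC.
  have := @product_measure1E _ _ _ _ R (sprod leb leb) leb _ _ (measurableX mA mB) mC.
  by have := @product_measure1E _ _ _ _ R leb leb _ _ mA mB => <-.
rewrite P// !L -!EFinM lee_fin.
have : (0 <= r ^+ 3)%R by rewrite exprn_ge0 ?ltW.
nra.
Qed.

Section bump_tensor.
Variables (c a1 b1 a2 b2 a3 b3 : R).
Hypothesis c0 : (0 < c)%R.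

Lemma bump3_extractE j (x : R3 R) : bump3 c a1 b1 a2 b2 a3 b3 (extract j x) =
  tens3 (if j == 0%R then bump c a1 b1 else bump c a2 b2)
        (if j == 1%R then bump c a1 b1 else if j == 0%R then bump c a2 b2 else bump c a3 b3)
        (if j == 2%R then bump c a1 b1 else bump c a3 b3) x.
Proof. by rewrite /bump3 /tens3; case: j => -[|[|[|//]]] jlt /=; ring. Qed.

Lemma bump3_prim_extractE j (x : R3 R) : bump3_prim c a1 b1 a2 b2 a3 b3 (extract j x) =
  tens3 (if j == 0%R then bump_prim c a1 b1 else bump c a2 b2)
        (if j == 1%R then bump_prim c a1 b1 else if j == 0%R then bump c a2 b2 else bump c a3 b3)
        (if j == 2%R then bump_prim c a1 b1 else bump c a3 b3) x.
Proof. by rewrite /bump3_prim /tens3; case: j => -[|[|[|//]]] jlt /=; ring. Qed.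

Lemma smooth_bump3_prim j :
  smooth (fun x : R3 R => bump3_prim c a1 b1 a2 b2 a3 b3 (extract j x)).
Proof.
rewrite (funext (bump3_prim_extractE j)).
by apply: smooth_tens3; repeat case: ifP => _; first [exact: smooth_bump_prim|exact: smooth_bump].
Qed.

Lemma derive_bump3_prim j (x : R3 R) :
  ('D_(basis3 j) (fun x : R3 R => bump3_prim c a1 b1 a2 b2 a3 b3 (extract j x)) x =
   bump3 c a1 b1 a2 b2 a3 b3 (extract j x))%R.
Proof.
rewrite (funext (bump3_prim_extractE j)).
have sb a b := smooth_bump a b c0; have sp := smooth_bump_prim a1 b1 c0.
have D y : ('D_1 (bump_prim c a1 b1 : R^o -> R) y = bump c a1 b1 y)%R.
  by have [_ ->] := is_derive_bump_prim a1 b1 y c0.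
rewrite bump3_extractE.
case: j => -[|[|[|//]]] jlt /=.
- have := derive_tens3_basis sp (sb a2 b2) (sb a3 b3) (Ordinal jlt).
  by move=> /(congr1 (fun F => F x)) /= ->; rewrite /tens3 /= D.
- have := derive_tens3_basis (sb a2 b2) sp (sb a3 b3) (Ordinal jlt).
  by move=> /(congr1 (fun F => F x)) /= ->; rewrite /tens3 /= D.
- have := derive_tens3_basis (sb a2 b2) (sb a3 b3) sp (Ordinal jlt).
  by move=> /(congr1 (fun F => F x)) /= ->; rewrite /tens3 /= D.
Qed.

End bump_tensor.

Lemma exists_root (n : nat) (x : R) : (0 < x)%R -> exists2 y : R, (0 < y)%R & (y ^+ n.+1 = x)%R.
Proof.
move=> x0; exists (x `^ (n.+1%:R^-1))%R; first exact: powR_gt0.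
rewrite -powR_mulrn ?powR_ge0// -powRrM mulVf ?pnatr_eq0// powRr1//; exact: ltW.
Qed.

(** With [d^2 = e / C]: if [K <= d s], the left side is at most [e s^3 n]; otherwise [s <= K / d]
    gives [(C / d) n K^3]. The product [n K^3] is left unsplit because [K^3] will be integrated in
    time while [n] is constant in time. *)
Lemma weighted_young (C e : R) : (0 < C)%R -> (0 < e)%R -> exists2 c : R, (0 < c)%R &
  forall K s n : R, (0 < K)%R -> (0 < s)%R -> (0 < n)%R ->
    (C * (K ^+ 2 * s * n) <= e * (s ^+ 4 + n ^+ 4) + c * (n * K ^+ 3))%R.
Proof.
move=> C0 e0; have [d d0 dE] := @exists_root 1 (e / C) (divr_gt0 e0 C0).
exists (C / d)%R; first exact: divr_gt0.
move=> K s n K0 s0 n0.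
have ns : (s ^+ 3 * n <= s ^+ 4 + n ^+ 4)%R.
  have [sn|/ltW sn] := leP s n.
    have h : (s ^+ 3 <= n ^+ 3)%R.
      by apply: lerXn2r; rewrite ?nnegrE ?(ltW s0) ?(ltW n0).
    have k1 := ler_wpM2r (ltW n0) h; have s4 : (0 <= s ^+ 4)%R by rewrite exprn_ge0 ?ltW.
    have E : (n ^+ 4 = n ^+ 3 * n)%R by rewrite -exprSr.
    by move: k1; rewrite -E; lra.
  have s3 : (0 <= s ^+ 3)%R by rewrite exprn_ge0 ?ltW.
  have k1 := ler_wpM2l s3 sn; have n4 : (0 <= n ^+ 4)%R by rewrite exprn_ge0 ?ltW.
  have E : (s ^+ 4 = s ^+ 3 * s)%R by rewrite -exprSr.
  by move: k1; rewrite -E; lra.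
have [Ks|/ltW Ks] := leP K (d * s)%R.
  have K2 : (K ^+ 2 <= (d * s) ^+ 2)%R.
    by apply: lerXn2r => //; rewrite nnegrE ?(ltW K0)// mulr_ge0 ?(ltW d0) ?(ltW s0).
  have sn0 : (0 <= s * n)%R by rewrite mulr_ge0 ?(ltW s0) ?(ltW n0).
  have k1 := ler_wpM2l (ltW C0) (ler_wpM2r sn0 K2).
  have E : (C * ((d * s) ^+ 2 * (s * n)) = e * (s ^+ 3 * n))%R.
    by rewrite exprMn dE; field; rewrite gt_eqF.
  have k2 := ler_wpM2l (ltW e0) ns.
  have p : (0 <= C / d * (n * K ^+ 3))%R.
    have Cd := divr_ge0 (ltW C0) (ltW d0).
    by apply: mulr_ge0 => //; apply: mulr_ge0; [exact: ltW|apply: exprn_ge0; exact: ltW].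
  by move: k1; rewrite E mulrA; lra.
have sK : (s <= K / d)%R by rewrite ler_pdivlMr// mulrC.
have q : (0 <= C * (K ^+ 2 * n))%R.
  by apply: mulr_ge0; [exact: ltW|apply: mulr_ge0; [apply: exprn_ge0|]; exact: ltW].
have k1 := ler_wpM2l q sK.
have p : (0 <= e * (s ^+ 4 + n ^+ 4))%R.
  by apply: mulr_ge0; [exact: ltW|apply: addr_ge0; apply: exprn_ge0; exact: ltW].
have E1 : (C * (K ^+ 2 * n) * (K / d) = C / d * (n * K ^+ 3))%R by field; rewrite gt_eqF.
by move: k1; rewrite E1; lra.
Qed.

(** The sum of the three coefficients of [weak_pairing], the second carrying the constant [64^4] of
    [weak_sobolev]. *)
Definition slice_const : R := (128 + 4 * 64 ^+ 4 + 48)%R.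

Section slice.
Variables (x0 : R3 R) (t0 r t M : R).
Hypothesis r0 : (0 < r)%R.
Hypothesis M1 : (1 <= M)%R.
Hypothesis HM : cut_derivatives_le M.
Variables (Om : set (R3 R)) (U : mR3 R -> R) (G : 'I_3 -> mR3 R -> R).
Hypothesis cubeOm : cube x0 r `<=` Om.
Hypothesis mU : measurable_fun setT U.
Hypothesis mG : forall j, measurable_fun setT (G j).
Hypothesis U2 : \int[leb3 R]_x (U x ^+ 2)%:E < +oo.
Hypothesis G2 : forall j, \int[leb3 R]_x (G j x ^+ 2)%:E < +oo.
Hypothesis wg : forall j (psi : R3 R -> R), test_function Om psi ->
  \int[leb3 R]_x (U x * 'D_(basis3 j) psi x)%R%:E =
  - \int[leb3 R]_x (G j x * psi x)%:E.

Let X := xi x0 t0 r t.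
Let dX j (x : mR3 R) : R := ('D_(basis3 j) X x)%R.
Let V (x : mR3 R) : R := (X x * U x)%R.
Let DV j (x : mR3 R) : R := (X x * G j x + dX j x * U x)%R.

Let measurable_X : measurable_fun (setT : set (mR3 R)) X.
Proof.
have S a d := smooth_scaled a d (@smooth_cut R).
by apply: measurable_tens3 => //; exact: smooth_mul (@smooth_cst _ R^o _) (S _ _).
Qed.

Let measurable_dX j : measurable_fun (setT : set (mR3 R)) (dX j).
Proof.
have S a d := smooth_scaled a d (@smooth_cut R).
have S1 : smooth (cst (scaled cut t0 (r ^+ 2) t) \* scaled cut x0.1.1 r : R^o -> R)%R.
  exact: smooth_mul (@smooth_cst _ R^o _) (S _ _).
have E := derive_tens3_basis S1 (S x0.1.2 r) (S x0.2 r) j.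
have -> : dX j = _ := E.
by apply: measurable_tens3; case: ifP => _ //; exact: (smooth_derive (1 : R^o)).
Qed.

Let X_bounds x : (0 <= X x <= 1)%R.
Proof. by rewrite /X xiE zeta_ge0 zeta_le1. Qed.

Let X_cube x : ~ cube x0 r x -> X x = 0%R.
Proof. exact: test_function_eq0 (test_function_xi x0 t0 r0 t). Qed.

Let dX_cube j x : ~ cube x0 r x -> dX j x = 0%R.
Proof. exact: test_function_eq0 (test_function_derive _ (test_function_xi x0 t0 r0 t)). Qed.

Let dX_le j x : (`|dX j x| <= M / r)%R.
Proof. exact: derive_xi_le. Qed.

Let integrable_sqr (f : mR3 R -> R) : measurable_fun setT f ->
  \int[leb3 R]_x (f x ^+ 2)%:E < +oo ->
  (leb3 R).-integrable setT (EFin \o (fun x => f x ^+ 2)%R).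
Proof.
move=> mf f2; apply/integrableP; split.
  by apply/measurable_EFinP; exact: measurable_funX.
rewrite (eq_integral (fun x => (f x ^+ 2)%:E))// => x _.
by rewrite /= ger0_norm// sqr_ge0.
Qed.

(** Every function to be integrated below is supported in the cube and at most quadratic in [U] and
    [G j], so domination by the indicator of the cube plus [U^2 + G_j^2] covers them all. *)
Let integrable_slice j (f : mR3 R -> R) (C : R) : measurable_fun setT f ->
  (forall x, ~ cube x0 r x -> f x = 0)%R ->
  (forall x, `|f x| <= C * (1 + (U x ^+ 2 + G j x ^+ 2)))%R ->
  (leb3 R).-integrable setT (EFin \o f).
Proof.
move=> mf f0 fC.
have I1 : (leb3 R).-integrable setT (EFin \o (\1_(cube x0 r) : mR3 R -> R)).
  apply/integrableP; split.
    by apply/measurable_EFinP; apply: measurable_indic; exact: measurable_cube.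
  rewrite (eq_integral (fun x : mR3 R => (\1_(cube x0 r) x)%:E)); last first.
    by move=> x _; rewrite /= ger0_norm.
  rewrite integral_indic//; last exact: measurable_cube.
  by rewrite setIT; apply: le_lt_trans (leb3_cube_le x0 r0) (ltry _).
have I2 := integrable_sqr mU U2.
have I3 := integrable_sqr (mG j) (G2 j).
have I4 := integrableZl measurableT C (integrableD measurableT I1 (integrableD measurableT I2 I3)).
apply: le_integrable I4 => //; first exact/measurable_EFinP.
move=> x _; rewrite -[leRHS]/(`|C * (\1_(cube x0 r) x + (U x ^+ 2 + G j x ^+ 2))|%R%:E).
rewrite -[leLHS]/(`|f x|%R%:E) lee_fin.
have [xc|xc] := pselect (cube x0 r x).
  apply: le_trans (fC x) _; apply: le_trans (ler_norm _) _.
  by rewrite indicE mem_set.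
by rewrite f0// normr0.
Qed.

Let le1_sqr (a b : R) : (`|a| <= 1 + (a ^+ 2 + b ^+ 2))%R.
Proof.
have := sqr_ge0 (`|a| - 1); have := sqr_ge0 b.
by rewrite sqrrB real_normK ?num_real//; have := normr_ge0 a; lra.
Qed.

Let le1_sqr' (a b : R) : (`|b| <= 1 + (a ^+ 2 + b ^+ 2))%R.
Proof. by rewrite [(a ^+ 2 + _)%R]addrC le1_sqr. Qed.

Let norm_mul (a b A B : R) : (`|a| <= A -> `|b| <= B -> `|a * b| <= A * B)%R.
Proof. by move=> ? ?; rewrite normrM ler_pM. Qed.

Let norm_X x : (`|X x| <= 1)%R.
Proof. by have /andP[? ?] := X_bounds x; rewrite ger0_norm. Qed.

Let Mr0 : (0 <= M / r)%R.
Proof. by rewrite divr_ge0 ?ltW// (lt_le_trans _ M1). Qed.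

Let integrable_V : (leb3 R).-integrable setT (EFin \o V).
Proof.
apply: (@integrable_slice ord0 _ 1); first exact: measurable_funM.
  by move=> x xc; rewrite /V X_cube// mul0r.
by move=> x; exact: norm_mul.
Qed.

Let measurable_DV j : measurable_fun setT (DV j).
Proof. by apply: measurable_funD; exact: measurable_funM. Qed.

Let integrable_DV j : (leb3 R).-integrable setT (EFin \o DV j).
Proof.
apply: (@integrable_slice j _ (1 + M / r)%R) => //.
  by move=> x xc; rewrite /DV X_cube// dX_cube// !mul0r addr0.
move=> x; rewrite /DV; apply: le_trans (ler_normD _ _) _.
by rewrite [leRHS]mulrDl; apply: lerD; exact: norm_mul.
Qed.

(** The weak gradient is tested with [X * P], whose support is in the cube although that of the
    primitive [P] is unbounded. The product rule produces the term in [dX], which is finite and is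
    moved to the other side. *)
Let weak_derivative j c a1 b1 a2 b2 a3 b3 : (0 < c)%R ->
  \int[leb3 R]_x (V x * bump3 c a1 b1 a2 b2 a3 b3 (extract j x))%:E =
  - \int[leb3 R]_x (DV j x * bump3_prim c a1 b1 a2 b2 a3 b3 (extract j x))%:E.
Proof.
move=> c0.
pose B (x : mR3 R) := bump3 c a1 b1 a2 b2 a3 b3 (extract j x).
pose P (x : mR3 R) := bump3_prim c a1 b1 a2 b2 a3 b3 (extract j x).
have sP : smooth (P : R3 R -> R) by exact: smooth_bump3_prim.
have sX : smooth (X : R3 R -> R) by exact: smooth_xi.
have DXP x : ('D_(basis3 j) (X \* P) x = dX j x * P x + X x * B x)%R.
  by rewrite (derive_mulE _ _ sX sP) (derive_bump3_prim _ _ _ _ _ _ c0).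
have tXP : test_function Om (X \* P : R3 R -> R)%R.
  apply: (@test_function_compact _ _ (cube x0 r)) => //; first exact: smooth_mul.
    by apply: compact_setX; [apply: compact_setX|]; exact: segment_compact.
  by move=> x /X_cube /= ->; rewrite mul0r.
have mB : measurable_fun setT B.
  exact: (measurableT_comp (measurable_bump3 _ _ _ _ _ _ c0) (measurable_extract j)).
have mP : measurable_fun setT P.
  exact: (measurableT_comp (measurable_bump3_prim _ _ _ _ _ _ c0) (measurable_extract j)).
have B1 x : (`|B x| <= 1)%R.
  have /andP[u0 u1] := bump3_bounds a1 b1 a2 b2 a3 b3 (extract j x) c0.
  by rewrite ger0_norm.
have P1 x : (`|P x| <= `|b1 - a1|)%R.
  have b0 := @bump_ge0 R; have b1' a b s := @bump_le1 R c a b s c0.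
  have p0 := bump_prim_ge0 c a1 b1 (extract j x).1.
  have pl := bump_prim_le a1 b1 (extract j x).1 c0.
  rewrite /P /bump3_prim ger0_norm; last by apply: mulr_ge0 => //; apply: mulr_ge0.
  rewrite -[leRHS]mulr1; apply: ler_pM => //; first exact: mulr_ge0.
  by apply: mulr_ile1.
have I1 : (leb3 R).-integrable setT (EFin \o (fun x => V x * B x)%R).
  apply: (@integrable_slice j _ 1).
  - by apply: measurable_funM => //; apply: measurable_funM.
  - by move=> x xc; rewrite /V X_cube// !mul0r.
  - move=> x; rewrite [X in `|X|%R]mulrC.
    by have := norm_mul (B1 x) (norm_mul (norm_X x) (le1_sqr (U x) (G j x))); rewrite !mul1r.
have I2 : (leb3 R).-integrable setT (EFin \o (fun x => U x * (dX j x * P x))%R).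
  apply: (@integrable_slice j _ (M / r * `|b1 - a1|)%R).
  - by apply: measurable_funM => //; apply: measurable_funM.
  - by move=> x xc; rewrite dX_cube// !(mul0r, mulr0).
  - move=> x; rewrite [X in `|X|%R]mulrC.
    exact: (norm_mul (norm_mul (dX_le j x) (P1 x)) (le1_sqr (U x) (G j x))).
have I3 : (leb3 R).-integrable setT (EFin \o (fun x => G j x * (X x * P x))%R).
  apply: (@integrable_slice j _ `|b1 - a1|%R).
  - by apply: measurable_funM => //; apply: measurable_funM.
  - by move=> x xc; rewrite X_cube// !(mul0r, mulr0).
  - move=> x; rewrite [X in `|X|%R]mulrC.
    have := norm_mul (norm_mul (norm_X x) (P1 x)) (le1_sqr' (U x) (G j x)).
    by rewrite !mul1r.
have W := wg j tXP.
have E1 : \int[leb3 R]_x (U x * 'D_(basis3 j) (X \* P) x)%R%:E =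
    \int[leb3 R]_x (U x * (dX j x * P x))%:E + \int[leb3 R]_x (V x * B x)%:E.
  rewrite -integralD//; apply: eq_integral => x _; rewrite DXP -EFinD.
  by congr (_%:E); rewrite /V; ring.
have E2 : \int[leb3 R]_x (DV j x * P x)%:E =
    \int[leb3 R]_x (G j x * (X x * P x))%:E + \int[leb3 R]_x (U x * (dX j x * P x))%:E.
  rewrite -integralD//; apply: eq_integral => x _; rewrite -EFinD.
  by congr (_%:E); rewrite /DV; ring.
have f2 := integrable_fin_num measurableT I2.
have f3 := integrable_fin_num measurableT I3.
have f1 := integrable_fin_num measurableT I1.
rewrite E2; move: W; rewrite E1 => /(congr1 (fun y => y - \int[leb3 R]_x (U x * (dX j x * P x))%:E)).
rewrite addeAC subee// add0e => ->.
by rewrite oppeD// fin_num_adde_defl.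
Qed.

Let measurable_V : measurable_fun setT V.
Proof. exact: measurable_funM. Qed.

Lemma slice_pairing (h : mR3 R -> R) (nu sg k : R) :
  measurable_fun setT h -> (forall x, 0 <= h x)%R ->
  (0 < nu)%R -> (0 < sg)%R -> (0 < k)%R ->
  \int[leb3 R]_x (V x ^+ 2)%:E <= (nu ^+ 4)%:E ->
  (forall j, \int[leb3 R]_x (DV j x ^+ 2)%:E <= (sg ^+ 4)%:E) ->
  (forall a, (0 < a)%R -> (a ^+ 3)%:E * leb3 R [set x | (a < h x)%R] <= (k ^+ 3)%:E) ->
  \int[leb3 R]_x (h x ^+ 2 * `|V x|)%:E <= (slice_const * (k ^+ 2 * sg * nu))%:E.
Proof.
move=> mh h0 nu0 sg0 k0 hV hDV hk.
have W b : (0 < b)%R -> (b ^+ 6)%:E * leb3 R [set x | (b < `|V x|)%R] <=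
    (64 ^+ 4 * (sg ^+ 4) ^+ 3)%:E.
  (* The numbers [m j] are the right ends of the cube in the three directions. *)
  apply: (@weak_sobolev R V DV (nu ^+ 4) (sg ^+ 4) (fun j => (extract j x0).1 + 11 / 20 * r)%R) => //.
  - move=> j x jx; rewrite /DV; have xc : ~ cube x0 r x.
      move=> /cube_abs[]; rewrite !ler_norml => /andP[_ h1] /andP[_ h2] /andP[_ h3].
      by case: j jx => -[|[|[|//]]] jlt /=; lra.
    by rewrite X_cube// dX_cube// !mul0r addr0.
  - exact: exprn_gt0.
(* With [a = k sg^2 / nu^2] and [b = sg^3 / nu] the three terms of [weak_pairing] become multiples
   of the same product [k^2 sg nu]. *)
have := @weak_pairing _ _ _ (leb3 R) h (fun x => `|V x|)%R (k ^+ 3) (nu ^+ 4)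
  (64 ^+ 4 * (sg ^+ 4) ^+ 3) (k * sg ^+ 2 / nu ^+ 2) (sg ^+ 3 / nu).
have p0 n (y : R) : (0 < y)%R -> (0 <= y ^+ n)%R by move=> y0; rewrite exprn_ge0 ?ltW.
have mV' : measurable_fun setT (fun x => `|V x|)%R by exact: measurableT_comp.
move=> /(_ mh h0 mV' (fun x => normr_ge0 _) (p0 3%N k k0) (p0 4%N nu nu0)).
have W0 : (0 <= 64 ^+ 4 * (sg ^+ 4) ^+ 3 :> R)%R.
  by apply: mulr_ge0; apply: exprn_ge0 => //; exact: p0.
have a0 : (0 < k * sg ^+ 2 / nu ^+ 2)%R by rewrite divr_gt0 ?mulr_gt0 ?exprn_gt0.
have b0 : (0 < sg ^+ 3 / nu)%R by rewrite divr_gt0 ?exprn_gt0.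
move=> /(_ W0 hk (fun t t0 => chebyshev_sqr measurable_V t0 hV) W a0 b0).
congr (_ <= _%:E).
rewrite /slice_const; move: (64 ^+ 4)%R => A; field.
by rewrite (gt_eqF nu0) (gt_eqF sg0) (gt_eqF k0).
Qed.

Let DV_sqr_le j : \int[leb3 R]_x (DV j x ^+ 2)%:E <=
  2%:E * \int[leb3 R]_x ((X x * G j x) ^+ 2)%:E
  + (2 * (M / r) ^+ 2)%:E * \int[leb3 R]_(x in cube x0 r) (U x ^+ 2)%:E.
Proof.
have mcube := measurable_cube x0 r.
have C0 : (0 <= 2 * (M / r) ^+ 2)%R by rewrite mulr_ge0// sqr_ge0.
pose A (x : mR3 R) : R := ((X x * G j x) ^+ 2)%R.
pose B (x : mR3 R) : R := (U x ^+ 2 * \1_(cube x0 r) x)%R.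
have mA : measurable_fun setT A by apply: measurable_funX; exact: measurable_funM.
have mB : measurable_fun setT B.
  apply: measurable_funM; first exact: measurable_funX.
  exact: measurable_indic.
have A0 x : (0 <= A x)%R by exact: sqr_ge0.
have B0 x : (0 <= B x)%R by apply: mulr_ge0; [exact: sqr_ge0|].
have -> : \int[leb3 R]_(x in cube x0 r) (U x ^+ 2)%:E = \int[leb3 R]_x (B x)%:E.
  by rewrite integral_mkcond epatch_indic.
rewrite -[X in 2%:E * X]/(\int[leb3 R]_x (A x)%:E).
have Z (k : R) (F : mR3 R -> R) : (0 <= k)%R -> measurable_fun setT F ->
    (forall x, 0 <= F x)%R ->
    k%:E * \int[leb3 R]_x (F x)%:E = \int[leb3 R]_x (k%:E * (F x)%:E).
  move=> k0 mF F0; rewrite ge0_integralZl_EFin//.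
    by move=> x _; rewrite lee_fin.
  exact/measurable_EFinP.
have eA := Z 2%R A (ler0n _ _) mA A0; have eB := Z _ B C0 mB B0.
rewrite eA eB -ge0_integralD//.
- apply: ge0_le_integral => //.
  + by move=> x _; rewrite lee_fin sqr_ge0.
  + by apply/measurable_EFinP; exact: measurable_funX.
  + apply: emeasurable_funD; apply: emeasurable_funM => //; exact/measurable_EFinP.
  + move=> x _; rewrite -!EFinM -EFinD lee_fin /DV /A /B.
    have h1 (a b : R) : ((a + b) ^+ 2 <= 2 * a ^+ 2 + 2 * b ^+ 2)%R.
      by have := sqr_ge0 (a - b); rewrite sqrrB sqrrD; lra.
    apply: le_trans (h1 _ _) _; rewrite lerD2l.
    have [xc|xc] := pselect (cube x0 r x); last first.
      rewrite dX_cube// mul0r expr0n mulr0; apply: mulr_ge0 => //; exact: B0.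
    rewrite indicE mem_set// mulr1 exprMn mulrA; apply: ler_wpM2r; first exact: sqr_ge0.
    rewrite ler_pM2l//.
    rewrite -[leLHS]real_normK ?num_real//; apply: lerXn2r => //.
- by move=> x _; rewrite lee_fin; apply: mulr_ge0 => //; exact: A0.
- by apply: emeasurable_funM => //; exact/measurable_EFinP.
- by move=> x _; rewrite lee_fin; apply: mulr_ge0 => //; exact: B0.
- by apply: emeasurable_funM => //; exact/measurable_EFinP.
Qed.

Lemma slice_estimate (e c : R) (h : mR3 R -> R) (rho nu S kap : R) :
  (forall K s n : R, 0 < K -> 0 < s -> 0 < n ->
    slice_const * (K ^+ 2 * s * n) <= e * (s ^+ 4 + n ^+ 4) + c * (n * K ^+ 3))%R ->
  (r = rho ^+ 4)%R -> (0 < rho)%R -> (0 < nu)%R -> (0 < S)%R -> (0 < kap)%R ->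
  measurable_fun setT h -> (forall x, 0 <= h x)%R ->
  \int[leb3 R]_x (V x ^+ 2)%:E <= (nu ^+ 4)%:E ->
  (forall j, 2%:E * \int[leb3 R]_x ((X x * G j x) ^+ 2)%:E
    + (2 * (M / r) ^+ 2)%:E * \int[leb3 R]_(x in cube x0 r) (U x ^+ 2)%:E <= S%:E) ->
  (forall a, (0 < a)%R -> (a ^+ 3)%:E * leb3 R [set x | (a < h x)%R] <= kap%:E) ->
  \int[leb3 R]_x (h x ^+ 2 * `|V x|)%:E <=
    (r * (e * (S + nu ^+ 4 / r ^+ 2) + c * (nu / rho ^+ 5 * kap)))%:E.
Proof.
move=> hc rE rho0 nu0 S0 kap0 mh h0 hV hS hk.
have [sg sg0 sgE] := exists_root 3 S0; have [k k0 kE] := exists_root 2 kap0.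
have hDV j : \int[leb3 R]_x (DV j x ^+ 2)%:E <= (sg ^+ 4)%:E.
  by rewrite sgE; apply: le_trans (hS j); exact: DV_sqr_le.
have := slice_pairing mh h0 nu0 sg0 k0 hV hDV; rewrite kE => /(_ hk) /le_trans; apply.
rewrite lee_fin.
(* The weights restore scale invariance: [(nu / rho^2)^4 = nu^4 / r^2] scales like the squared
   gradient [sg^4], and the powers of [rho] in [K^2 s n] cancel the prefactor [r = rho^4]. *)
have := hc (k / rho)%R sg (nu / rho ^+ 2)%R (divr_gt0 k0 rho0) sg0
  (divr_gt0 nu0 (exprn_gt0 2 rho0)).
rewrite -(ler_pM2l r0) => /le_trans H.
have -> : (slice_const * (k ^+ 2 * sg * nu) =
    r * (slice_const * ((k / rho) ^+ 2 * sg * (nu / rho ^+ 2))))%R.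
  by rewrite rE; field; rewrite (gt_eqF rho0).
apply: H; rewrite le_eqVlt; apply/orP; left; apply/eqP.
by rewrite -sgE -kE rE; field; rewrite (gt_eqF rho0).
Qed.

End slice.

End slice_estimate.

(** * Integration in time *)

Section space_time.
Context {R : realType}.
Local Open Scope ereal_scope.
Local Notation leb := (@lebesgue_measure R).
Local Notation T1 := (measurableTypeR R).
Local Notation sleb3 := (sprod (sprod leb leb) leb).

(** The integral of a nonnegative function is a supremum over the simple functions below it, hence
    monotone for arbitrary nonnegative functions. It is applied to the integrands of [C_infty] and
    [D_infty], whose measurability in time is not established. *)
Lemma le_integral_ge0 d (T : measurableType d) (mu : {measure set T -> \bar R})
    (D : set T) (f g : T -> \bar R) :
  (forall x, D x -> 0 <= f x) -> (forall x, D x -> f x <= g x) ->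
  \int[mu]_(x in D) f x <= \int[mu]_(x in D) g x.
Proof.
move=> f0 fg; have g0 x : D x -> 0 <= g x by move=> Dx; exact: le_trans (f0 x Dx) (fg x Dx).
rewrite (ge0_integralE _ f0) (ge0_integralE _ g0).
apply: le_ereal_sup => _ [h hf <-]; exists h => // x.
apply: le_trans (hf x) _; rewrite /patch; case: ifP => // /set_mem; exact: fg.
Qed.

Lemma weak_Lnorm_distribution (p : R) (Om : set (R3 R)) (g : R3 R -> R) (b : R) :
  (0 < p)%R -> (0 < b)%R ->
  (b `^ p)%R%:E * leb3 R (Om `&` [set x | (b < `|g x|)%R]) <= weak_Lnorm p Om g `^ p.
Proof.
move=> p0 b0; set m := leb3 R _; have m0 : 0 <= m by exact: measure_ge0.
have e : (b `^ p)%R%:E * m = (b%:E * m `^ p^-1) `^ p.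
  rewrite poweRM ?poweR_ge0//; last by rewrite lee_fin ltW.
  by rewrite -poweRrM mulVf ?gt_eqF// poweRe1.
rewrite e; have h : b%:E * m `^ p^-1 <= weak_Lnorm p Om g.
  by apply: ereal_sup_ubound; exists b.
have h0 : 0 <= b%:E * m `^ p^-1 by rewrite mule_ge0 ?poweR_ge0// lee_fin ltW.
apply: gt0_ler_poweR => //; first exact: ltW.
  by rewrite in_itv/= h0 leey.
by rewrite in_itv/= (le_trans h0 h) leey.
Qed.

Lemma measurable_eball (x0 : R3 R) (r : R) : measurable (eball x0 r : set (mR3 R)).
Proof.
have m1 : measurable_fun setT (fun x : mR3 R => x.1.1).
  exact: (measurableT_comp measurable_fst measurable_fst).
have m2 : measurable_fun setT (fun x : mR3 R => x.1.2).
  exact: (measurableT_comp measurable_snd measurable_fst).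
have m3 : measurable_fun setT (fun x : mR3 R => x.2) by exact: measurable_snd.
have S (f : mR3 R -> R) (a : R) : measurable_fun setT f ->
    measurable_fun setT (fun x => (f x - a) ^+ 2)%R.
  by move=> mf; apply: measurable_funX; exact: measurable_funB.
have ms : measurable_fun setT (fun x : mR3 R => Defs.edist x x0).
  apply: (@measurableT_comp _ _ _ _ _ _ (@Num.sqrt R)).
    by apply: continuous_measurable_fun; exact: sqrt_continuous.
  by apply: measurable_funD; [apply: measurable_funD|]; exact: S.
rewrite (_ : eball x0 r = setT `&` [set x : mR3 R | (Defs.edist x x0 < r)%R]).
  by apply: measurable_fun_ltr => //; exact: measurable_cst.
by rewrite setTI.
Qed.

Lemma tonelli4 (A : set (mR3 R)) (I : set T1) (F : mR4 R -> \bar R) :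
  measurable A -> measurable I -> measurable_fun setT F -> (forall z, 0 <= F z) ->
  \int[leb4 R]_(z in A `*` I) F z =
  \int[leb]_(t in I) \int[leb3 R]_(x in A) F (x, t).
Proof.
move=> mA mI mF F0.
pose H (z : mR4 R) := F z * (\1_(A `*` I) z)%:E.
have mH : measurable_fun setT H.
  apply: emeasurable_funM; first exact: mF.
  apply/measurable_EFinP; apply: measurable_indic.
  exact: measurableX.
have H0 z : 0 <= H z by apply: mule_ge0; [exact: F0|rewrite lee_fin].
have := @fubini_tonelli2 _ _ _ _ R sleb3 leb H mH H0.
have -> : \int[sleb3 \x leb]_z H z = \int[leb4 R]_(z in A `*` I) F z.
  by rewrite [RHS]integral_mkcond epatch_indic.
move=> ->; rewrite [RHS]integral_mkcond; apply: eq_integral => t _.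
rewrite /fubini_G /H patchE; case: ifPn => tI.
  rewrite [RHS]integral_mkcond epatch_indic; apply: eq_integral => x _ /=.
  congr (_ * _%:E); rewrite !indicE; congr (_%:R); congr nat_of_bool.
  by apply/idP/idP; rewrite !inE; [move=> []|move=> xA; split => //=; exact: set_mem].
rewrite integral0_eq// => x _; rewrite indicE memNset ?mule0//= => -[_ /= /mem_set].
by apply/negP.
Qed.

Lemma measurable_slice_integral (A : set (mR3 R)) (F : mR4 R -> \bar R) :
  measurable A -> measurable_fun setT F -> (forall z, 0 <= F z) ->
  measurable_fun (setT : set T1) (fun t => \int[leb3 R]_(x in A) F (x, t)).
Proof.
move=> mA mF F0.
pose H (z : mR4 R) := F z * (\1_(A `*` setT) z)%:E.
have mH : measurable_fun setT H.
  apply: emeasurable_funM; first exact: mF.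
  apply/measurable_EFinP; apply: measurable_indic.
  exact: measurableX.
have H0 z : 0 <= H z by apply: mule_ge0; [exact: F0|rewrite lee_fin].
have := @measurable_fun_fubini_tonelli_G _ _ _ _ R sleb3 H mH H0.
congr (measurable_fun _ _); apply/funext => t.
rewrite [RHS]integral_mkcond epatch_indic; apply: eq_integral => x _ /=.
congr (_ * _%:E); rewrite !indicE; congr (_%:R); congr nat_of_bool.
by apply/idP/idP; rewrite !inE; [move=> []|].
Qed.

(** Codes of no rational are sent to 0, which the positivity test in [sup_distribution] discards. *)
Definition nth_rat (n : nat) : R :=
  if unpickle n : option rat is Some q then ratr q else 0%R.

(** The cube of the weak L^3 norm of [h (., t)], computed on positive rational levels only: a
    countable supremum is measurable in [t]. *)
Definition sup_distribution (h : mR4 R -> R) (t : R) : \bar R :=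
  esups (fun n => if (0 < nth_rat n)%R
    then (nth_rat n ^+ 3)%:E * leb3 R [set x | (nth_rat n < h (x, t))%R] else 0) 0%N.

Lemma measurable_sup_distribution (h : mR4 R -> R) : measurable_fun setT h ->
  measurable_fun (setT : set T1) (sup_distribution h).
Proof.
move=> mh; apply: measurable_fun_esups => n; move: (nth_rat n) => q.
case: (ltP 0%R q) => q0; last exact: measurable_cst.
apply: emeasurable_funM; first exact: measurable_cst.
have mE : measurable [set z : mR4 R | (q < h z)%R] by exact: measurable_superlevel.
have := measurable_fun_ysection sleb3 mE.
congr (measurable_fun _ _); apply/funext => t /=; congr (leb3 R _).
by apply/seteqP; split => x /=; rewrite /ysection /= inE.
Qed.

Lemma sup_distribution_ge0 h t : 0 <= sup_distribution h t.
Proof.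
pose u n : \bar R := if (0 < nth_rat n)%R
    then (nth_rat n ^+ 3)%:E * leb3 R [set x | (nth_rat n < h (x, t))%R] else 0.
apply: (@le_trans _ _ (u 0%N)); last by apply: ereal_sup_ubound; exists 0%N.
rewrite /u; case: ifP => // q0; rewrite mule_ge0// lee_fin exprn_ge0//; exact: ltW.
Qed.

Lemma sup_distribution_rat h t (q : rat) : (0 < ratr q :> R)%R ->
  ((ratr q : R) ^+ 3)%:E * leb3 R [set x | (ratr q < h (x, t))%R] <= sup_distribution h t.
Proof.
move=> q0; apply: ereal_sup_ubound; exists (pickle q) => //=.
by rewrite /nth_rat pickleK q0.
Qed.

(** For a rational [q < a] the set [{h > a}] is contained in [{h > q}], so [q^3 |{h > a}|] is at
    most the supremum; rationals approach [a] from below. *)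
Lemma sup_distribution_ub h t (a : R) : measurable_fun setT h -> (0 < a)%R ->
  (a ^+ 3)%:E * leb3 R [set x | (a < h (x, t))%R] <= sup_distribution h t.
Proof.
move=> mh a0; set S := sup_distribution h t; set m := leb3 R _.
have mS b : measurable [set x : mR3 R | (b < h (x, t))%R].
  apply: measurable_superlevel.
  exact: (measurableT_comp mh (@pair2_measurable _ _ _ _ t)).
have S0 : 0 <= S by exact: sup_distribution_ge0.
have qS (y : R) : (0 <= y < a)%R -> exists2 q : R, (y < q < a)%R & (q ^+ 3)%:E * m <= S.
  move=> /andP[y0 ya]; have [q /[!in_itv]/= /andP[yq qa]] := rat_in_itvoo ya.
  have q0 : (0 < ratr q :> R)%R by exact: le_lt_trans yq.
  exists (ratr q); first by rewrite yq.
  apply: le_trans (sup_distribution_rat h t q0).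
  apply: lee_wpmul2l; first by rewrite lee_fin exprn_ge0// ltW.
  by apply: le_measure; rewrite ?inE// => x /=; exact: lt_trans.
have m0 : 0 <= m by exact: measure_ge0.
case ES : S => [s| |]; [|by rewrite leey|by move: S0; rewrite ES].
case Em : m => [n| |]; [| |by move: m0; rewrite Em].
  rewrite -EFinM lee_fin leNgt; apply/negP => san.
  rewrite ES lee_fin in S0; rewrite Em lee_fin in m0.
  have n0 : (0 < n)%R.
    by rewrite lt_neqAle m0 andbT; apply/eqP => n0; move: san; rewrite -n0 mulr0 ltNge S0.
  (* If [a^3 n] exceeded the supremum [s], the cube root [y] of [s / n] would be below [a], and a
     rational between [y] and [a] would violate the bound. *)
  have [y y0 [ya yE]] : exists2 y : R, (0 <= y)%R & (y < a /\ s <= y ^+ 3 * n)%R.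
    have [s0|s0] := eqVneq s 0%R; first by exists 0%R => //; rewrite s0 expr0n/= mul0r.
    have sn : (0 < s / n)%R by rewrite divr_gt0// lt_neqAle eq_sym s0.
    have [y y0 yE] := exists_root 2 sn; exists y; first exact: ltW.
    rewrite yE divfK ?gt_eqF//; split => //; rewrite ltNge; apply/negP => ay.
    have : (a ^+ 3 <= y ^+ 3)%R by apply: lerXn2r => //; rewrite nnegrE ltW.
    by rewrite yE ler_pdivlMr// leNgt san.
  have [q /andP[yq qa]] := qS y (introT andP (conj y0 ya)).
  rewrite Em ES -EFinM lee_fin leNgt => /negP; apply; apply: (le_lt_trans yE).
  by rewrite ltr_pM2r// ltrXn2r// nnegrE ltW// (le_lt_trans y0).
have [q /andP[q0 _]] := qS 0%R (introT andP (conj (lexx _) a0)).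
by rewrite Em ES gt0_muley ?lte_fin ?exprn_gt0.
Qed.

Lemma sup_distribution_le h t (k : \bar R) : 0 <= k ->
  (forall a, (0 < a)%R -> (a ^+ 3)%:E * leb3 R [set x | (a < h (x, t))%R] <= k) ->
  sup_distribution h t <= k.
Proof.
move=> k0 hk; apply: ub_ereal_sup => _ [n _ <-] /=.
by case: ifP => // q0; exact: hk.
Qed.

End space_time.

(** * The local energy inequality with the cut-off inserted *)

Section energy.
Context {R : realType}.
Local Open Scope ereal_scope.
Local Notation leb := (@lebesgue_measure R).
Local Notation T1 := (measurableTypeR R).

Variables (x0 : R3 R) (t0 : R) (u : R4 R -> 'rV[R]_3) (p : R4 R -> R)
  (Du : R4 R -> 'M[R]_3).
Hypothesis sol : suitable_weak_solution (x0, t0) u p Du.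

Local Notation Om := (eball x0 1).
Local Notation T := (time_itv t0 1).

(** The solution is measurable on the cylinder only; extension by zero gives functions on the whole
    space, to which the results of the preceding sections apply. *)
Definition velocity i (z : mR4 R) : R :=
  patch (fun=> 0%R) (pcyl (x0, t0) 1) (fun z => u z 0%R i) z.

Definition gradient i j (z : mR4 R) : R :=
  patch (fun=> 0%R) (pcyl (x0, t0) 1) (fun z => Du z i j) z.

Definition pressure (z : mR4 R) : R := patch (fun=> 0%R) (pcyl (x0, t0) 1) p z.

Definition speed2 (z : mR4 R) : R := (\sum_(i < 3) velocity i z ^+ 2)%R.

Definition gradient2 (z : mR4 R) : R :=
  (\sum_(i < 3) \sum_(j < 3) gradient i j z ^+ 2)%R.

Lemma measurable_pcyl r : measurable (pcyl (x0, t0) r : set (mR4 R)).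
Proof. by apply: measurableX; [exact: measurable_eball|exact: measurable_itv]. Qed.

Let measurable_patch (f : R4 R -> R) : measurable_on (pcyl (x0, t0) 1) f ->
  measurable_fun setT (patch (fun=> 0%R) (pcyl (x0, t0) 1) f : mR4 R -> R).
Proof. by move=> mf; apply/(measurable_restrictT f (measurable_pcyl 1)). Qed.

Lemma measurable_velocity i : measurable_fun setT (velocity i).
Proof. exact: measurable_patch (sws_measurable_u sol i). Qed.

Lemma measurable_gradient i j : measurable_fun setT (gradient i j).
Proof. exact: measurable_patch (sws_measurable_Du sol i j). Qed.

Lemma measurable_pressure : measurable_fun setT pressure.
Proof. exact: measurable_patch (sws_measurable_p sol). Qed.

Lemma measurable_speed2 : measurable_fun setT speed2.
Proof.
apply: measurable_sum => i; apply: measurable_funX; exact: measurable_velocity.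
Qed.

Lemma measurable_gradient2 : measurable_fun setT gradient2.
Proof.
apply: measurable_sum => i; apply: measurable_sum => j.
apply: measurable_funX; exact: measurable_gradient.
Qed.

Lemma speed2E z : pcyl (x0, t0) 1 z -> speed2 z = sqnorm (u z).
Proof.
by move=> zQ; apply: eq_bigr => i _; rewrite /velocity /patch mem_set.
Qed.

Lemma speed2_out z : ~ pcyl (x0, t0) 1 z -> speed2 z = 0%R.
Proof.
by move=> zQ; apply: big1 => i _; rewrite /velocity /patch memNset// expr0n.
Qed.

Lemma gradient2E z : pcyl (x0, t0) 1 z -> gradient2 z = mx_sqnorm (Du z).
Proof.
move=> zQ; apply: eq_bigr => i _; apply: eq_bigr => j _.
by rewrite /gradient /patch mem_set.
Qed.

Lemma gradient2_out z : ~ pcyl (x0, t0) 1 z -> gradient2 z = 0%R.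
Proof.
move=> zQ; apply: big1 => i _; apply: big1 => j _.
by rewrite /gradient /patch memNset// expr0n.
Qed.

Lemma speed2_ge0 z : (0 <= speed2 z)%R.
Proof. by apply: sumr_ge0 => i _; exact: sqr_ge0. Qed.

Lemma gradient2_ge0 z : (0 <= gradient2 z)%R.
Proof. by do 2! (apply: sumr_ge0 => ? _); exact: sqr_ge0. Qed.

Lemma velocity_le i z : (velocity i z ^+ 2 <= speed2 z)%R.
Proof.
rewrite /speed2 (bigD1 i)//= lerDl; apply: sumr_ge0 => k _; exact: sqr_ge0.
Qed.

Lemma gradient_le i j z : (gradient i j z ^+ 2 <= gradient2 z)%R.
Proof.
rewrite /gradient2 (bigD1 i)//= (bigD1 j)//= -addrA lerDl addr_ge0//.
  by apply: sumr_ge0 => k _; exact: sqr_ge0.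
by do 2! (apply: sumr_ge0 => ? _); exact: sqr_ge0.
Qed.

Lemma integral_speed2 t : T t ->
  \int[leb3 R]_(x in Om) (sqnorm (u (x, t)))%:E = \int[leb3 R]_x (speed2 (x, t))%:E.
Proof.
move=> tT; rewrite integral_mkcond; apply: eq_integral => x _; rewrite patchE.
case: ifPn => [/set_mem xO|/negP xO]; first by rewrite speed2E.
by rewrite speed2_out// => -[/= /mem_set].
Qed.

Lemma slices_finite : \forall t \ae leb, T t ->
  \int[leb3 R]_x (speed2 (x, t))%:E < +oo /\
  \int[leb3 R]_x (gradient2 (x, t))%:E < +oo.
Proof.
pose F (z : mR4 R) := (speed2 z + gradient2 z)%:E.
have F0 z : 0 <= F z by rewrite lee_fin addr_ge0 ?speed2_ge0 ?gradient2_ge0.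
have mF : measurable_fun setT F.
  apply/measurable_EFinP; apply: measurable_funD; first exact: measurable_speed2.
  exact: measurable_gradient2.
have mT : measurable (T : set T1) by exact: measurable_itv.
have := sws_u_L2_W12 sol.
have -> : \int[leb4 R]_(z in pcyl (x0, t0) 1) (sqnorm (u z) + mx_sqnorm (Du z))%:E =
    \int[leb4 R]_(z in pcyl (x0, t0) 1) F z.
  by apply: eq_integral => z /set_mem zQ; rewrite /F speed2E// gradient2E.
rewrite (tonelli4 (measurable_eball x0 1) mT mF F0) => fin.
have mI : measurable_fun T (fun t => \int[leb3 R]_(x in Om) F (x, t)).
  apply: measurable_funTS; exact: (measurable_slice_integral (measurable_eball x0 1) mF F0).
have I : leb.-integrable T (fun t => \int[leb3 R]_(x in Om) F (x, t)).
  apply/integrableP; split => //; apply: le_lt_trans fin.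
  by apply: le_integral_ge0 => t _ //; rewrite gee0_abs// integral_ge0.
have := integrable_ae mT I; apply: filterS => t /[apply] tfin.
have E0 : \int[leb3 R]_(x in Om) F (x, t) = \int[leb3 R]_x F (x, t).
  rewrite integral_mkcond; apply: eq_integral => x _; rewrite patchE.
  case: ifPn => // /negP xO; have nQ : ~ pcyl (x0, t0) 1 (x, t) by move=> [/= /mem_set].
  by rewrite /F speed2_out// gradient2_out// addr0.
have lt : \int[leb3 R]_x F (x, t) < +oo by rewrite -E0 -ge0_fin_numE// integral_ge0.
by split; apply: le_lt_trans lt; apply: le_integral_ge0 => x _; rewrite lee_fin
  ?speed2_ge0 ?gradient2_ge0 ?lerDl ?lerDr ?speed2_ge0 ?gradient2_ge0.
Qed.

Lemma slice_weak_gradient : \forall t \ae leb, T t ->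
  forall i j (psi : R3 R -> R), test_function Om psi ->
  \int[leb3 R]_x (velocity i (x, t) * 'D_(basis3 j) psi x)%R%:E =
  - \int[leb3 R]_x (gradient i j (x, t) * psi x)%:E.
Proof.
have := sws_weak_gradient sol; apply: (@filterS _ _ (ae_filter_ringOfSetsType leb)) => t wt tT i j psi tpsi.
have W := wt tT i j psi tpsi.
have E1 : \int[leb3 R]_x (velocity i (x, t) * 'D_(basis3 j) psi x)%R%:E =
    \int[leb3 R]_(x in Om) (u (x, t) 0 i * 'D_(basis3 j) psi x)%R%:E.
  rewrite [RHS]integral_mkcond; apply: eq_integral => x _; rewrite patchE.
  case: ifPn => [/set_mem xO|/negP xO]; first by rewrite /velocity /patch mem_set.
  by rewrite /velocity /patch memNset ?mul0r// => -[/= /mem_set].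
rewrite E1 W; congr (- _); rewrite integral_mkcond; apply: eq_integral => x _.
rewrite patchE.
case: ifPn => [/set_mem xO|/negP xO]; first by rewrite /gradient /patch mem_set.
by rewrite /gradient /patch memNset ?mul0r// => -[/= /mem_set].
Qed.

Section cutoff_energy.
Variables (r M : R).
Hypothesis r0 : (0 < r)%R.
Hypothesis r1 : (r < 1)%R.
Hypothesis M1 : (1 <= M)%R.
Hypothesis HM : cut_derivatives_le M.

Local Notation zt := (zeta x0 t0 r).

(** This and [root_pressure] are the two choices of [h], whose squares are [|u|^2] and [|p|] on the
    cube. The indicator places their superlevel sets inside the ball where the weak norms are
    taken. *)
Definition root_speed (z : mR4 R) : R := (Num.sqrt (speed2 z) * \1_(cube x0 r) z.1)%R.

Definition root_pressure (z : mR4 R) : R :=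
  (Num.sqrt `|pressure z| * \1_(cube x0 r) z.1)%R.

Definition cut_energy (t : R) : \bar R :=
  \int[leb3 R]_x (zt (x, t) ^+ 2 * speed2 (x, t))%:E.

Definition dissipation (t : R) : \bar R :=
  \int[leb3 R]_x (zt (x, t) ^+ 2 * gradient2 (x, t))%:E.

(** A nonnegative majorant of the right side of the local energy inequality: [4 M / r^2] adds
    [M / r^2] for the time derivative and [3 M / r^2] for the Laplacian, and [2 M / r] comes from
    the gradient of [zeta^2]. *)
Definition flux (z : mR4 R) : R :=
  (4 * M / r ^+ 2 * root_speed z ^+ 2 +
   2 * M / r * \sum_(j < 3) (root_speed z ^+ 2 * `|zt z * velocity j z| +
     2 * (root_pressure z ^+ 2 * `|zt z * velocity j z|)))%R.

Lemma measurable_tens4 (h1 h2 h3 h4 : R -> R) : smooth (h1 : R^o -> R) ->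
  smooth (h2 : R^o -> R) -> smooth (h3 : R^o -> R) -> smooth (h4 : R^o -> R) ->
  measurable_fun (setT : set (mR4 R)) (tens4 h1 h2 h3 h4).
Proof.
move=> /measurable_smooth1 m1 /measurable_smooth1 m2 /measurable_smooth1 m3
  /measurable_smooth1 m4.
have f : measurable_fun setT (fun z : mR4 R => z.1) by exact: measurable_fst.
have f1 : measurable_fun setT (fun z : mR4 R => z.1.1).
  exact: (measurableT_comp measurable_fst f).
apply: measurable_funM; first exact: (measurableT_comp m1 (measurableT_comp measurable_fst f1)).
apply: measurable_funM; first exact: (measurableT_comp m2 (measurableT_comp measurable_snd f1)).
apply: measurable_funM; first exact: (measurableT_comp m3 (measurableT_comp measurable_snd f)).
exact: (measurableT_comp m4 measurable_snd).
Qed.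

Lemma measurable_zeta : measurable_fun (setT : set (mR4 R)) zt.
Proof. by apply: measurable_tens4; apply: smooth_scaled; exact: smooth_cut. Qed.

Let measurable_zeta2 : measurable_fun (setT : set (mR4 R)) (zeta2 x0 t0 r).
Proof. by apply: measurable_tens4; apply: smooth_scaled; exact: smooth_cut2. Qed.

Let measurable_dtime : measurable_fun (setT : set (mR4 R)) (dtime (zeta2 x0 t0 r)).
Proof.
have S a d := smooth_scaled a d (@smooth_cut2 R).
rewrite /zeta2 (dtime_tens4 (S _ _) (S _ _) (S _ _) (S _ _)).
by apply: measurable_tens4 => //; exact: (smooth_derive (1 : R^o)).
Qed.

Let measurable_dspace j : measurable_fun (setT : set (mR4 R)) (dspace j (zeta2 x0 t0 r)).
Proof.
have S a d := smooth_scaled a d (@smooth_cut2 R).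
rewrite /zeta2 (dspace_tens4 (S _ _) (S _ _) (S _ _) (S _ _)).
by apply: measurable_tens4 => //; case: ifP => _ //; exact: (smooth_derive (1 : R^o)).
Qed.

Let measurable_laplacian : measurable_fun (setT : set (mR4 R)) (laplacian (zeta2 x0 t0 r)).
Proof.
have S a d := smooth_scaled a d (@smooth_cut2 R).
have S' a d := smooth_derive (1 : R^o) (S a d).
apply: measurable_sum => j.
rewrite /zeta2 (dspace_tens4 (S _ _) (S _ _) (S _ _) (S _ _)).
rewrite dspace_tens4; [|by case: ifP => _; [exact: S'|exact: S] ..|exact: S].
have D (b : bool) (h : R -> R) : smooth (h : R^o -> R) ->
    smooth ((if b then 'D_1 (h : R^o -> R) else h)%R : R^o -> R).
  by case: b => // sh; exact: (smooth_derive (1 : R^o)).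
by apply: measurable_tens4; [exact: D (D _ _ (S _ _)) ..|exact: S].
Qed.

Let measurable_cube1 : measurable_fun setT (fun z : mR4 R => \1_(cube x0 r) z.1 : R).
Proof.
apply: (@measurableT_comp _ _ _ _ _ _ (\1_(cube x0 r) : mR3 R -> R)); last exact: measurable_fst.
by apply: measurable_indic; exact: measurable_cube.
Qed.

Let measurable_sqrt (f : mR4 R -> R) : measurable_fun setT f ->
  measurable_fun setT (fun z => Num.sqrt (f z)).
Proof.
apply: measurableT_comp; apply: continuous_measurable_fun; exact: sqrt_continuous.
Qed.

Lemma measurable_root_speed : measurable_fun setT root_speed.
Proof. by apply: measurable_funM => //; apply: measurable_sqrt; exact: measurable_speed2. Qed.

Lemma measurable_root_pressure : measurable_fun setT root_pressure.
Proof.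
apply: measurable_funM => //; apply: measurable_sqrt; apply: measurableT_comp => //.
exact: measurable_pressure.
Qed.

Lemma root_speed_ge0 z : (0 <= root_speed z)%R.
Proof. by rewrite mulr_ge0// sqrtr_ge0. Qed.

Lemma root_pressure_ge0 z : (0 <= root_pressure z)%R.
Proof. by rewrite mulr_ge0// sqrtr_ge0. Qed.

Let measurable_zv j : measurable_fun setT (fun z : mR4 R => `|zt z * velocity j z|)%R.
Proof.
apply: measurableT_comp => //; apply: measurable_funM; first exact: measurable_zeta.
exact: measurable_velocity.
Qed.

Lemma measurable_flux : measurable_fun setT flux.
Proof.
have ms := measurable_funX 2 measurable_root_speed.
have mp := measurable_funX 2 measurable_root_pressure.
apply: measurable_funD; first by apply: measurable_funM => //.
apply: measurable_funM => //; apply: measurable_sum => j.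
apply: measurable_funD; first by apply: measurable_funM => //; exact: measurable_zv.
by apply: measurable_funM => //; apply: measurable_funM => //; exact: measurable_zv.
Qed.

Lemma flux_ge0 z : (0 <= flux z)%R.
Proof.
have M0 : (0 <= M)%R := le_trans ler01 M1.
rewrite /flux addr_ge0//.
  by rewrite mulr_ge0 ?sqr_ge0// divr_ge0 ?mulr_ge0 ?exprn_ge0// ltW.
rewrite mulr_ge0//; first by rewrite divr_ge0 ?mulr_ge0// ltW.
apply: sumr_ge0 => j _; rewrite addr_ge0//; first by rewrite mulr_ge0 ?sqr_ge0.
by rewrite !mulr_ge0 ?sqr_ge0.
Qed.

Let flux_bound (n : nat) (w d : 'I_n -> R) (A B a b q c k : R) :
  (0 <= c)%R -> (`|a| <= A)%R -> (`|b| <= B)%R -> (forall j, `|d j| <= k * c)%R ->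
  (0 <= k)%R ->
  (`|(\sum_j w j ^+ 2) * (a + b) + (\sum_j w j * d j) * (\sum_j w j ^+ 2 + 2 * q)| <=
   (A + B) * \sum_j w j ^+ 2 +
   k * \sum_j ((\sum_j w j ^+ 2) * `|c * w j| + 2 * (`|q| * `|c * w j|)))%R.
Proof.
move=> c0 aA bB dk k0; set s := (\sum_j w j ^+ 2)%R.
have s0 : (0 <= s)%R by apply: sumr_ge0 => j _; exact: sqr_ge0.
apply: le_trans (ler_normD _ _) _; apply: lerD.
  rewrite normrM (ger0_norm s0) mulrC; apply: ler_wpM2r => //.
  by apply: le_trans (ler_normD _ _) _; exact: lerD.
have sq : (`|s + 2 * q| <= s + 2 * `|q|)%R.
  by apply: le_trans (ler_normD _ _) _; rewrite (ger0_norm s0) normrM ger0_norm.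
rewrite normrM; apply: (@le_trans _ _ ((\sum_j k * `|c * w j|) * (s + 2 * `|q|))%R).
  apply: ler_pM => //; apply: le_trans (ler_norm_sum _ _ _) _.
  apply: ler_sum => j _; rewrite !normrM mulrCA (ger0_norm c0) mulrC.
  by rewrite [leRHS]mulrCA [leRHS]mulrA; apply: ler_wpM2r.
rewrite mulr_suml mulr_sumr; apply: ler_sum => j _; rewrite le_eqVlt; apply/orP; left.
by apply/eqP; ring.
Qed.

(** The right side no longer depends on [t]: the integrand is replaced by its majorant, and before
    time [t0] the cut-off lives in []t0 - r^2, t0[], over which the majorant is integrated. *)
Lemma local_energy : \forall t \ae leb, T t ->
  cut_energy t + 2%:E * \int[leb]_(s in `](t0 - 1)%R, t[) dissipation s <=
  \int[leb]_(s in time_itv t0 r) \int[leb3 R]_x (flux (x, s))%:E.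
Proof.
have := sws_local_energy sol; apply: (@filterS _ _ (ae_filter_ringOfSetsType leb)) => t et tT.
have tphi : test_function setT (zeta2 x0 t0 r).
  by have [s1 s2 _] := test_function_zeta2 x0 t0 r0; split.
have phi0 z : (0 <= zeta2 x0 t0 r z)%R by rewrite zeta2E sqr_ge0.
have := et tT _ tphi phi0 (@zeta2_pboundary R x0 t0 r r0 r1).
have tt0 : (t < t0)%R by move: tT; rewrite /time_itv /= in_itv/= => /andP[].
have sQ x s : Om x -> (t0 - 1 < s < t)%R -> pcyl (x0, t0) 1 (x, s).
  move=> xO /andP[s1 s2]; split => //=; rewrite /time_itv /= in_itv/= expr1n s1/=; exact: lt_trans tt0.
have -> : \int[leb3 R]_(x in Om) (zeta2 x0 t0 r (x, t) * sqnorm (u (x, t)))%:E = cut_energy t.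
  rewrite integral_mkcond; apply: eq_integral => x _; rewrite patchE zeta2E.
  case: ifPn => [/set_mem xO|/negP xO]; first by rewrite speed2E.
  by rewrite speed2_out ?mulr0// => -[/= /mem_set].
have mI : measurable (`](t0 - 1)%R, t[%classic : set T1) by exact: measurable_itv.
have zsq2 f : measurable_fun setT f -> measurable_fun setT (fun z : mR4 R => (zt z ^+ 2 * f z)%:E).
  move=> mf; apply/measurable_EFinP; apply: measurable_funM => //.
  by apply: measurable_funX; exact: measurable_zeta.
have -> : \int[leb4 R]_(z in Om `*` `](t0 - 1)%R, t[%classic)
      (zeta2 x0 t0 r z * mx_sqnorm (Du z))%:E =
    \int[leb]_(s in `](t0 - 1)%R, t[) dissipation s.
  rewrite -(@tonelli4 _ setT _ (fun z => (zt z ^+ 2 * gradient2 z)%:E) measurableT mI).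
  - rewrite [LHS]integral_mkcond [RHS]integral_mkcond; apply: eq_integral => -[x s] _.
    rewrite !patchE zeta2E; case: ifPn => [/set_mem[/= xO sI]|/negP nz].
      rewrite in_itv/= in sI; rewrite (gradient2E (sQ _ _ xO sI)) ifT//.
      by apply/mem_set; split => //=; rewrite in_itv.
    case: ifPn => // /set_mem[/= _ sI]; rewrite gradient2_out ?mulr0// => -[/= xO _].
    by apply: nz; apply/mem_set; split.
  - exact: zsq2 measurable_gradient2.
  - by move=> z; rewrite lee_fin mulr_ge0 ?sqr_ge0 ?gradient2_ge0.
move=> /le_trans; apply.
pose f (z : mR4 R) : R := (speed2 z * (dtime (zeta2 x0 t0 r) z + laplacian (zeta2 x0 t0 r) z)
  + (\sum_(j < 3) velocity j z * dspace j (zeta2 x0 t0 r) z) * (speed2 z + 2 * pressure z))%R.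
have mf : measurable_fun setT f.
  apply: measurable_funD; apply: measurable_funM; first exact: measurable_speed2.
  - by apply: measurable_funD; [exact: measurable_dtime|exact: measurable_laplacian].
  - apply: measurable_sum => j.
    by apply: measurable_funM; [exact: measurable_velocity|exact: measurable_dspace].
  - apply: measurable_funD; first exact: measurable_speed2.
    by apply: measurable_funM; [exact: measurable_cst|exact: measurable_pressure].
have mD : measurable (Om `*` `](t0 - 1)%R, t[%classic : set (mR4 R)).
  by apply: measurableX => //; exact: measurable_eball.
rewrite (eq_integral (fun z => (f z)%:E)); last first.
  move=> [x s] /set_mem[/= xO sI]; rewrite in_itv/= in sI.
  have zQ := sQ _ _ xO sI; rewrite /f speed2E//; congr (_ + _ * (_ + _ * _))%:E.
    by apply: eq_bigr => j _; rewrite /velocity /patch mem_set.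
  by rewrite /pressure /patch mem_set.
apply: (le_trans (lee_abs _)).
have := @le_abse_integral _ _ _ (leb4 R) _ (fun z => (f z)%:E) mD.
have mfD : measurable_fun (Om `*` `](t0 - 1)%R, t[%classic : set (mR4 R)) (fun z => (f z)%:E).
  by apply/measurable_EFinP; exact: measurable_funTS.
move=> /(_ mfD) /le_trans; apply.
have mTr : measurable (time_itv t0 r : set T1) by exact: measurable_itv.
rewrite -(@tonelli4 _ setT _ (fun z => (flux z)%:E) measurableT mTr); first last.
- by move=> z; rewrite lee_fin flux_ge0.
- by apply/measurable_EFinP; exact: measurable_flux.
rewrite [leLHS]integral_mkcond [leRHS]integral_mkcond.
apply: le_integral_ge0 => z _; first by rewrite patchE; case: ifP.
have fl0 : 0 <= ((fun z => (flux z)%:E) \_ (setT `*` time_itv t0 r)) z.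
  by rewrite patchE; case: ifP => // _; rewrite lee_fin flux_ge0.
rewrite patchE; case: ifPn => // /set_mem[/= zO zI].
have tz := test_function_zeta2 x0 t0 r0.
have [zc|zc] := pselect (cylinder x0 t0 r z); last first.
  have e1 : dtime (zeta2 x0 t0 r) z = 0%R.
    exact: test_function_eq0 (test_function_derive _ tz) zc.
  have e2 j : dspace j (zeta2 x0 t0 r) z = 0%R.
    exact: test_function_eq0 (test_function_derive _ tz) zc.
  have e3 : laplacian (zeta2 x0 t0 r) z = 0%R.
    apply: big1 => j _.
    exact: test_function_eq0 (test_function_derive _ (test_function_derive _ tz)) zc.
  have -> : f z = 0%R.
    rewrite /f e1 e3 addr0 mulr0 add0r big1 ?mul0r// => j _; rewrite e2 mulr0//.
  by rewrite normr0.
have zr : time_itv t0 r z.2.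
  move: zI zc => /=; rewrite /cylinder /time_itv !in_itv/= => /andP[s1 s2] [_ /=].
  rewrite in_itv/= => /andP[s3 _]; rewrite in_itv/= (lt_trans s2 tt0) andbT.
  apply: lt_le_trans s3; rewrite ltrD2l ltrN2 gtr_pMl ?exprn_gt0//; lra.
rewrite patchE mem_set//= lee_fin.
have zcube : cube x0 r z.1 by case: zc.
have := @flux_bound 3 (fun j => velocity j z) (fun j => dspace j (zeta2 x0 t0 r) z)
  (M / r ^+ 2) (3 * (M / r ^+ 2)) (dtime (zeta2 x0 t0 r) z) (laplacian (zeta2 x0 t0 r) z)
  (pressure z) (zt z) (2 * (M / r)) (zeta_ge0 _ _ _ _) (dtime_zeta2_le _ _ r0 HM _)
  (laplacian_zeta2_le _ _ r0 HM _) (fun j => dspace_zeta2_le _ _ r0 HM _ _).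
have k0 : (0 <= 2 * (M / r))%R.
  by rewrite mulr_ge0// divr_ge0// ?(le_trans ler01 M1)// ltW.
move=> /(_ k0) /le_trans; apply.
rewrite /flux /root_speed /root_pressure indicE mem_set// !mulr1.
rewrite !sqr_sqrtr ?normr_ge0 ?speed2_ge0// le_eqVlt; apply/orP; left; apply/eqP.
rewrite /speed2; congr (_ + _)%R; first by ring.
by rewrite !mulrA.
Qed.

End cutoff_energy.

End energy.

(** * Bound on the flux at a fixed time *)

Section flux_estimate.
Context {R : realType}.
Local Open Scope ereal_scope.
Local Notation leb := (@lebesgue_measure R).
Local Notation T1 := (measurableTypeR R).

Lemma le_EFin_affine (X : \bar R) (a b k : R) : (0 <= b)%R ->
  (forall d, (0 < d)%R -> X <= (a + b * (k + d))%:E) -> X <= (a + b * k)%:E.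
Proof.
rewrite le_eqVlt => /orP[/eqP<- H|b0 H]; first by have := H _ ltr01; rewrite !mul0r.
apply/lee_addgt0Pr => d d0; have := H _ (divr_gt0 d0 b0).
by rewrite mulrDr mulrCA divff ?gt_eqF// mulr1 addrA EFinD.
Qed.

Variables (x0 : R3 R) (t0 : R) (u : R4 R -> 'rV[R]_3) (p : R4 R -> R)
  (Du : R4 R -> 'M[R]_3).
Hypothesis sol : suitable_weak_solution (x0, t0) u p Du.
Variables (r M : R).
Hypothesis r0 : (0 < r)%R.
Hypothesis r1 : (r < 1)%R.
Hypothesis M1 : (1 <= M)%R.
Hypothesis HM : cut_derivatives_le M.

Local Notation Om := (eball x0 1).
Local Notation zt := (zeta x0 t0 r).
Local Notation hu := (root_speed x0 t0 u r).
Local Notation hp := (root_pressure x0 t0 p r).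
Local Notation vel := (velocity x0 t0 u).
Local Notation grad := (gradient x0 t0 Du).

Section fixed_time.
Variable t : R.
Hypothesis speed_fin : \int[leb3 R]_x (speed2 x0 t0 u (x, t))%:E < +oo.
Hypothesis grad_fin : \int[leb3 R]_x (gradient2 x0 t0 Du (x, t))%:E < +oo.
Hypothesis wg : forall i j (psi : R3 R -> R), test_function Om psi ->
  \int[leb3 R]_x (vel i (x, t) * 'D_(basis3 j) psi x)%R%:E =
  - \int[leb3 R]_x (grad i j (x, t) * psi x)%:E.
Variables (e c rho nu d ku kp : R).
Hypothesis c0 : (0 < c)%R.
Hypothesis hc : forall K s n : R, (0 < K -> 0 < s -> 0 < n ->
    slice_const * (K ^+ 2 * s * n) <= e * (s ^+ 4 + n ^+ 4) + c * (n * K ^+ 3))%R.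
Hypothesis rE : r = (rho ^+ 4)%R.
Hypothesis rho0 : (0 < rho)%R.
Hypothesis nu0 : (0 < nu)%R.
Hypothesis d0 : (0 < d)%R.
Hypothesis ku0 : (0 <= ku)%R.
Hypothesis kp0 : (0 <= kp)%R.
Hypothesis hku : forall a, (0 < a)%R ->
  (a ^+ 3)%:E * leb3 R [set x | (a < hu (x, t))%R] <= ku%:E.
Hypothesis hkp : forall a, (0 < a)%R ->
  (a ^+ 3)%:E * leb3 R [set x | (a < hp (x, t))%R] <= kp%:E.
Hypothesis cut_energy_le : cut_energy x0 t0 u r t <= (nu ^+ 4)%:E.

Let Y : R := fine (dissipation x0 t0 Du r t).
(** The bound of [weak3_integral_sqr] for [|u|^2] on the cube, whose measure is at most [2 r^3], at
    the level [d / r], which is the natural size of a speed. *)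
Let J : R := (2 * d ^+ 2 * r + 8 * r * ku / d)%R.
(** The first two terms bound the squared gradient of the cut-off velocity. The last, of the same
    scaling, makes [S] positive so that its fourth root can be divided by. *)
Let S : R := (2 * Y + 2 * (M / r) ^+ 2 * J + nu ^+ 4 / r ^+ 2)%R.

Let slice_measurable (f : mR4 R -> R) : measurable_fun setT f ->
  measurable_fun setT (fun x : mR3 R => f (x, t)).
Proof. by move=> mf; exact: (measurableT_comp mf (@pair2_measurable _ _ _ _ t)). Qed.

Let mhu : measurable_fun setT (fun x : mR3 R => hu (x, t)).
Proof. exact: slice_measurable (measurable_root_speed sol r). Qed.

Let mhp : measurable_fun setT (fun x : mR3 R => hp (x, t)).
Proof. exact: slice_measurable (measurable_root_pressure sol r). Qed.

Let mvel i : measurable_fun setT (fun x : mR3 R => vel i (x, t)).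
Proof. exact: slice_measurable (measurable_velocity sol i). Qed.

Let mgrad i j : measurable_fun setT (fun x : mR3 R => grad i j (x, t)).
Proof. exact: slice_measurable (measurable_gradient sol i j). Qed.

Let mzt : measurable_fun setT (fun x : mR3 R => zt (x, t)).
Proof. exact: slice_measurable (measurable_zeta x0 t0 r). Qed.

Let root_speed_integral : \int[leb3 R]_x (hu (x, t) ^+ 2)%:E <= J%:E.
Proof.
have -> : \int[leb3 R]_x (hu (x, t) ^+ 2)%:E =
    \int[leb3 R]_(x in cube x0 r) (hu (x, t) ^+ 2)%:E.
  rewrite [RHS]integral_mkcond; apply: eq_integral => x _; rewrite patchE.
  case: ifPn => // nx; rewrite /root_speed indicE (negbTE nx)/= mulr0 expr0n//.
have a0 : (0 < d / r)%R by exact: divr_gt0.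
have := weak3_integral_sqr mhu (fun x => root_speed_ge0 _ _ _ _ (x, t)) hku
  (measurable_cube x0 r) a0.
move=> /le_trans; apply; rewrite /J EFinD; apply: leeD.
  apply: le_trans (lee_wpmul2l _ (leb3_cube_le x0 r0)) _; first by rewrite lee_fin sqr_ge0.
  rewrite -EFinM lee_fin le_eqVlt; apply/orP; left; apply/eqP; field.
  by rewrite gt_eqF.
rewrite lee_fin le_eqVlt; apply/orP; left; apply/eqP; field.
by rewrite !gt_eqF.
Qed.

Let velocity_cube i : \int[leb3 R]_(x in cube x0 r) (vel i (x, t) ^+ 2)%:E <= J%:E.
Proof.
apply: le_trans root_speed_integral.
rewrite [leLHS]integral_mkcond; apply: le_integral_ge0 => x _.
  by rewrite patchE; case: ifP => // _; rewrite lee_fin sqr_ge0.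
rewrite patchE; case: ifPn => [xc|_]; last by rewrite lee_fin sqr_ge0.
rewrite lee_fin /root_speed indicE xc mulr1 sqr_sqrtr ?speed2_ge0//.
exact: velocity_le.
Qed.

Let dissipation_fin : dissipation x0 t0 Du r t = Y%:E.
Proof.
rewrite /Y fineK// ge0_fin_numE; last first.
  by apply: integral_ge0 => x _; rewrite lee_fin mulr_ge0 ?sqr_ge0 ?gradient2_ge0.
apply: le_lt_trans grad_fin; apply: le_integral_ge0 => x _; rewrite lee_fin.
  by rewrite mulr_ge0 ?sqr_ge0 ?gradient2_ge0.
apply: ler_piMl; first exact: gradient2_ge0.
by apply: exprn_ile1; [exact: zeta_ge0|exact: zeta_le1].
Qed.

Let cut_gradient_le i j :
  \int[leb3 R]_x ((xi x0 t0 r t x * grad i j (x, t)) ^+ 2)%:E <= Y%:E.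
Proof.
rewrite -dissipation_fin; apply: le_integral_ge0 => x _; rewrite lee_fin ?sqr_ge0//.
by rewrite xiE exprMn ler_wpM2l ?sqr_ge0// gradient_le.
Qed.

Let J0 : (0 <= J)%R.
Proof.
by rewrite /J addr_ge0// ?divr_ge0 ?mulr_ge0 ?sqr_ge0// ltW.
Qed.

Let Y0 : (0 <= Y)%R.
Proof. by rewrite -lee_fin -dissipation_fin integral_ge0// => x _; rewrite lee_fin mulr_ge0 ?sqr_ge0 ?gradient2_ge0. Qed.

Let S0 : (0 < S)%R.
Proof.
have Mr : (0 <= 2 * (M / r) ^+ 2 * J)%R   by apply: mulr_ge0; [apply: mulr_ge0 => //; exact: sqr_ge0|exact: J0].
have nr : (0 < nu ^+ 4 / r ^+ 2)%R by rewrite divr_gt0 ?exprn_gt0.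
by rewrite /S ltr_wpDl// addr_ge0// mulr_ge0.
Qed.

Let pairing (h : mR3 R -> R) (k : R) i : measurable_fun setT h -> (forall x, 0 <= h x)%R ->
  (0 <= k)%R ->
  (forall a, (0 < a)%R -> (a ^+ 3)%:E * leb3 R [set x | (a < h x)%R] <= k%:E) ->
  \int[leb3 R]_x (h x ^+ 2 * `|zt (x, t) * vel i (x, t)|)%:E <=
  (r * (e * (S + nu ^+ 4 / r ^+ 2)) + r * (c * (nu / rho ^+ 5)) * k)%:E.
Proof.
(* [slice_estimate] takes a strictly positive distribution bound, while [k] may vanish: it is
   applied with [k + s], and [s] tends to 0. *)
move=> mh h0 k0 hk; apply: le_EFin_affine => [|s s0].
  by rewrite !mulr_ge0 ?invr_ge0 ?exprn_ge0// ltW.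
have cO : cube x0 r `<=` Om.
  by move=> x /(cube_edist r0) /lt_trans; apply.
have := @slice_estimate R x0 t0 r t M r0 M1 HM Om (fun x => vel i (x, t))
  (fun j x => grad i j (x, t)) cO (mvel i) (mgrad i).
have fin1 : \int[leb3 R]_x (vel i (x, t) ^+ 2)%:E < +oo.
  apply: le_lt_trans speed_fin; apply: le_integral_ge0 => x _; rewrite lee_fin ?sqr_ge0//.
  exact: velocity_le.
have fin2 j : \int[leb3 R]_x (grad i j (x, t) ^+ 2)%:E < +oo.
  apply: le_lt_trans grad_fin; apply: le_integral_ge0 => x _; rewrite lee_fin ?sqr_ge0//.
  exact: gradient_le.
move=> /(_ fin1 fin2 (wg i)) /(_ e c h rho nu S (k + s)%R hc rE rho0 nu0 S0).
have ks0 : (0 < k + s)%R by exact: ltr_wpDl.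
have V1 : \int[leb3 R]_x ((xi x0 t0 r t x * vel i (x, t)) ^+ 2)%:E <= (nu ^+ 4)%:E.
  apply: le_trans cut_energy_le; apply: le_integral_ge0 => x _; rewrite lee_fin ?sqr_ge0//.
  by rewrite xiE exprMn ler_wpM2l ?sqr_ge0// velocity_le.
have V2 j : 2%:E * \int[leb3 R]_x ((xi x0 t0 r t x * grad i j (x, t)) ^+ 2)%:E +
    (2 * (M / r) ^+ 2)%:E * \int[leb3 R]_(x in cube x0 r) (vel i (x, t) ^+ 2)%:E <= S%:E.
  apply: (@le_trans _ _ (2%:E * Y%:E + (2 * (M / r) ^+ 2)%:E * J%:E)).
    have C0 : (0 <= 2 * (M / r) ^+ 2)%R by apply: mulr_ge0 => //; exact: sqr_ge0.
    apply: leeD.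
      by apply: lee_wpmul2l => //; exact: cut_gradient_le.
    by apply: lee_wpmul2l; [rewrite lee_fin|exact: velocity_cube].
  rewrite -!EFinM -EFinD lee_fin /S lerDl divr_ge0 ?exprn_ge0// ltW//.
have hks a : (0 < a)%R -> (a ^+ 3)%:E * leb3 R [set x | (a < h x)%R] <= (k + s)%:E.
  by move=> a0; apply: le_trans (hk a a0) _; rewrite lee_fin lerDl ltW.
move=> /(_ ks0 mh h0 V1 V2 hks); under eq_integral do rewrite xiE.
move=> /le_trans; apply; rewrite lee_fin le_eqVlt; apply/orP; left; apply/eqP.
by ring.
Qed.

Lemma slice_flux : \int[leb3 R]_x (flux x0 t0 u p r M (x, t))%:E <=
  (4 * M / r ^+ 2 * J + 6 * M *
    (3 * (e * (S + nu ^+ 4 / r ^+ 2)) + c * (nu / rho ^+ 5) * (ku + 2 * kp)))%:E.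
Proof.
pose A (x : mR3 R) : R := (hu (x, t) ^+ 2)%R.
pose B j (x : mR3 R) : R := (hu (x, t) ^+ 2 * `|zt (x, t) * vel j (x, t)|)%R.
pose C j (x : mR3 R) : R := (hp (x, t) ^+ 2 * `|zt (x, t) * vel j (x, t)|)%R.
have A0 x : (0 <= A x)%R by exact: sqr_ge0.
have B0 j x : (0 <= B j x)%R by apply: mulr_ge0; [exact: sqr_ge0|exact: normr_ge0].
have C0 j x : (0 <= C j x)%R by apply: mulr_ge0; [exact: sqr_ge0|exact: normr_ge0].
have mzv j : measurable_fun setT (fun x : mR3 R => `|zt (x, t) * vel j (x, t)|)%R.
  by apply: measurableT_comp => //; apply: measurable_funM; [exact: mzt|exact: mvel].
have mA : measurable_fun setT A by apply: measurable_funX; exact: mhu.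
have mB j : measurable_fun setT (B j).
  by apply: measurable_funM; [exact: mA|exact: mzv].
have mC j : measurable_fun setT (C j).
  by apply: measurable_funM; [apply: measurable_funX; exact: mhp|exact: mzv].
have M0 : (0 <= M)%R := le_trans ler01 M1.
set k1 := (4 * M / r ^+ 2)%R; set k2 := (2 * M / r)%R.
have k10 : (0 <= k1)%R by rewrite divr_ge0 ?mulr_ge0 ?exprn_ge0// ltW.
have k20 : (0 <= k2)%R by rewrite divr_ge0 ?mulr_ge0// ltW.
have Z (k : R) (F : mR3 R -> R) : (0 <= k)%R -> measurable_fun setT F ->
    (forall x, 0 <= F x)%R ->
    \int[leb3 R]_x (k * F x)%:E = k%:E * \int[leb3 R]_x (F x)%:E.
  move=> k0 mF F0; rewrite -ge0_integralZl_EFin//.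
  - by move=> x _; rewrite lee_fin.
  - exact/measurable_EFinP.
have D (F G : mR3 R -> R) : measurable_fun setT F -> measurable_fun setT G ->
    (forall x, 0 <= F x)%R -> (forall x, 0 <= G x)%R ->
    \int[leb3 R]_x (F x + G x)%:E = \int[leb3 R]_x (F x)%:E + \int[leb3 R]_x (G x)%:E.
  move=> mF mG F0 G0; rewrite -ge0_integralD//.
  - by move=> x _; rewrite lee_fin.
  - exact/measurable_EFinP.
  - by move=> x _; rewrite lee_fin.
  - exact/measurable_EFinP.
have mBC j : measurable_fun setT (fun x => B j x + 2 * C j x)%R.
  by apply: measurable_funD => //; apply: measurable_funM => //; exact: measurable_cst.
have BC0 j x : (0 <= B j x + 2 * C j x)%R by rewrite addr_ge0// mulr_ge0.
have E : \int[leb3 R]_x (flux x0 t0 u p r M (x, t))%:E =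
    k1%:E * \int[leb3 R]_x (A x)%:E +
    k2%:E * (\sum_(j < 3) (\int[leb3 R]_x (B j x)%:E + 2%:E * \int[leb3 R]_x (C j x)%:E)).
  transitivity (\int[leb3 R]_x (k1 * A x + k2 * \sum_(j < 3) (B j x + 2 * C j x))%:E) => //.
  rewrite D; first last.
  - by move=> x; rewrite mulr_ge0// sumr_ge0.
  - by move=> x; rewrite mulr_ge0.
  - by apply: measurable_funM; [exact: measurable_cst|exact: measurable_sum].
  - by apply: measurable_funM => //; exact: measurable_cst.
  rewrite !Z//; first last.
  - by move=> x; rewrite sumr_ge0.
  - exact: measurable_sum.
  congr (_ + _ * _).
  under eq_integral do rewrite -sumEFin.
  rewrite ge0_integral_sum//; first last.
  - by move=> j x _; rewrite lee_fin.
  - by move=> j; apply/measurable_EFinP.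
  apply: eq_bigr => j _; rewrite D//; first by rewrite Z.
  - by apply: measurable_funM => //; exact: measurable_cst.
  - by move=> x; rewrite mulr_ge0.
rewrite E; set Bu := (r * (e * (S + nu ^+ 4 / r ^+ 2)) + r * (c * (nu / rho ^+ 5)) * ku)%R.
set Bp := (r * (e * (S + nu ^+ 4 / r ^+ 2)) + r * (c * (nu / rho ^+ 5)) * kp)%R.
have HB j : \int[leb3 R]_x (B j x)%:E <= Bu%:E.
  by apply: pairing => // x; exact: root_speed_ge0.
have HC j : \int[leb3 R]_x (C j x)%:E <= Bp%:E.
  by apply: pairing => // x; exact: root_pressure_ge0.
apply: (@le_trans _ _ (k1%:E * J%:E + k2%:E * (\sum_(j < 3) (Bu%:E + 2%:E * Bp%:E)))).
  apply: leeD; first by apply: lee_wpmul2l; [rewrite lee_fin|exact: root_speed_integral].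
  apply: lee_wpmul2l; first by rewrite lee_fin.
  by apply: lee_sum => j _; apply: leeD => //; apply: lee_wpmul2l.
have -> : \sum_(j < 3) (Bu%:E + 2%:E * Bp%:E) = (3 * (Bu + 2 * Bp))%:E.
  transitivity (\sum_(j < 3) (Bu + 2 * Bp)%:E) => //.
  rewrite sumEFin; congr (_%:E); rewrite !big_ord_recr big_ord0 /=; ring.
rewrite -!EFinM -EFinD lee_fin le_eqVlt; apply/orP; left; apply/eqP; rewrite /k1 /k2 /Bu /Bp.
by field; rewrite !gt_eqF.
Qed.

End fixed_time.

End flux_estimate.

(** * The flux integrated over time *)

Section time_integral.
Context {R : realType}.
Local Open Scope ereal_scope.
Local Notation leb := (@lebesgue_measure R).
Local Notation T1 := (measurableTypeR R).

(** With [d^3 = e]: either [a <= d n], and the left side is at most [e n^4], or [n <= a / d], and it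
    is at most [a^4 / d]. *)
Lemma young34 (e : R) : (0 < e)%R -> exists2 c : R, (0 < c)%R &
  forall n a : R, (0 < n)%R -> (0 < a)%R -> (n * a ^+ 3 <= e * n ^+ 4 + c * a ^+ 4)%R.
Proof.
move=> e0; have [d d0 dE] := exists_root 2 e0.
exists d^-1%R => [|n a n0 a0]; first by rewrite invr_gt0.
have n4 : (0 <= e * n ^+ 4)%R by apply: mulr_ge0; [|apply: exprn_ge0]; exact: ltW.
have a4 : (0 <= d^-1 * a ^+ 4)%R.
  by apply: mulr_ge0; [rewrite invr_ge0|apply: exprn_ge0]; exact: ltW.
have [an|/ltW an] := leP a (d * n)%R.
  have dn0 : (0 <= d * n)%R by apply: mulr_ge0; exact: ltW.
  have h : (a ^+ 3 <= (d * n) ^+ 3)%R by apply: lerXn2r; rewrite ?nnegrE ?(ltW a0).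
  have k := ler_wpM2l (ltW n0) h.
  have E : (n * (d * n) ^+ 3 = e * n ^+ 4)%R by rewrite -dE; ring.
  by move: k; rewrite E; lra.
have h : (n <= d^-1 * a)%R by rewrite mulrC ler_pdivlMr// mulrC.
have a3 : (0 <= a ^+ 3)%R by apply: exprn_ge0; exact: ltW.
have k := ler_wpM2r a3 h.
have E : (d^-1 * a * a ^+ 3 = d^-1 * a ^+ 4)%R by ring.
by move: k; rewrite E; lra.
Qed.

Lemma integral_affine_le (I : set T1) (f g1 g2 g3 : T1 -> \bar R)
    (a1 a2 a3 a4 b1 b2 b3 l : R) : measurable I ->
  measurable_fun setT f -> (forall t, 0 <= f t) ->
  measurable_fun setT g1 -> (forall t, 0 <= g1 t) ->
  measurable_fun setT g2 -> (forall t, 0 <= g2 t) ->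
  measurable_fun setT g3 -> (forall t, 0 <= g3 t) ->
  (0 <= a1)%R -> (0 <= a2)%R -> (0 <= a3)%R -> (0 <= a4)%R ->
  (\forall t \ae leb, I t -> f t <= a1%:E * g1 t + a2%:E * g2 t + a3%:E * g3 t + a4%:E) ->
  \int[leb]_(t in I) g1 t <= b1%:E -> \int[leb]_(t in I) g2 t <= b2%:E ->
  \int[leb]_(t in I) g3 t <= b3%:E -> leb I = l%:E ->
  \int[leb]_(t in I) f t <= (a1 * b1 + a2 * b2 + a3 * b3 + a4 * l)%:E.
Proof.
move=> mI mf f0 m1 p1 m2 p2 m3 p3 a10 a20 a30 a40 fg G1 G2 G3 Il.
have Z (k : R) (g : T1 -> \bar R) : (0 <= k)%R -> measurable_fun setT g ->
    (forall t, 0 <= g t) ->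
    \int[leb]_(t in I) (k%:E * g t) = k%:E * \int[leb]_(t in I) g t.
  move=> k0 mg g0; apply: ge0_integralZl_EFin => //; exact: measurable_funTS.
have D (g h : T1 -> \bar R) : measurable_fun setT g -> measurable_fun setT h ->
    (forall t, 0 <= g t) -> (forall t, 0 <= h t) ->
    \int[leb]_(t in I) (g t + h t) = \int[leb]_(t in I) g t + \int[leb]_(t in I) h t.
  by move=> mg mh g0 h0; apply: ge0_integralD => //; exact: measurable_funTS.
have mZ (k : R) (g : T1 -> \bar R) : measurable_fun setT g -> measurable_fun setT (fun t => k%:E * g t).
  by move=> mg; apply: emeasurable_funM => //; exact: measurable_cst.
have pZ (k : R) (g : T1 -> \bar R) : (0 <= k)%R -> (forall t, 0 <= g t) -> forall t, 0 <= k%:E * g t.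
  by move=> k0 g0 t; apply: mule_ge0.
have q1 := mZ a1 _ m1; have q2 := mZ a2 _ m2; have q3 := mZ a3 _ m3.
have r1 := pZ _ _ a10 p1; have r2 := pZ _ _ a20 p2; have r3 := pZ _ _ a30 p3.
have q12 := emeasurable_funD q1 q2; have q123 := emeasurable_funD q12 q3.
have q4 : measurable_fun setT (cst a4%:E : T1 -> \bar R) by exact: measurable_cst.
have r12 t : 0 <= a1%:E * g1 t + a2%:E * g2 t by exact: adde_ge0.
have r123 t : 0 <= a1%:E * g1 t + a2%:E * g2 t + a3%:E * g3 t by exact: adde_ge0.
have le1 : \int[leb]_(t in I) f t <=
    \int[leb]_(t in I) (a1%:E * g1 t + a2%:E * g2 t + a3%:E * g3 t + a4%:E).
  apply: ae_ge0_le_integral => //.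
  - exact: measurable_funTS.
  - by move=> t _; apply: adde_ge0.
  - by apply: measurable_funTS; exact: (emeasurable_funD q123 q4).
apply: (le_trans le1).
have E1 := D _ _ q123 q4 r123 (fun=> a40); have E2 := D _ _ q12 q3 r12 r3.
have E3 := D _ _ q1 q2 r1 r2.
have E4 : \int[leb]_(t in I) (cst a4%:E t) = a4%:E * l%:E.
  by transitivity (a4%:E * leb I); [exact: integral_cst|rewrite Il].
rewrite E1 E2 E3 E4 !Z// !EFinD !EFinM.
by apply: leeD; [apply: leeD; [apply: leeD|]|]; rewrite ?lexx//; apply: lee_wpmul2l.
Qed.

Variables (x0 : R3 R) (t0 : R) (u : R4 R -> 'rV[R]_3) (p : R4 R -> R)
  (Du : R4 R -> 'M[R]_3).
Hypothesis sol : suitable_weak_solution (x0, t0) u p Du.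
Variables (r M : R).
Hypothesis r0 : (0 < r)%R.
Hypothesis r1 : (r < 1)%R.
Hypothesis M1 : (1 <= M)%R.
Hypothesis HM : cut_derivatives_le M.

Local Notation T := (time_itv t0 1).
Local Notation Tr := (time_itv t0 r).
Local Notation hu := (root_speed x0 t0 u r).
Local Notation hp := (root_pressure x0 t0 p r).

Let mTr : measurable (Tr : set T1). Proof. exact: measurable_itv. Qed.

Let TrT : Tr `<=` T.
Proof.
move=> t; rewrite /time_itv /= !in_itv/= => /andP[h ->]; rewrite andbT.
apply: le_lt_trans h; rewrite lerD2l lerN2; apply: lerXn2r; rewrite ?nnegrE ?ltW//.
Qed.

Let cube_pcyl x t : Tr t -> cube x0 r x -> eball x0 r x /\ pcyl (x0, t0) 1 (x, t).
Proof.
move=> tT xc; have xr := cube_edist r0 xc; split => //.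
by split => /=; [exact: lt_trans r1|exact: TrT].
Qed.

Let mslice t : measurable_fun setT (fun x : mR3 R => (x, t) : mR4 R).
Proof. exact: pair2_measurable. Qed.

Lemma sup_distribution_speed t : Tr t -> sup_distribution hu t <=
  weak_Lnorm 3 (eball x0 r) (fun x => enorm (u (x, t))) `^ 3.
Proof.
move=> tT; apply: sup_distribution_le => [|a a0]; first exact: poweR_ge0.
apply: le_trans (weak_Lnorm_distribution _ _ (_ : 0 < 3)%R a0); last by [].
rewrite powR_mulrn ?(ltW a0)//; apply: lee_wpmul2l; first by rewrite lee_fin exprn_ge0// ltW.
have e : eball x0 r `&` [set x | (a < `|enorm (u (x, t))|)%R] =
    eball x0 r `&` [set x | (a < Num.sqrt (speed2 x0 t0 u (x, t)))%R].
  have q x : eball x0 r x -> `|enorm (u (x, t))|%R = Num.sqrt (speed2 x0 t0 u (x, t)).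
    move=> xr; rewrite ger0_norm ?sqrtr_ge0// /enorm speed2E//.
    by split => /=; [exact: lt_trans r1|exact: TrT].
  by apply/seteqP; split => x /= [xr h]; split => //; move: h; rewrite q.
have ms : measurable_fun setT (fun x : mR3 R => Num.sqrt (speed2 x0 t0 u (x, t))).
  apply: (@measurableT_comp _ _ _ _ _ _ (@Num.sqrt R)).
    by apply: continuous_measurable_fun; exact: sqrt_continuous.
  exact: (measurableT_comp (measurable_speed2 sol) (mslice t)).
rewrite e; apply: le_measure; rewrite ?inE.
- apply: measurable_superlevel.
  exact: (measurableT_comp (measurable_root_speed sol r) (mslice t)).
- apply: measurableI; first exact: measurable_eball.
  exact: measurable_superlevel.
- move=> x /=; rewrite /root_speed indicE; case: (boolP (_ \in _)) => [/set_mem xc|_].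
    by rewrite mulr1 => h; split => //; have [] := cube_pcyl tT xc.
  by rewrite mulr0 ltNge ltW.
Qed.

(** Since [|p|^(1/2) > a] means [|p| > a^2], and [(a^2)^(3/2) = a^3], the weak L^3 bound of the root
    is the weak L^(3/2) bound of the pressure. *)
Lemma sup_distribution_pressure t : Tr t -> sup_distribution hp t <=
  weak_Lnorm (3 / 2) (eball x0 r) (fun x => p (x, t)) `^ (3 / 2).
Proof.
move=> tT; apply: sup_distribution_le => [|a a0]; first exact: poweR_ge0.
have p32 : (0 < 3 / 2 :> R)%R by rewrite divr_gt0.
apply: le_trans (weak_Lnorm_distribution _ _ p32 (exprn_gt0 2 a0)).
have -> : ((a ^+ 2) `^ (3 / 2) = a ^+ 3)%R.
  by rewrite -powR_mulrn ?(ltW a0)// -powRrM mulrCA divff ?mulr1// powR_mulrn// ltW.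
apply: lee_wpmul2l; first by rewrite lee_fin exprn_ge0// ltW.
have e : eball x0 r `&` [set x | (a ^+ 2 < `|p (x, t)|)%R] =
    eball x0 r `&` [set x | (a ^+ 2 < `|pressure x0 t0 p (x, t)|)%R].
  have q x : eball x0 r x -> p (x, t) = pressure x0 t0 p (x, t).
    move=> xr; rewrite /pressure /patch mem_set//.
    by split => /=; [exact: lt_trans r1|exact: TrT].
  by apply/seteqP; split => x /= [xr h]; split => //; move: h; rewrite q.
rewrite e; apply: le_measure; rewrite ?inE.
- apply: measurable_superlevel.
  exact: (measurableT_comp (measurable_root_pressure sol r) (mslice t)).
- apply: measurableI; first exact: measurable_eball.
  apply: measurable_superlevel; apply: measurableT_comp => //.
  exact: (measurableT_comp (measurable_pressure sol) (mslice t)).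
- move=> x /=; rewrite /root_pressure indicE; case: (boolP (_ \in _)) => [/set_mem xc|_].
    rewrite mulr1 => h; split; first by have [] := cube_pcyl tT xc.
    rewrite -[ltRHS]sqr_sqrtr//; apply: ltrXn2r => //; rewrite ?nnegrE ?ltW ?sqrtr_ge0//.
  by rewrite mulr0 ltNge ltW.
Qed.

Variables (e c rho nu d q : R).
Hypothesis e0 : (0 < e)%R.
Hypothesis c0 : (0 < c)%R.
Hypothesis hc : forall K s n : R, (0 < K -> 0 < s -> 0 < n ->
    slice_const * (K ^+ 2 * s * n) <= e * (s ^+ 4 + n ^+ 4) + c * (n * K ^+ 3))%R.
Hypothesis rE : r = (rho ^+ 4)%R.
Hypothesis rho0 : (0 < rho)%R.
Hypothesis nu0 : (0 < nu)%R.
Hypothesis d0 : (0 < d)%R.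
Hypothesis cut_energy_le :
  \forall t \ae leb, T t -> cut_energy x0 t0 u r t <= (nu ^+ 4)%:E.
Hypothesis dissipation_le :
  \int[leb]_(t in T) dissipation x0 t0 Du r t <= (nu ^+ 4)%:E.
Hypothesis C_le : C_infty (x0, t0) r u <= (d ^+ 3)%:E.
Hypothesis D_le : D_infty (x0, t0) r p <= (q ^+ 3)%:E.

Let integral_speed : \int[leb]_(t in Tr) sup_distribution hu t <= (r ^+ 2 * d ^+ 3)%:E.
Proof.
have := C_le; rewrite /C_infty /= lee_pdivrMl ?exprn_gt0// -EFinM; apply: le_trans.
by apply: le_integral_ge0 => t tT; [exact: sup_distribution_ge0|exact: sup_distribution_speed].
Qed.

Let integral_pressure : \int[leb]_(t in Tr) sup_distribution hp t <= (r ^+ 2 * q ^+ 3)%:E.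
Proof.
have := D_le; rewrite /D_infty /= lee_pdivrMl ?exprn_gt0// -EFinM; apply: le_trans.
by apply: le_integral_ge0 => t tT; [exact: sup_distribution_ge0|exact: sup_distribution_pressure].
Qed.

Let dissipation_ge0 t : 0 <= dissipation x0 t0 Du r t.
Proof.
by apply: integral_ge0 => x _; rewrite lee_fin mulr_ge0 ?sqr_ge0 ?gradient2_ge0.
Qed.

Let measurable_dissipation : measurable_fun setT (dissipation x0 t0 Du r : T1 -> \bar R).
Proof.
apply: (@measurable_slice_integral _ setT
  (fun z => (zeta x0 t0 r z ^+ 2 * gradient2 x0 t0 Du z)%:E)) => //.
  apply/measurable_EFinP; apply: measurable_funM; last exact: measurable_gradient2 sol.
  by apply: measurable_funX; exact: measurable_zeta.
by move=> z; rewrite lee_fin mulr_ge0 ?sqr_ge0 ?gradient2_ge0.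
Qed.

Let measurable_total_flux :
  measurable_fun (setT : set T1) (fun t => \int[leb3 R]_x (flux x0 t0 u p r M (x, t))%:E).
Proof.
apply: (@measurable_slice_integral _ setT (fun z => (flux x0 t0 u p r M z)%:E)) => //.
  by apply/measurable_EFinP; exact: measurable_flux sol _ _.
by move=> z; rewrite lee_fin flux_ge0.
Qed.

Let ae_finite (f : T1 -> \bar R) (k : R) : measurable_fun setT f -> (forall t, 0 <= f t) ->
  \int[leb]_(t in Tr) f t <= k%:E -> \forall t \ae leb, Tr t -> f t \is a fin_num.
Proof.
move=> mf f0 fk; apply: (integrable_ae mTr); apply/integrableP; split.
  exact: measurable_funTS.
apply: le_lt_trans (ltry k); apply: le_trans fk.
by apply: le_integral_ge0 => t _; [exact: abse_ge0|rewrite gee0_abs].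
Qed.

(** [A1] to [A4] are the coefficients of the bound [slice_flux] once [J] and [S] are expanded: it is
    affine in the dissipation and in the two distribution suprema. *)
Let A1 : R := (36 * M * e)%R.
Let A2 : R := ((4 * M / r ^+ 2 + 36 * M * e * (M / r) ^+ 2) * (8 * r / d)
  + 6 * M * c * (nu / rho ^+ 5))%R.
Let A3 : R := (12 * M * c * (nu / rho ^+ 5))%R.
Let A4 : R := ((4 * M / r ^+ 2 + 36 * M * e * (M / r) ^+ 2) * (2 * d ^+ 2 * r)
  + 36 * M * e * nu ^+ 4 / r ^+ 2)%R.

Let flux_pointwise : \forall t \ae leb, Tr t ->
  \int[leb3 R]_x (flux x0 t0 u p r M (x, t))%:E <=
  A1%:E * dissipation x0 t0 Du r t + A2%:E * sup_distribution hu t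
  + A3%:E * sup_distribution hp t + A4%:E.
Proof.
have mhu := measurable_sup_distribution (measurable_root_speed sol r).
have mhp := measurable_sup_distribution (measurable_root_pressure sol r).
have fu := ae_finite mhu (sup_distribution_ge0 hu) integral_speed.
have fp := ae_finite mhp (sup_distribution_ge0 hp) integral_pressure.
have f0 := slices_finite sol; have f1 := slice_weak_gradient sol.
have F := ae_filter_ringOfSetsType leb.
have := @filterI _ _ F _ _ fu (@filterI _ _ F _ _ fp (@filterI _ _ F _ _ f0
  (@filterI _ _ F _ _ f1 cut_energy_le))).
apply: (@filterS _ _ F) => t [ku [kp [fin [wg en]]]] tr.
have tT := TrT tr; have [s1 s2] := fin tT.
have hku := ku tr; have hkp := kp tr.
set k1 := fine (sup_distribution hu t); set k2 := fine (sup_distribution hp t).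
have k1E : sup_distribution hu t = k1%:E := esym (fineK hku).
have k2E : sup_distribution hp t = k2%:E := esym (fineK hkp).
have k10 : (0 <= k1)%R by apply: fine_ge0; exact: sup_distribution_ge0.
have k20 : (0 <= k2)%R by apply: fine_ge0; exact: sup_distribution_ge0.
have w1 a : (0 < a)%R -> (a ^+ 3)%:E * leb3 R [set x | (a < hu (x, t))%R] <= k1%:E.
  by move=> a0; rewrite -k1E; apply: sup_distribution_ub => //; exact: measurable_root_speed sol r.
have w2 a : (0 < a)%R -> (a ^+ 3)%:E * leb3 R [set x | (a < hp (x, t))%R] <= k2%:E.
  by move=> a0; rewrite -k2E; apply: sup_distribution_ub => //; exact: measurable_root_pressure sol r.
have := slice_flux sol r0 r1 M1 HM s1 s2 (wg tT) c0 hc rE rho0 nu0 d0 k10 k20 w1 w2 (en tT).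
have Yfin : dissipation x0 t0 Du r t \is a fin_num.
  rewrite ge0_fin_numE//; apply: le_lt_trans s2; apply: le_integral_ge0 => x _; rewrite lee_fin.
    by rewrite mulr_ge0 ?sqr_ge0 ?gradient2_ge0.
  apply: ler_piMl; first exact: gradient2_ge0.
  by apply: exprn_ile1; [exact: zeta_ge0|exact: zeta_le1].
move=> /le_trans; apply; rewrite k1E k2E -[X in A1%:E * X](fineK Yfin).
rewrite -!EFinM -!EFinD lee_fin le_eqVlt; apply/orP; left; apply/eqP.
rewrite /A1 /A2 /A3 /A4; move: (fine (dissipation _ _ _ _ _)) => Y.
by field; rewrite (gt_eqF r0) (gt_eqF rho0) (gt_eqF d0).
Qed.

(** The time interval has length [r^2]. The dissipation and the constant term each give
    [36 M e nu^4]; the two parts of [J] give [8 + 2 = 10] times [r d^2]; and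
    [nu r^2 / rho^5 = nu rho^3]. *)
Lemma total_flux_le :
  \int[leb]_(t in Tr) \int[leb3 R]_x (flux x0 t0 u p r M (x, t))%:E <=
  (72 * M * e * nu ^+ 4 + 10 * (4 * M + 36 * M ^+ 3 * e) * r * d ^+ 2
   + 6 * M * c * (nu * rho ^+ 3) * (d ^+ 3 + 2 * q ^+ 3))%:E.
Proof.
have M0 : (0 < M)%R := lt_le_trans ltr01 M1.
have A10 : (0 <= A1)%R by rewrite /A1 !mulr_ge0// ltW.
have Me0 : (0 <= 36 * M * e)%R by rewrite !mulr_ge0// ltW.
have Mr0 : (0 <= 4 * M / r ^+ 2 + 36 * M * e * (M / r) ^+ 2)%R.
  apply: addr_ge0; last by apply: mulr_ge0 => //; exact: sqr_ge0.
  by apply: divr_ge0; [rewrite mulr_ge0// ltW|rewrite exprn_ge0// ltW].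
have nr0 : (0 <= nu / rho ^+ 5)%R by rewrite divr_ge0 ?exprn_ge0// ltW.
have Mc0 : (0 <= M * c)%R by rewrite mulr_ge0// ltW.
have A20 : (0 <= A2)%R.
  rewrite /A2; apply: addr_ge0; last first.
    by rewrite -(mulrA 6%R M); apply: mulr_ge0 => //; exact: mulr_ge0.
  by apply: mulr_ge0 => //; apply: divr_ge0; [rewrite mulr_ge0// ltW|exact: ltW].
have A30 : (0 <= A3)%R by rewrite /A3 -(mulrA 12%R M); apply: mulr_ge0 => //; exact: mulr_ge0.
have A40 : (0 <= A4)%R.
  rewrite /A4; apply: addr_ge0.
    by apply: mulr_ge0 => //; apply: mulr_ge0; [apply: mulr_ge0 => //; exact: sqr_ge0|exact: ltW].
  by apply: divr_ge0; [rewrite mulr_ge0// exprn_ge0// ltW|rewrite exprn_ge0// ltW].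
have mhu := measurable_sup_distribution (measurable_root_speed sol r).
have mhp := measurable_sup_distribution (measurable_root_pressure sol r).
have lebTr : leb Tr = (r ^+ 2)%:E.
  rewrite /time_itv lebesgue_measure_itv/= lte_fin ifT; last first.
    by rewrite ltrBlDr ltrDl exprn_gt0.
  by rewrite -EFinD; congr (_%:E); ring.
have integral_dissipation : \int[leb]_(t in Tr) dissipation x0 t0 Du r t <= (nu ^+ 4)%:E.
  apply: le_trans dissipation_le; apply: ge0_subset_integral => //.
  - exact: measurable_itv.
  - exact: measurable_funTS measurable_dissipation.
have := integral_affine_le mTr measurable_total_flux _ measurable_dissipation dissipation_ge0
  mhu (sup_distribution_ge0 hu) mhp (sup_distribution_ge0 hp) A10 A20 A30 A40 flux_pointwise
  integral_dissipation integral_speed integral_pressure lebTr.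
have fl0 t : 0 <= \int[leb3 R]_x (flux x0 t0 u p r M (x, t))%:E.
  by apply: integral_ge0 => x _; rewrite lee_fin flux_ge0.
move=> /(_ fl0) /le_trans; apply.
rewrite lee_fin le_eqVlt; apply/orP; left; apply/eqP; rewrite /A1 /A2 /A3 /A4 rE.
by field; rewrite (gt_eqF rho0) (gt_eqF d0).
Qed.

End time_integral.

(** * Absorption of the small terms and iteration *)

Section absorption.
Context {R : realType}.
Local Open Scope ereal_scope.
Local Notation leb := (@lebesgue_measure R).
Local Notation T1 := (measurableTypeR R).

Lemma ae_itv_exists (a b : R) (P : R -> Prop) : (a < b)%R ->
  (\forall t \ae leb, P t) -> exists2 t, (a < t < b)%R & P t.
Proof.
move=> ab aeP; apply: contrapT => nP.
have sub : `]a, b[%classic `<=` [set t | ~ P t].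
  move=> t /=; rewrite in_itv/= => tab Pt; apply: nP; by exists t.
have aeP' : leb.-negligible (~` (P : set T1)) by exact: aeP.
have neg : leb.-negligible (`]a, b[%classic : set T1) by apply: negligibleS aeP'; exact: sub.
have mI : measurable (`]a, b[%classic : set T1) by exact: measurable_itv.
have L : leb `]a, b[%classic = (b - a)%:E by rewrite lebesgue_measure_itv/= lte_fin ab.
have /eqP := etrans (esym L) ((negligibleP leb mI).1 neg).
by rewrite eqe subr_eq0 gt_eqF.
Qed.

(** The energy inequality bounds the dissipation up to almost every [t < t0]. Such times exist
    arbitrarily close to the end point, and monotone convergence gives the whole interval. *)
Lemma integral_exhaustion (f : T1 -> \bar R) (a b : R) (B : \bar R) : (a < b)%R ->
  measurable_fun setT f -> (forall t, 0 <= f t) ->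
  (\forall t \ae leb, (a < t < b)%R -> \int[leb]_(s in `]a, t[) f s <= B) ->
  \int[leb]_(s in `]a, b[) f s <= B.
Proof.
move=> ab mf f0 aeB.
pose F (n : nat) : set T1 := `]a, (b - n.+1%:R^-1)%R[%classic.
have mF n : measurable (F n) by exact: measurable_itv.
have ndF : {homo F : n m / (n <= m)%N >-> (n <= m)%O}.
  move=> n m nm; apply/subsetPset => x; rewrite /F /= !in_itv/= => /andP[-> xb]/=.
  by apply: lt_le_trans xb _; rewrite lerD2l lerN2 lef_pV2 ?posrE// ler_nat ltnS.
have UF : \bigcup_n F n = `]a, b[%classic.
  apply/seteqP; split => x; rewrite /F /= in_itv/=.
    move=> [n _ /=]; rewrite in_itv/= => /andP[-> xb]/=; apply: (lt_trans xb).
    by rewrite ltrBlDr ltrDl invr_gt0.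
  move=> /andP[ax xb]; have bx0 : (0 < b - x)%R by rewrite subr_gt0.
  exists (Num.truncn (b - x)^-1) => //=; rewrite in_itv/= ax/= ltrBrDr -ltrBrDl.
  rewrite invf_plt ?posrE//; exact: truncnS_gt.
have cv := ge0_nondecreasing_set_cvg_integral ndF mF (fun n => measurable_funTS mf)
  (fun n x _ => f0 x) (mu := leb).
rewrite -UF -(cvg_lim _ cv)//; apply: lime_le; first by apply/cvg_ex; eexists; exact: cv.
apply: nearW => n.
have ln : (Num.max a (b - n.+1%:R^-1) < b)%R.
  by rewrite gt_max ab/= ltrBlDr ltrDl invr_gt0.
have [t /andP[t1 t2]] := ae_itv_exists ln aeB.
move: t1; rewrite gt_max => /andP[at' nt] /(_ (introT andP (conj at' t2))).
apply: le_trans; apply: ge0_subset_integral => //; first exact: measurable_funTS.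
by move=> x; rewrite /F /= !in_itv/= => /andP[-> xb] /=; exact: lt_trans nt.
Qed.

(** The map [N -> N / 2 + K] has the fixed point [2 K], and n steps lead from [N1 + 2 K] to
    [N1 / 2^n + 2 K]. Stopping below [3 K] takes finitely many steps, so no passage to the limit in
    [P] occurs. *)
Lemma iterate_halving (P : R -> Prop) (N0 K : R) : (0 < K)%R -> P N0 ->
  (forall N N', (N <= N')%R -> P N -> P N') ->
  (forall N, (0 < N)%R -> P N -> P (N / 2 + K)%R) -> P (3 * K)%R.
Proof.
move=> K0 P0 mono step.
pose N1 := Num.max N0 K.
have N10 : (0 < N1)%R by rewrite lt_max K0 orbT.
have P1 : P N1 by apply: mono P0; rewrite le_max lexx.
have H n : P (N1 / 2 ^+ n + 2 * K)%R.
  elim: n => [|n IH].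
    by rewrite expr0 divr1; apply: mono P1; rewrite lerDl mulr_ge0// ltW.
  have h := step _ _ IH.
  apply: mono (h _).
    rewrite le_eqVlt; apply/orP; left; apply/eqP; rewrite exprS; field.
    by rewrite expf_neq0.
  by rewrite addr_gt0 ?divr_gt0 ?exprn_gt0 ?mulr_gt0.
pose n := Num.Def.archi_bound (N1 / K).
have hn : (N1 / K < 2 ^+ n)%R by exact: upper_nthrootP.
apply: mono (H n).
have : (N1 / 2 ^+ n <= K)%R.
  by rewrite ler_pdivrMr ?exprn_gt0// mulrC -ler_pdivrMr// ltW.
lra.
Qed.

Lemma slice_const_gt0 : (0 < slice_const :> R)%R.
Proof.
rewrite /slice_const; apply: addr_gt0; last by rewrite ltr0n.
apply: addr_gt0; first by rewrite ltr0n.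
by apply: mulr_gt0; [rewrite ltr0n|apply: exprn_gt0; rewrite ltr0n].
Qed.

(** The small parameters make the absorbed terms add up to [N / 4]: [72 M / (576 M) = 1/8], and the
    two uses of [young34] give [(1 + 2) * 6 M c / (144 M c) = 1/8]. The remainders use
    [(rho d)^4 = r d^4]. *)
Let flux_arithmetic (M c k N r rho nu d q : R) : (0 < M -> 0 < c -> 0 < k ->
  0 < r -> 0 < d -> 0 < q -> nu ^+ 4 = N -> rho ^+ 4 = r ->
  nu * (rho * d) ^+ 3 <= (144 * (M * c))^-1 * nu ^+ 4 + k * (rho * d) ^+ 4 ->
  nu * (rho * q) ^+ 3 <= (144 * (M * c))^-1 * nu ^+ 4 + k * (rho * q) ^+ 4 ->
  72 * M * (576 * M)^-1 * nu ^+ 4 + 10 * (4 * M + 36 * M ^+ 3 * (576 * M)^-1) * r * d ^+ 2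
   + 6 * M * c * (nu * rho ^+ 3) * (d ^+ 3 + 2 * q ^+ 3) <=
  N / 4 + (10 * (4 * M + 36 * M ^+ 3 * (576 * M)^-1) + 12 * (M * c) * k) * r *
    (d ^+ 2 + d ^+ 4 + q ^+ 4))%R.
Proof.
move=> M0 c0 k0 r0 d0 q0 nuE rhoE y1 y2.
have Mc0 : (0 < M * c)%R by exact: mulr_gt0.
have Mc6 : (0 <= 6 * (M * c))%R by apply: mulr_ge0; [rewrite ler0n|exact: ltW].
have z1 := ler_wpM2l Mc6 y1; have z2 := ler_wpM2l Mc6 y2.
have E1 : (72 * M * (576 * M)^-1 * nu ^+ 4 = N / 8)%R.
  by rewrite nuE; field; rewrite gt_eqF.
have E2 (a : R) : (6 * (M * c) * ((144 * (M * c))^-1 * nu ^+ 4 + k * (rho * a) ^+ 4) =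
    N / 24 + 6 * (M * c) * k * (r * a ^+ 4))%R.
  by rewrite nuE -rhoE; field; rewrite (gt_eqF M0) (gt_eqF c0).
rewrite {}E1; rewrite E2 in z1; rewrite E2 in z2.
set A := (10 * _)%R.
have A0 : (0 <= A)%R.
  apply: mulr_ge0; first by rewrite ler0n.
  apply: addr_ge0; first by apply: mulr_ge0; [rewrite ler0n|exact: ltW].
  apply: mulr_ge0; first by apply: mulr_ge0; [rewrite ler0n|apply: exprn_ge0; exact: ltW].
  by rewrite invr_ge0; apply: mulr_ge0; [rewrite ler0n|exact: ltW].
have p4 (x : R) : (0 < x)%R -> (0 <= r * x ^+ 4)%R.
  by move=> x0; apply: mulr_ge0; [|apply: exprn_ge0]; exact: ltW.
have Mck : (0 <= M * c * k)%R by apply: mulr_ge0; exact: ltW.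
have d2 : (0 <= r * d ^+ 2)%R by apply: mulr_ge0; [exact: ltW|exact: sqr_ge0].
have h1 := mulr_ge0 A0 (p4 _ d0); have h2 := mulr_ge0 A0 (p4 _ q0).
have h3 := mulr_ge0 Mck (p4 _ d0); have h4 := mulr_ge0 Mck d2.
move: z1 z2 h1 h2 h3 h4; clear; move: A => A.
lra.
Qed.

Lemma flux_absorbed (M : R) : (1 <= M)%R -> cut_derivatives_le M ->
  exists2 K : R, (0 < K)%R &
  forall (x0 : R3 R) (t0 : R) u p Du, suitable_weak_solution (x0, t0) u p Du ->
  forall r N d q : R, (0 < r < 1)%R -> (0 < N)%R -> (0 < d)%R -> (0 < q)%R ->
  (\forall t \ae leb, time_itv t0 1 t -> cut_energy x0 t0 u r t <= N%:E) ->
  \int[leb]_(t in time_itv t0 1) dissipation x0 t0 Du r t <= N%:E ->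
  C_infty (x0, t0) r u <= (d ^+ 3)%:E -> D_infty (x0, t0) r p <= (q ^+ 3)%:E ->
  \int[leb]_(t in time_itv t0 r) \int[leb3 R]_x (flux x0 t0 u p r M (x, t))%:E <=
  (N / 4 + K * r * (d ^+ 2 + d ^+ 4 + q ^+ 4))%:E.
Proof.
move=> M1 HM; have M0 : (0 < M)%R := lt_le_trans ltr01 M1.
have c5 : (0 < 576 * M)%R by apply: mulr_gt0; [rewrite ltr0n|exact: M0].
have e0 : (0 < (576 * M)^-1)%R by rewrite invr_gt0.
have [c c0 hc] := weighted_young slice_const_gt0 e0.
have Mc0 : (0 < M * c)%R by exact: mulr_gt0.
have f0 : (0 < (144 * (M * c))^-1 :> R)%R.
  by rewrite invr_gt0; apply: mulr_gt0; [rewrite ltr0n|exact: Mc0].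
have [k k0 hk] := young34 f0.
have K1 : (0 < 10 * (4 * M + 36 * M ^+ 3 * (576 * M)^-1))%R.
  apply: mulr_gt0; first by rewrite ltr0n.
  apply: addr_gt0; first by apply: mulr_gt0; [rewrite ltr0n|exact: M0].
  apply: mulr_gt0; last exact: e0.
  by apply: mulr_gt0; [rewrite ltr0n|exact: exprn_gt0].
have K2 : (0 < 12 * (M * c) * k)%R.
  apply: mulr_gt0; last exact: k0.
  by apply: mulr_gt0; [rewrite ltr0n|exact: Mc0].
exists (10 * (4 * M + 36 * M ^+ 3 * (576 * M)^-1) + 12 * (M * c) * k)%R; first exact: addr_gt0.
move=> x0 t0 u p Du sol r N d q /andP[r0 r1] N0 d0 q0 hN hD hC hDi.
have [nu nu0 nuE] := exists_root 3 N0; have [rho rho0 rhoE] := exists_root 3 r0.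
rewrite -nuE in hN hD.
have := total_flux_le sol r0 r1 M1 HM e0 c0 hc (esym rhoE) rho0 nu0 d0 hN hD hC hDi.
move=> /le_trans; apply; rewrite lee_fin.
exact: (flux_arithmetic M0 c0 k0 r0 d0 q0 nuE rhoE (hk nu (rho * d)%R nu0 (mulr_gt0 rho0 d0))
  (hk nu (rho * q)%R nu0 (mulr_gt0 rho0 q0))).
Qed.

End absorption.

(** * From the energy bound to the theorem *)

Section conclusion.
Context {R : realType}.
Local Open Scope ereal_scope.
Local Notation leb := (@lebesgue_measure R).
Local Notation T1 := (measurableTypeR R).

Lemma ae_neq (a : R) : \forall t \ae leb, (t != a)%R.
Proof.
have h : leb.-negligible ([set a] : set T1).
  by apply/negligibleP => //; exact: lebesgue_measure_set1.
by apply: negligibleS h => t /= /negP; rewrite negbK => /eqP.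
Qed.

Lemma pcyl_subset (z0 : R4 R) (r s : R) : (0 <= r <= s)%R -> pcyl z0 r `<=` pcyl z0 s.
Proof.
move=> /andP[r0 rs] z [/= zx]; rewrite /time_itv /= in_itv/= => /andP[t1 t2].
split; first exact: lt_le_trans rs.
rewrite /time_itv /= in_itv/= t2 andbT; apply: le_lt_trans t1.
by rewrite lerD2l lerN2; apply: lerXn2r => //; rewrite nnegrE// (le_trans r0).
Qed.

Section energy_bound.
Variables (x0 : R3 R) (t0 : R) (u : R4 R -> 'rV[R]_3) (p : R4 R -> R)
  (Du : R4 R -> 'M[R]_3).
Hypothesis sol : suitable_weak_solution (x0, t0) u p Du.
Variables (r : R).
Hypothesis r0 : (0 < r)%R.
Hypothesis r1 : (r < 1)%R.

Local Notation T := (time_itv t0 1).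
Local Notation zt := (zeta x0 t0 r).

Let measurable_zeta_gradient2 : measurable_fun setT
  (fun z : mR4 R => (zt z ^+ 2 * gradient2 x0 t0 Du z)%:E).
Proof.
apply/measurable_EFinP; apply: measurable_funM; last exact: measurable_gradient2 sol.
by apply: measurable_funX; exact: measurable_zeta.
Qed.

Let zeta_gradient2_ge0 z : 0 <= (zt z ^+ 2 * gradient2 x0 t0 Du z)%:E.
Proof. by rewrite lee_fin mulr_ge0 ?sqr_ge0 ?gradient2_ge0. Qed.

Let dissipation_ge0 t : 0 <= dissipation x0 t0 Du r t.
Proof. by apply: integral_ge0 => x _; exact: zeta_gradient2_ge0. Qed.

Let measurable_dissipation : measurable_fun setT (dissipation x0 t0 Du r : T1 -> \bar R).
Proof. exact: (@measurable_slice_integral _ setT _ _ measurable_zeta_gradient2). Qed.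

Let dissipationE (I : set T1) : measurable I ->
  \int[leb]_(t in I) dissipation x0 t0 Du r t =
  \int[leb4 R]_(z in setT `*` I) (zt z ^+ 2 * gradient2 x0 t0 Du z)%:E.
Proof.
by move=> mI; rewrite (tonelli4 measurableT mI measurable_zeta_gradient2 zeta_gradient2_ge0).
Qed.

Let mT : measurable (T : set T1). Proof. exact: measurable_itv. Qed.

Definition energy_bound (N : R) : Prop :=
  (\forall t \ae leb, T t -> cut_energy x0 t0 u r t <= N%:E) /\
  \int[leb]_(t in T) dissipation x0 t0 Du r t <= N%:E.

Lemma energy_bound_mono N N' : (N <= N')%R -> energy_bound N -> energy_bound N'.
Proof.
move=> NN' [h1 h2]; split; last by apply: le_trans h2 _; rewrite lee_fin.
move: h1; apply: (@filterS _ _ (ae_filter_ringOfSetsType leb)) => t h tT.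
by apply: le_trans (h tT) _; rewrite lee_fin.
Qed.

(** The starting point of the iteration, supplied by the energy class of [u]; its size leaves no
    trace in the final bound. *)
Lemma energy_bound_exists : exists N, energy_bound N.
Proof.
have [y aey yoo] := ereal_inf_lt (sws_u_Linfty_L2 sol).
have fin := sws_u_L2_W12 sol; set W := \int[_]_(z in _) _ in fin.
have W0 : 0 <= W.
  apply: integral_ge0 => z _; rewrite lee_fin addr_ge0//.
    by apply: sumr_ge0 => i _; exact: sqr_ge0.
  by do 2! (apply: sumr_ge0 => ? _); exact: sqr_ge0.
(* The essential bound [y] is only known to be below [+oo]; its maximum with 0 is finite. *)
exists (fine (maxe y 0) + fine W)%R.
have WE : W = (fine W)%:E by rewrite fineK// ge0_fin_numE.
have mE : maxe y 0 = (fine (maxe y 0))%:E.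
  by rewrite fineK// ge0_fin_numE ?le_max ?lexx ?orbT// gt_max yoo/= ltry.
split.
  move: aey; apply: (@filterS _ _ (ae_filter_ringOfSetsType leb)) => t h tT.
  apply: (@le_trans _ _ y).
    apply: le_trans (h tT); rewrite (@integral_speed2 R x0 t0 u t tT).
    apply: le_integral_ge0 => x _; rewrite lee_fin.
      by rewrite mulr_ge0 ?sqr_ge0 ?speed2_ge0.
    apply: ler_piMl; first exact: speed2_ge0.
    by apply: exprn_ile1; [exact: zeta_ge0|exact: zeta_le1].
  apply: (@le_trans _ _ (maxe y 0)); first by rewrite le_max lexx.
  by rewrite mE lee_fin lerDl fine_ge0.
rewrite dissipationE//; apply: (@le_trans _ _ W); last first.
  by rewrite [X in X <= _]WE lee_fin lerDr fine_ge0// le_max lexx orbT.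
rewrite [leLHS]integral_mkcond /W [leRHS]integral_mkcond; apply: le_integral_ge0 => z _.
  by rewrite patchE; case: ifP.
have mx0 (A : 'M[R]_3) : (0 <= mx_sqnorm A)%R.
  by do 2! (apply: sumr_ge0 => ? _); exact: sqr_ge0.
have sq0 (v : 'rV[R]_3) : (0 <= sqnorm v)%R by apply: sumr_ge0 => i _; exact: sqr_ge0.
rewrite !patchE; case: (boolP (z \in pcyl (x0, t0) 1)) => [/set_mem zQ|/negP zQ]; last first.
  by rewrite gradient2_out ?mulr0 ?if_same// => zQ'; apply: zQ; exact/mem_set.
case: ifPn => _; last by rewrite lee_fin addr_ge0.
rewrite lee_fin gradient2E//; apply: (@le_trans _ _ (mx_sqnorm (Du z))); last by rewrite lerDr.
by apply: ler_piMl => //; apply: exprn_ile1; [exact: zeta_ge0|exact: zeta_le1].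
Qed.

(** Both terms on the left of [local_energy] are nonnegative, so each is bounded by the flux; for
    the dissipation the bound extends to the full interval by [integral_exhaustion]. *)
Lemma energy_bound_step (M K N : R) : (1 <= M)%R ->
  cut_derivatives_le M ->
  (0 <= K)%R -> (0 < N)%R ->
  \int[leb]_(t in time_itv t0 r) \int[leb3 R]_x (flux x0 t0 u p r M (x, t))%:E <=
    (N / 4 + K)%:E -> energy_bound (N / 2 + K).
Proof.
move=> M1 HM K0 N0 HF.
have le4 : (N / 4 + K <= N / 2 + K)%R by rewrite lerD2r ler_pM2l// lef_pV2 ?posrE// ler_nat.
have LE := local_energy sol r0 r1 M1 HM.
split.
  move: LE; apply: (@filterS _ _ (ae_filter_ringOfSetsType leb)) => t h tT.
  have {h} := le_trans (h tT) HF; move=> /(le_trans _) h.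
  apply: (@le_trans _ _ (N / 4 + K)%:E); last by rewrite lee_fin.
  apply: h; apply: leeDl; apply: mule_ge0 => //; exact: integral_ge0.
rewrite /time_itv expr1n; apply: integral_exhaustion => //.
  by rewrite ltrBlDr ltrDl.
move: LE; apply: (@filterS _ _ (ae_filter_ringOfSetsType leb)) => t h tT.
have tT' : T t by rewrite /time_itv /= in_itv/= expr1n.
have := le_trans (h tT') HF.
have ce0 : 0 <= cut_energy x0 t0 u r t.
  by apply: integral_ge0 => x _; rewrite lee_fin mulr_ge0 ?sqr_ge0 ?speed2_ge0.
move=> /(le_trans (leeDr _ ce0)) hh.
apply: (@le_trans _ _ (N / 4 + K)%:E); last by rewrite lee_fin.
apply: le_trans hh; have I0 : 0 <= \int[leb]_(s in `](t0 - 1)%R, t[) dissipation x0 t0 Du r s.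
  exact: integral_ge0.
by apply: lee_pemull => //; rewrite lee_fin ler1n.
Qed.

Variable c : R.
Hypothesis c0 : (0 < c)%R.
Hypothesis cut_c : forall s, (`|s| <= 1 / 2 -> c <= cut s)%R.

Let zeta_sqr_lower z : pcyl (x0, t0) (r / 2) z -> (1 <= c ^- 8 * zt z ^+ 2)%R.
Proof.
move=> zQ; have h := zeta_lower_bound r0 cut_c c0 zQ.
have c4 : (0 < c ^+ 4)%R by exact: exprn_gt0.
have h2 : ((c ^+ 4) ^+ 2 <= zt z ^+ 2)%R.
  by apply: lerXn2r; rewrite ?nnegrE ?(ltW c4)//; exact: zeta_ge0.
by rewrite mulrC ler_pdivlMr ?exprn_gt0// mul1r; move: h2; rewrite -exprM.
Qed.

Let half_pcyl : pcyl (x0, t0) (r / 2) `<=` pcyl (x0, t0) 1.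
Proof.
apply: pcyl_subset; rewrite divr_ge0 ?(ltW r0)//= ler_pdivrMr// mul1r.
by apply: ltW; apply: (lt_trans r1); rewrite ltr1n.
Qed.

Lemma A_quantity_le N : energy_bound N ->
  A_quantity (x0, t0) (r / 2) u <= ((r / 2)^-1 * (c ^- 8 * N))%:E.
Proof.
move=> [h _]; apply: ereal_inf_lbound => /=.
have F := ae_filter_ringOfSetsType leb.
(* [A_quantity] is taken over a closed time interval; its two end points are discarded as a null
   set. *)
have := @filterI _ _ F _ _ h (@filterI _ _ F _ _ (ae_neq t0) (ae_neq (t0 - (r / 2) ^+ 2))).
apply: (@filterS _ _ F) => t [ht [/eqP tn1 /eqP tn2]]; rewrite in_itv/= => /andP[t1 t2].
have tI : time_itv t0 (r / 2) t.
  rewrite /time_itv /= in_itv/= !lt_neqAle t1 t2 !andbT; apply/andP; split; apply/eqP => //.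
  by move=> e; apply: tn2.
have tT : T t.
  have [_] // : pcyl (x0, t0) 1 (x0, t).
  apply: half_pcyl; split => //=; rewrite /eball /= /Defs.edist !subrr expr0n/= !addr0 sqrtr0.
  by rewrite divr_gt0.
have cN : 0 <= (c ^- 8)%:E by rewrite lee_fin invr_ge0 exprn_ge0 ?ltW.
rewrite EFinM; apply: lee_wpmul2l; first by rewrite lee_fin invr_ge0 divr_ge0 ?ltW.
rewrite EFinM; apply: le_trans (lee_wpmul2l cN (ht tT)).
rewrite /cut_energy -ge0_integralZl_EFin//; last 2 first.
- by move=> x _; rewrite lee_fin mulr_ge0 ?sqr_ge0 ?speed2_ge0.
- have pm : measurable_fun setT (fun x : mR3 R => (x, t) : mR4 R) by exact: pair2_measurable.
  apply/measurable_EFinP; apply: measurable_funM.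
    by apply: measurable_funX; exact: (measurableT_comp (measurable_zeta x0 t0 r) pm).
  exact: (measurableT_comp (measurable_speed2 sol) pm).
have sq0 (v : 'rV[R]_3) : (0 <= sqnorm v)%R by apply: sumr_ge0 => i _; exact: sqr_ge0.
rewrite [leLHS]integral_mkcond; apply: le_integral_ge0 => x _.
  by rewrite patchE; case: ifP => // _; rewrite lee_fin.
rewrite patchE; case: ifPn => [/set_mem xr|_]; last first.
  by rewrite mule_ge0// lee_fin mulr_ge0 ?sqr_ge0 ?speed2_ge0.
have zQ : pcyl (x0, t0) (r / 2) (x, t) by [].
have zQ1 : pcyl (x0, t0) 1 (x, t) by exact: half_pcyl.
rewrite -EFinM lee_fin -(speed2E u zQ1) mulrA.
by apply: ler_peMl; [exact: speed2_ge0|exact: zeta_sqr_lower].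
Qed.

Lemma B_quantity_le N : energy_bound N ->
  B_quantity (x0, t0) (r / 2) Du <= ((r / 2)^-1 * (c ^- 8 * N))%:E.
Proof.
move=> [_ h]; have cN : 0 <= (c ^- 8)%:E by rewrite lee_fin invr_ge0 exprn_ge0 ?ltW.
rewrite /B_quantity EFinM; apply: lee_wpmul2l; first by rewrite lee_fin invr_ge0 divr_ge0 ?ltW.
rewrite EFinM; apply: le_trans (lee_wpmul2l cN h).
rewrite dissipationE//.
have mX : measurable (setT `*` T : set (mR4 R)) by exact: measurableX.
rewrite -ge0_integralZl_EFin//; last first.
  exact: measurable_funTS measurable_zeta_gradient2.
have mx0 (A : 'M[R]_3) : (0 <= mx_sqnorm A)%R.
  by do 2! (apply: sumr_ge0 => ? _); exact: sqr_ge0.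
rewrite [leLHS]integral_mkcond [leRHS]integral_mkcond; apply: le_integral_ge0 => z _.
  by rewrite patchE; case: ifP => // _; rewrite lee_fin.
rewrite !patchE; case: ifPn => [/set_mem zQ|_]; last by case: ifP => // _; exact: mule_ge0.
have zQ1 : pcyl (x0, t0) 1 z by exact: half_pcyl.
rewrite ifT; last by apply/mem_set; split => //; case: zQ1.
rewrite -EFinM lee_fin -(gradient2E Du zQ1) mulrA.
by apply: ler_peMl; [exact: gradient2_ge0|exact: zeta_sqr_lower].
Qed.

End energy_bound.

Lemma energy_estimate : exists2 K : R, (0 < K)%R &
  forall (x0 : R3 R) (t0 : R) (u : R4 R -> 'rV[R]_3) (p : R4 R -> R) (Du : R4 R -> 'M[R]_3),
  suitable_weak_solution (x0, t0) u p Du ->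
  forall r d q : R, (0 < r)%R -> (r < 1)%R -> (0 < d)%R -> (0 < q)%R ->
  C_infty (x0, t0) r u <= (d ^+ 3)%:E -> D_infty (x0, t0) r p <= (q ^+ 3)%:E ->
  A_quantity (x0, t0) (r / 2) u + B_quantity (x0, t0) (r / 2) Du <=
  (K * (d ^+ 2 + d ^+ 4 + q ^+ 4))%:E.
Proof.
have [M M1 HM] := @cut_bounds R; have [c c0 cut_c] := @cut_lower_bound R.
have [K K0 HK] := flux_absorbed M1 HM.
have cK0 : (0 < 12 * c ^- 8 * K)%R.
  apply: mulr_gt0; last exact: K0.
  by apply: mulr_gt0; [rewrite ltr0n|rewrite invr_gt0 exprn_gt0].
(* The factors are 2 for the two quantities, [2 / r] for the inverse of the half radius, [c^-8] for
   the lower bound of [zeta^2], and [3 K r] from the iteration. *)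
exists (12 * c ^- 8 * K)%R; first exact: cK0.
move=> x0 t0 u p Du sol r d q r0 r1 d0 q0 hC hD.
set s := (d ^+ 2 + d ^+ 4 + q ^+ 4)%R.
have s0 : (0 < s)%R.
  by apply: addr_gt0; [apply: addr_gt0|]; exact: exprn_gt0.
have Ks0 : (0 < K * r * s)%R by apply: mulr_gt0; [exact: mulr_gt0|].
have [N0 hN0] := energy_bound_exists sol r.
have r01 : (0 < r < 1)%R by rewrite r0.
have hb : energy_bound x0 t0 u Du r (3 * (K * r * s)).
  apply: (iterate_halving Ks0 hN0).
    by move=> N N'; exact: energy_bound_mono.
  move=> N N_gt0 hN; apply: (energy_bound_step sol r0 r1 M1 HM (ltW Ks0) N_gt0).
  by case: hN => h1 h2; exact: (HK _ _ _ _ _ sol _ _ _ _ r01 N_gt0 d0 q0 h1 h2 hC hD).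
apply: le_trans (leeD (A_quantity_le sol r0 r1 c0 cut_c hb)
  (B_quantity_le sol r0 r1 c0 cut_c hb)) _.
rewrite -EFinD lee_fin le_eqVlt; apply/orP; left; apply/eqP; field.
by rewrite (gt_eqF r0) (gt_eqF c0).
Qed.

Lemma expr_shift (e t : R) : (0 <= e)%R -> (0 <= t <= 1)%R ->
  ((e + t) ^+ 2 <= e ^+ 2 + (2 * e + 1) * t /\
   (e + t) ^+ 4 <= e ^+ 4 + (4 * e ^+ 3 + 6 * e ^+ 2 + 4 * e + 1) * t)%R.
Proof.
move=> e0 /andP[t0 t1].
have t2 : (t ^+ 2 <= t)%R by rewrite expr2; exact: ler_piMl.
have t3 : (t ^+ 3 <= t)%R by rewrite exprS; apply: ler_piMr => //; exact: exprn_ile1.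
have t4 : (t ^+ 4 <= t)%R by rewrite exprS; apply: ler_piMr => //; exact: exprn_ile1.
have e2 : (0 <= 6 * e ^+ 2)%R by rewrite mulr_ge0 ?sqr_ge0.
have e3 : (0 <= 4 * e)%R by rewrite mulr_ge0.
have h2 := ler_wpM2l e2 t2; have h3 := ler_wpM2l e3 t3.
split.
  rewrite (_ : (e + t) ^+ 2 = e ^+ 2 + 2 * e * t + t ^+ 2)%R; last by ring.
  lra.
rewrite (_ : (e + t) ^+ 4 = e ^+ 4 + 4 * e ^+ 3 * t + 6 * e ^+ 2 * t ^+ 2
  + 4 * e * t ^+ 3 + t ^+ 4)%R; last by ring.
lra.
Qed.

(** The energy estimate requires positive [d] and [q], whereas the scale-invariant quantities may
    vanish. Shifting [a] and [b] by [t <= 1] costs an error linear in [t], with slope at most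
    [K * Ba], which tends to 0. *)
Lemma le_limit_estimate (X : \bar R) (K a b : R) : (0 < K)%R -> (0 <= a)%R -> (0 <= b)%R ->
  (forall d q, (a < d)%R -> (b < q)%R -> X <= (K * (d ^+ 2 + d ^+ 4 + q ^+ 4))%:E) ->
  X <= (K * (a ^+ 2 + a ^+ 4 + b ^+ 4))%:E.
Proof.
move=> K0 a0 b0 H.
pose Ba := (2 * a + 1 + (4 * a ^+ 3 + 6 * a ^+ 2 + 4 * a + 1)
  + (4 * b ^+ 3 + 6 * b ^+ 2 + 4 * b + 1))%R.
have Ba0 : (0 <= Ba)%R.
  have P (x : R) : (0 <= x)%R -> (0 <= 4 * x ^+ 3 + 6 * x ^+ 2 + 4 * x + 1)%R.
    by move=> x0; rewrite !addr_ge0 ?mulr_ge0 ?exprn_ge0.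
  by rewrite /Ba addr_ge0 ?P// addr_ge0 ?P// addr_ge0// mulr_ge0.
have := @le_EFin_affine R X (K * (a ^+ 2 + a ^+ 4 + b ^+ 4)) (K * Ba) 0.
rewrite mulr0 addr0; apply; first by rewrite mulr_ge0// ltW.
move=> d d0; rewrite add0r; set t := Num.min d 1%R.
have t0 : (0 < t)%R by rewrite lt_min d0 ltr01.
have t01 : (0 <= t <= 1)%R by rewrite (ltW t0) ge_min lexx orbT.
have td : (t <= d)%R by rewrite ge_min lexx.
have h1 : (a < a + t)%R by rewrite ltrDl.
have h2 : (b < b + t)%R by rewrite ltrDl.
apply: le_trans (H _ _ h1 h2) _; rewrite lee_fin.
have [x2 x4] := expr_shift a0 t01; have [_ y4] := expr_shift b0 t01.
rewrite -[(K * Ba * d)%R]mulrA -[leRHS]mulrDr ler_pM2l//.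
have := ler_wpM2l Ba0 td; rewrite /Ba; lra.
Qed.

End conclusion.

Theorem lemma2p4 (R : realType) :
  exists c : R,
    forall (x0 : R3 R) (t0 : R)
      (u : R4 R -> 'rV[R]_3) (p : R4 R -> R) (Du : R4 R -> 'M[R]_3),
      suitable_weak_solution (x0, t0) u p Du ->
      forall r : R, 0 < r -> r < 1 ->
        (A_quantity (x0, t0) (r / 2) u + B_quantity (x0, t0) (r / 2) Du
         <= c%:E * (C_infty (x0, t0) r u `^ (4 / 3)
                    + C_infty (x0, t0) r u `^ (2 / 3)
                    + D_infty (x0, t0) r p `^ (4 / 3)))%E.
Proof.
have [K K0 HK] := @energy_estimate R.
exists K => x0 t0 u p Du sol r r0 r1.
have C0 : (0 <= C_infty (x0, t0) r u)%E.
  apply: mule_ge0; first by rewrite lee_fin invr_ge0 exprn_ge0// ltW.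
  by apply: integral_ge0 => t _; exact: poweR_ge0.
have D0 : (0 <= D_infty (x0, t0) r p)%E.
  apply: mule_ge0; first by rewrite lee_fin invr_ge0 exprn_ge0// ltW.
  by apply: integral_ge0 => t _; exact: poweR_ge0.
have H := fun d q d0 q0 => HK x0 t0 u p Du sol r d q r0 r1 d0 q0.
move: (A_quantity _ _ _ + B_quantity _ _ _)%E H => X.
move: (C_infty _ _ _) (D_infty _ _ _) C0 D0 => C D C0 D0 H.
have p43 : 0 < 4 / 3 :> R by rewrite divr_gt0.
have p23 : 0 < 2 / 3 :> R by rewrite divr_gt0.
have ninfty (y : \bar R) : (0 <= y)%E -> y != -oo%E by move=> y0; rewrite gt_eqF// (lt_le_trans _ y0).
have Kinfty : (X <= K%:E * +oo)%E by rewrite gt0_muley ?lte_fin// leey.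
(* If either quantity is infinite, the right side is [+oo] because [K] is positive. *)
have [Coo|Cfin] := eqVneq C +oo%E.
  by rewrite (eqy_poweR p43 Coo) addye ?ninfty ?poweR_ge0// addye ?ninfty ?poweR_ge0.
have [Doo|Dfin] := eqVneq D +oo%E.
  by rewrite (eqy_poweR p43 Doo) addey// ninfty// adde_ge0 ?poweR_ge0.
(* Cube roots [a] and [b] of the two quantities turn the fractional powers into [a^4], [a^2] and
   [b^4], the form of [energy_estimate]. *)
have root (y : R) : 0 <= y -> exists2 a, 0 <= a &
    [/\ a ^+ 3 = y, y `^ (2 / 3) = a ^+ 2 & y `^ (4 / 3) = a ^+ 4].
  move=> y0; have a0 : 0 <= y `^ (3^-1) by exact: powR_ge0.
  have E (n : nat) : (y `^ (3^-1)) ^+ n = y `^ (n%:R / 3).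
    by rewrite -powR_mulrn// -powRrM mulrC.
  exists (y `^ (3^-1)) => //; split; [by rewrite E divff// powRr1|by rewrite E|by rewrite E].
have fin (Z : \bar R) : (0 <= Z)%E -> Z != +oo%E -> exists2 z, 0 <= z & Z = z%:E.
  by move=> Z0 Zfin; exists (fine Z); [exact: fine_ge0|rewrite fineK// ge0_fin_numE// ltey].
have [y y0 CE] := fin _ C0 Cfin; have [z z0 DE] := fin _ D0 Dfin.
have [a a0 [a3 a2 a4]] := root _ y0; have [b b0 [b3 _ b4]] := root _ z0.
move: H; rewrite CE DE !poweR_EFin a2 a4 b4 -a3 -b3 -!EFinD -EFinM [_ ^+ 4 + _ ^+ 2]addrC => H.
apply: le_limit_estimate => // d q ad bq.
have cube_le (v w : R) : 0 <= v -> v < w -> v ^+ 3 <= w ^+ 3.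
  by move=> v0 vw; apply: lerXn2r; rewrite ?nnegrE ?(ltW vw)// (le_trans v0) ?ltW.
apply: H; rewrite ?lee_fin ?cube_le//; [exact: le_lt_trans ad|exact: le_lt_trans bq].
Qed.
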